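(* Let $T>0$, $M>0$, $0<\delta\le\tfrac12$. Let $\lambda\colon[0,T]\to\mathbb{R}$ satisfy $\|\lambda\|_{\mathrm{Lip}(1/2)}\le1$, $\lambda\in C^{1,\frac12+\delta}([0,T])$ and $\|\lambda\|_{C^{1,\frac12+\delta}([0,T])}\le M$. Then the slit $\gamma=\gamma^\lambda$ generated by $\lambda$ is $C^{2,\delta}$ regular on $[a,T]$ for every $a\in(0,T)$. The statement is quantitative in the sense that $$\|\gamma\|_{C^{2,\delta}([a,T])}\le N\qquad\text{and}\qquad\inf_{t\in[a,T]}|\gamma'(t)|\ge\frac1N,$$ where $N=N(M,T,\delta,a)>0$ depends only on $M,T,\delta,a$.
   Context: Let $\mathbb{H}=\{z\in\mathbb{C}:\operatorname{Im} z>0\}$. For a continuous $\lambda\colon[0,T]\to\mathbb{R}$ (a driving function), let $g_t(z)$ be the solution of the chordal Loewner equation $\partial_t g_t(z)=\frac{2}{g_t(z)-\lambda(t)}$, $g_0(z)=z$, and let $H_t$ be the set of $z\in\mathbb{H}$ for which the solution is well defined up to time $t$ (i.e. $g_s(z)\ne\lambda(s)$ for $s\in[0,t]$). Then $g_t\colon H_t\to\mathbb{H}$ is conformal. Put $\|\lambda\|_{\mathrm{Lip}(1/2)}=\sup_{t_1\ne t_2\in[0,T]}|\lambda(t_1)-\lambda(t_2)|/|t_1-t_2|^{1/2}$. It is known (Marshall–Rohde, Lind) that if $\|\lambda\|_{\mathrm{Lip}(1/2)}<4$, then $\lambda$ generates a slit $\gamma=\gamma^{\lambda}\colon[0,T]\to\overline{\mathbb{H}}$: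 a simple curve with $\gamma(0)=\lambda(0)\in\mathbb{R}$, $\gamma(t)\in\mathbb{H}$ for $0<t\le T$, and $H_t=\mathbb{H}\setminus\gamma([0,t])$ for all $t$; moreover $\gamma(t)=\lim_{y\downarrow0}g_t^{-1}(\lambda(t)+iy)$. For a function $\phi$ on a closed interval $I$, $n\in\mathbb{N}$, $0<\alpha\le1$: $\|\phi\|_{C^{n,\alpha}(I)}=\sum_{k=0}^n\sup_I|\phi^{(k)}|+\sup_{t_1\ne t_2\in I}\frac{|\phi^{(n)}(t_1)-\phi^{(n)}(t_2)|}{|t_1-t_2|^\alpha}$, with one-sided derivatives at endpoints. A curve is ''$C^{n,\alpha}$ regular'' on $I$ if its $C^{n,\alpha}(I)$ norm is finite and its derivative is nonzero everywhere on $I$. *)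

(* Defs.v *)
From Stdlib Require Import Reals.
From Coquelicot Require Import Coquelicot.

Open Scope R_scope.

(** Functions on a closed interval [[a, b]] are represented by total functions
    on [R]; every notion below only looks at their values on [[a, b]]. *)

Definition Icc (a b t : R) : Prop := a <= t <= b.

(** Derivative relative to [[a, b]]: it is the two-sided derivative in the
    interior and the one-sided derivative at the endpoints (compare
    [is_derive], which uses the filter [locally t]). *)
Definition is_derive_on {V : NormedModule R_AbsRing} (a b : R)
    (phi : R -> V) (t : R) (l : V) : Prop :=
  filterdiff phi (within (Icc a b) (locally t)) (fun h : R => scal h l).

Definition ex_derive_on {V : NormedModule R_AbsRing} (a b : R)
    (phi : R -> V) (t : R) : Prop :=
  exists l : V, is_derive_on a b phi t l.

(** When [a < b] and [t] is in [[a, b]], the derivative is unique if it exists,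
    and [iota] selects it. *)
Definition Derive_on {V : CompleteNormedModule R_AbsRing} (a b : R)
    (phi : R -> V) (t : R) : V :=
  iota (fun l : V => is_derive_on a b phi t l).

Fixpoint Derive_n_on {V : CompleteNormedModule R_AbsRing} (a b : R)
    (phi : R -> V) (n : nat) : R -> V :=
  match n with
  | O => phi
  | S m => Derive_on a b (Derive_n_on a b phi m)
  end.

Definition ex_derive_n_on {V : CompleteNormedModule R_AbsRing} (a b : R)
    (phi : R -> V) (n : nat) : Prop :=
  forall (k : nat) (t : R), (k < n)%nat -> Icc a b t ->
    ex_derive_on a b (Derive_n_on a b phi k) t.

Definition sup_norm_on {V : NormedModule R_AbsRing} (a b : R)
    (phi : R -> V) : Rbar :=
  Lub_Rbar (fun y : R => exists t : R, Icc a b t /\ y = norm (phi t)).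

Definition inf_norm_on {V : NormedModule R_AbsRing} (a b : R)
    (phi : R -> V) : Rbar :=
  Glb_Rbar (fun y : R => exists t : R, Icc a b t /\ y = norm (phi t)).

Definition holder_seminorm {V : NormedModule R_AbsRing} (a b alpha : R)
    (phi : R -> V) : Rbar :=
  Lub_Rbar (fun y : R => exists t1 t2 : R,
    Icc a b t1 /\ Icc a b t2 /\ t1 <> t2 /\
    y = norm (minus (phi t1) (phi t2)) / Rpower (Rabs (t1 - t2)) alpha).

(** [u 0 + ... + u n]. *)
Fixpoint Rbar_sum (u : nat -> Rbar) (n : nat) : Rbar :=
  match n with
  | O => u O
  | S m => Rbar_plus (Rbar_sum u m) (u (S m))
  end.

(** For [a < b] all the suprema are taken over nonempty sets of nonnegative
    numbers, so that no sum of opposite infinities occurs. *)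
Definition C_norm {V : CompleteNormedModule R_AbsRing} (a b : R) (n : nat)
    (alpha : R) (phi : R -> V) : Rbar :=
  Rbar_plus
    (Rbar_sum (fun k : nat => sup_norm_on a b (Derive_n_on a b phi k)) n)
    (holder_seminorm a b alpha (Derive_n_on a b phi n)).

Definition C_class {V : CompleteNormedModule R_AbsRing} (a b : R) (n : nat)
    (alpha : R) (phi : R -> V) : Prop :=
  ex_derive_n_on a b phi n /\ is_finite (C_norm a b n alpha phi).

Definition C_regular {V : CompleteNormedModule R_AbsRing} (a b : R) (n : nat)
    (alpha : R) (phi : R -> V) : Prop :=
  C_class a b n alpha phi /\
  forall t : R, Icc a b t -> Derive_on a b phi t <> zero.

(** [C] as a real normed space; its norm is the modulus. *)
Notation CR := C_R_CompleteNormedModule.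

(** [s |-> g s] is the solution, on [[0, t]], of the chordal Loewner equation
    driven by [lambda] and started at [z]. *)
Definition loewner_solution (lambda : R -> R) (t : R) (z : C) (g : R -> C)
    : Prop :=
  g 0 = z /\
  forall s : R, Icc 0 t s ->
    g s <> RtoC (lambda s) /\
    is_derive_on (V := CR) 0 t g s
      (Cdiv (RtoC 2) (Cminus (g s) (RtoC (lambda s)))).

(** The domain [H_t]. *)
Definition loewner_domain (lambda : R -> R) (t : R) (z : C) : Prop :=
  0 < Im z /\ exists g : R -> C, loewner_solution lambda t z g.

(** [lambda], on [[0, T]], generates the slit [gamma]. *)
Definition generates_slit (T : R) (lambda : R -> R) (gamma : R -> C) : Prop :=
  (continuous_on (U := CR) (Icc 0 T) gamma /\
   (forall s t : R, Icc 0 T s -> Icc 0 T t -> gamma s = gamma t -> s = t)) /\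
  gamma 0 = RtoC (lambda 0) /\
  (forall t : R, 0 < t <= T -> 0 < Im (gamma t)) /\
  (forall t : R, Icc 0 T t -> forall z : C,
     loewner_domain lambda t z <->
     0 < Im z /\ ~ (exists s : R, Icc 0 t s /\ gamma s = z)).

(* Main.v *)
Require Import Defs.
From Stdlib Require Import Reals.
From Coquelicot Require Import Coquelicot.
From Stdlib Require Import Lra Psatz ClassicalEpsilon.
Open Scope R_scope.

(** For [0 <= r < t] put [W t r = g_r (gamma t) - lambda r], the position at time [r],
    relative to the driving function, of the point that becomes the tip at time [t].
    It satisfies [d/dr (W t r) = 2 / W t r - lambda' r], it tends to [0] as [r] tends
    to [t], and [gamma t = lambda 0 + W t 0].  So everything takes place in a family
    of ordinary differential equations with a singular end point, where [W t r] has
    the size of [sqrt (t - r)].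

    The key remark is that for [t < t'] the difference of the squares
    [W t' r ^ 2 - W t r ^ 2] solves a linear equation, with logarithmic derivative
    [- 2 lambda' / (W t' r + W t r)] ([square_difference]).  At [r = t] it equals
    [W t' t ^ 2], which is [- 4 (t' - t)] up to the power [3/2] of [t' - t].  Letting
    [t'] tend to [t] gives
    [gamma' t = - 2 exp (E t) / (gamma t - lambda 0)], where
    [E t] is the integral over [0 < q < t] of [lambda' q / W t q]
    ([square_first_order], [tip_first_order]).  This bounds [gamma'] from above and
    from below, and it remains to see that [E] is of class C^{1,delta}.

    Differentiating under the integral produces a kernel of size [(t - q) ^ (-3/2)],
    which is not integrable.  But the equation of [W] integrates [1 / W t q]
    explicitly, so a constant [c] may be subtracted from [lambda']; with [c = lambda' t]
    the Hoelder exponent [1/2 + delta] of [lambda'] leaves [(t - q) ^ (delta - 1)],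
    which is integrable ([drift_exponent_first_order]).

    Regularity is always expressed by a uniform first-order expansion: the error in
    [F t' - F t - (t' - t) F' tau] is [O ((t' - t) ^ (1 + delta))], for [tau] equal to
    either end point.  Such an expansion contains both the derivability of [F] and
    the Hoelder continuity of [F'] ([C1_holder]), so no estimate on a difference of
    derivatives is ever needed.  Every integral estimate is the mean value inequality
    for a primitive compared with an explicit real function.  All constants come from
    bounds on [W] that depend only on [T], [M] and [delta] ([tip_flow]); these follow
    from the fact that [gamma t] is swallowed exactly at time [t] ([swallowed]). *)

(** * Complex-valued functions of a real variable *)

(** This notion and the derivative below are componentwise, which reduces their calculus to
    the real one. *)
Definition ccont (F : R -> C) (x : R) : Prop :=
  continuous (fun u => Re (F u)) x /\ continuous (fun u => Im (F u)) x.

Definition cder (F : R -> C) (x : R) (l : C) : Prop :=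
  is_derive (fun u => Re (F u)) x (Re l) /\
  is_derive (fun u => Im (F u)) x (Im l).

Definition cexp (z : C) : C := (exp (Re z) * cos (Im z), exp (Re z) * sin (Im z)).

Lemma is_derive_eq (f : R -> R) (x l l' : R) :
  is_derive f x l -> l = l' -> is_derive f x l'.
Proof. now intros H <-. Qed.

Lemma cder_eq F x l l' : cder F x l -> l = l' -> cder F x l'.
Proof. now intros H <-. Qed.

Lemma cder_ccont F x l : cder F x l -> ccont F x.
Proof.
intros [H1 H2]; split; [apply (ex_derive_continuous (fun u => Re (F u)))
                       |apply (ex_derive_continuous (fun u => Im (F u)))];
  eexists; eassumption.
Qed.

Lemma cder_ext_loc F G x l :
  locally x (fun u => F u = G u) -> cder F x l -> cder G x l.
Proof.
intros H [H1 H2]; split; eapply is_derive_ext_loc; try eassumption;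
  (eapply filter_imp; [|exact H]); cbv beta; intros u ->; reflexivity.
Qed.

Lemma ccont_ext_loc F G x :
  locally x (fun u => F u = G u) -> ccont F x -> ccont G x.
Proof.
intros H [H1 H2]; split.
- apply (continuous_ext_loc (fun u => Re (G u)) (fun u => Re (F u))); [|assumption].
  eapply filter_imp; [|exact H]; cbv beta; intros u ->; reflexivity.
- apply (continuous_ext_loc (fun u => Im (G u)) (fun u => Im (F u))); [|assumption].
  eapply filter_imp; [|exact H]; cbv beta; intros u ->; reflexivity.
Qed.

Lemma ccont_const c x : ccont (fun _ => c) x.
Proof. split; apply continuous_const. Qed.

Lemma ccont_real (f : R -> R) x : continuous f x -> ccont (fun u => RtoC (f u)) x.
Proof. split; [exact H | apply continuous_const]. Qed.

Lemma ccont_plus F G x : ccont F x -> ccont G x -> ccont (fun u => F u + G u)%C x.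
Proof.
intros [H1 H2] [K1 K2]; split.
- apply (continuous_plus (fun u => Re (F u)) (fun u => Re (G u))); assumption.
- apply (continuous_plus (fun u => Im (F u)) (fun u => Im (G u))); assumption.
Qed.

Lemma ccont_opp F x : ccont F x -> ccont (fun u => - F u)%C x.
Proof.
intros [H1 H2]; split.
- apply (continuous_opp (fun u => Re (F u))); assumption.
- apply (continuous_opp (fun u => Im (F u))); assumption.
Qed.

Lemma ccont_minus F G x : ccont F x -> ccont G x -> ccont (fun u => F u - G u)%C x.
Proof. intros; apply ccont_plus; [|apply ccont_opp]; assumption. Qed.

Lemma ccont_mult F G x : ccont F x -> ccont G x -> ccont (fun u => F u * G u)%C x.
Proof.
intros [H1 H2] [K1 K2]; split.
- apply (continuous_minus (fun u => Re (F u) * Re (G u)) (fun u => Im (F u) * Im (G u)));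
  apply (continuous_mult (K := R_AbsRing)); assumption.
- apply (continuous_plus (fun u => Re (F u) * Im (G u)) (fun u => Im (F u) * Re (G u)));
  apply (continuous_mult (K := R_AbsRing)); assumption.
Qed.

Lemma Csqnorm_neq0 (z : C) : z <> RtoC 0 -> Re z ^ 2 + Im z ^ 2 <> 0.
Proof.
intros Hz H. apply Hz. destruct z as [x y]; unfold Re, Im in *; simpl in *.
assert (x = 0) by nra. assert (y = 0) by nra. now subst.
Qed.

Lemma ccont_inv F x : ccont F x -> F x <> RtoC 0 -> ccont (fun u => / F u)%C x.
Proof.
intros [H1 H2] Hz. apply Csqnorm_neq0 in Hz.
assert (Hn : continuous (fun u => / (Re (F u) ^ 2 + Im (F u) ^ 2)) x).
{ apply (continuous_Rinv_comp (fun u => Re (F u) ^ 2 + Im (F u) ^ 2)); [|assumption].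
  apply (continuous_plus (fun u => Re (F u) ^ 2) (fun u => Im (F u) ^ 2)); simpl;
  repeat apply (continuous_mult (K := R_AbsRing)); try assumption; apply continuous_const. }
split.
- apply (continuous_mult (fun u => Re (F u)) (fun u => / (Re (F u) ^ 2 + Im (F u) ^ 2)));
   assumption.
- apply (continuous_mult (fun u => - Im (F u)) (fun u => / (Re (F u) ^ 2 + Im (F u) ^ 2)));
   [apply (continuous_opp (fun u => Im (F u)))|]; assumption.
Qed.

Lemma ccont_cexp F x : ccont F x -> ccont (fun u => cexp (F u)) x.
Proof.
intros [H1 H2]; split.
- apply (continuous_mult (fun u => exp (Re (F u))) (fun u => cos (Im (F u))));
  [apply (continuous_exp_comp (fun u => Re (F u))) | apply (continuous_cos_comp (fun u => Im (F u)))]; assumption.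
- apply (continuous_mult (fun u => exp (Re (F u))) (fun u => sin (Im (F u))));
  [apply (continuous_exp_comp (fun u => Re (F u))) | apply (continuous_sin_comp (fun u => Im (F u)))]; assumption.
Qed.

Lemma cder_const c x : cder (fun _ => c) x 0.
Proof. split; apply (is_derive_const (K := R_AbsRing) (V := R_NormedModule)). Qed.

Lemma cder_real (f : R -> R) x l : is_derive f x l -> cder (fun u => RtoC (f u)) x l.
Proof. split; [exact H | exact (is_derive_const (K := R_AbsRing) (V := R_NormedModule) 0 x)]. Qed.

Lemma cder_plus F G x l m : cder F x l -> cder G x m -> cder (fun u => F u + G u)%C x (l + m).
Proof.
intros [H1 H2] [K1 K2]; split.
- apply (is_derive_plus (fun u => Re (F u)) (fun u => Re (G u))); assumption.
- apply (is_derive_plus (fun u => Im (F u)) (fun u => Im (G u))); assumption.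
Qed.

Lemma cder_opp F x l : cder F x l -> cder (fun u => - F u)%C x (- l).
Proof.
intros [H1 H2]; split.
- apply (is_derive_opp (fun u => Re (F u))); assumption.
- apply (is_derive_opp (fun u => Im (F u))); assumption.
Qed.

Lemma cder_minus F G x l m : cder F x l -> cder G x m -> cder (fun u => F u - G u)%C x (l - m).
Proof. intros; apply cder_plus; [|apply cder_opp]; assumption. Qed.

Lemma cder_mult F G x l m :
  cder F x l -> cder G x m -> cder (fun u => F u * G u)%C x (l * G x + F x * m).
Proof.
intros [H1 H2] [K1 K2]; split.
- eapply is_derive_eq.
  + apply (is_derive_minus (fun u => Re (F u) * Re (G u)) (fun u => Im (F u) * Im (G u)));
    apply Derive.is_derive_mult; eassumption.
  + unfold minus, plus, opp; simpl; unfold Re, Im; simpl; ring.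
- eapply is_derive_eq.
  + apply (is_derive_plus (fun u => Re (F u) * Im (G u)) (fun u => Im (F u) * Re (G u)));
    apply Derive.is_derive_mult; eassumption.
  + unfold minus, plus, opp; simpl; unfold Re, Im; simpl; ring.
Qed.

Lemma cder_cexp F x l : cder F x l -> cder (fun u => cexp (F u)) x (l * cexp (F x)).
Proof.
intros [H1 H2]; split.
- eapply is_derive_eq.
  + apply (Derive.is_derive_mult (fun u => exp (Re (F u))) (fun u => cos (Im (F u)))).
    * apply (is_derive_comp exp (fun u => Re (F u))); [apply is_derive_exp | exact H1].
    * apply (is_derive_comp cos (fun u => Im (F u))); [apply is_derive_cos | exact H2].
  + unfold scal; simpl; unfold mult; simpl; unfold cexp, Re, Im; simpl; ring.
- eapply is_derive_eq.
  + apply (Derive.is_derive_mult (fun u => exp (Re (F u))) (fun u => sin (Im (F u)))).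
    * apply (is_derive_comp exp (fun u => Re (F u))); [apply is_derive_exp | exact H1].
    * apply (is_derive_comp sin (fun u => Im (F u))); [apply is_derive_sin | exact H2].
  + unfold scal; simpl; unfold mult; simpl; unfold cexp, Re, Im; simpl; ring.
Qed.

Lemma cexp_add z w : cexp (z + w) = (cexp z * cexp w)%C.
Proof.
destruct z as [x y], w as [x' y']; unfold cexp, Cmult, Cplus, Re, Im; simpl.
rewrite exp_plus, cos_plus, sin_plus. f_equal; ring.
Qed.

Lemma cexp_0 : cexp 0 = RtoC 1.
Proof. unfold cexp; simpl. rewrite exp_0, cos_0, sin_0. unfold RtoC; f_equal; ring. Qed.

Lemma Cmod_cexp z : Cmod (cexp z) = exp (Re z).
Proof.
unfold Cmod, cexp; simpl.
replace (_ + _) with ((exp (Re z)) ^ 2 * (Rsqr (sin (Im z)) + Rsqr (cos (Im z))))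
  by (unfold Rsqr; ring).
rewrite sin2_cos2, Rmult_1_r. apply sqrt_pow2. left; apply exp_pos.
Qed.

Lemma cexp_neq0 z : cexp z <> RtoC 0.
Proof. apply Cmod_gt_0. rewrite Cmod_cexp. apply exp_pos. Qed.

Lemma Re_le_mod z : Re z <= Cmod z.
Proof. eapply Rle_trans; [apply Rle_abs | apply re_le_Cmod]. Qed.

Lemma abs_Im_le_mod z : Rabs (Im z) <= Cmod z.
Proof. eapply Rle_trans; [|apply Rmax_Cmod]; apply Rmax_r. Qed.

Lemma Im_le_mod z : Im z <= Cmod z.
Proof. eapply Rle_trans; [apply Rle_abs | apply abs_Im_le_mod]. Qed.

Lemma Cmod_cexp_le z c : Cmod z <= c -> Cmod (cexp z) <= exp c.
Proof.
intros H. rewrite Cmod_cexp.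
assert (E : Re z <= c) by (eapply Rle_trans; [apply Re_le_mod | exact H]).
destruct E as [E | ->]; [left; apply exp_increasing, E | right; reflexivity].
Qed.

Lemma Cmod_minus_sym z w : Cmod (z - w) = Cmod (w - z).
Proof. rewrite <- Cmod_opp. f_equal. ring. Qed.

(** Nothing is assumed on the derivative at the end points: this is what makes the
    singular end point of the flow harmless in all later estimates. *)
Lemma nondecreasing_of_derivative (f f' : R -> R) a b : a <= b ->
  (forall x, a <= x <= b -> continuous f x) ->
  (forall x, a < x < b -> is_derive f x (f' x)) ->
  (forall x, a < x < b -> 0 <= f' x) -> f a <= f b.
Proof.
intros [Hab | ->] Hc Hd Hp; [|right; reflexivity].
destruct (MVT_gen f a b (fun x => if Rlt_dec a x then if Rlt_dec x b then f' x else 0 else 0)) as [c [Hcc E]].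
- rewrite Rmin_left, Rmax_right by lra. intros x Hx.
  destruct (Rlt_dec a x); [|lra]. destruct (Rlt_dec x b); [|lra]. now apply Hd.
- rewrite Rmin_left, Rmax_right by lra. intros x Hx.
  apply continuity_pt_filterlim. now apply Hc.
- cbv beta in E.
  enough (0 <= f b - f a) by lra. rewrite E. apply Rmult_le_pos; [|lra].
  destruct (Rlt_dec a c); [|lra]. destruct (Rlt_dec c b); [|lra]. now apply Hp.
Qed.

(** The complex inequality is the real one for the component of [F] in the direction of
    [F b - F a]. *)
Lemma mean_value_bound (F F' : R -> C) (phi phi' : R -> R) a b : a <= b ->
  (forall x, a <= x <= b -> ccont F x) ->
  (forall x, a <= x <= b -> continuous phi x) ->
  (forall x, a < x < b -> cder F x (F' x)) ->
  (forall x, a < x < b -> is_derive phi x (phi' x)) ->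
  (forall x, a < x < b -> Cmod (F' x) <= phi' x) ->
  Cmod (F b - F a) <= phi b - phi a.
Proof.
intros Hab HF Hphi HdF Hdphi Hb.
set (d := (F b - F a)%C).
destruct (Req_dec (Cmod d) 0) as [Hd | Hd].
- rewrite Hd.
  enough (phi a <= phi b) by lra.
  apply (nondecreasing_of_derivative phi phi'); auto.
  intros x Hx. eapply Rle_trans; [apply Cmod_ge_0 | now apply Hb].
- assert (Hpos : 0 < Cmod d) by (destruct (Cmod_ge_0 d); [assumption | congruence]).
  set (g := fun x => phi x - (Re d * Re (F x) + Im d * Im (F x)) / Cmod d).
  set (g' := fun x => phi' x - (Re d * Re (F' x) + Im d * Im (F' x)) / Cmod d).
  assert (Hg : g a <= g b).
  { apply (nondecreasing_of_derivative g g'); auto.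
    - intros x Hx. destruct (HF x Hx) as [C1 C2].
      apply (continuous_minus phi (fun x => (Re d * Re (F x) + Im d * Im (F x)) / Cmod d)).
      + now apply Hphi.
      + apply (continuous_mult (K := R_AbsRing) (fun x => (Re d * Re (F x) + Im d * Im (F x))));
          [|apply continuous_const].
        apply (continuous_plus (V := R_NormedModule) (fun x => (Re d * Re (F x))));
        apply (continuous_mult (K := R_AbsRing)); try assumption; apply continuous_const.
    - intros x Hx. destruct (HdF x Hx) as [C1 C2].
      eapply is_derive_eq.
      + apply (is_derive_minus phi (fun x => (Re d * Re (F x) + Im d * Im (F x)) / Cmod d)).
        * apply Hdphi, Hx.
        * apply (is_derive_ext (fun x => / Cmod d * (Re d * Re (F x) + Im d * Im (F x))));
            [intros; unfold Rdiv; apply Rmult_comm|].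
          apply is_derive_scal.
          apply (is_derive_plus (V := R_NormedModule) (fun x => (Re d * Re (F x))) (fun x => Im d * Im (F x)));
            apply is_derive_scal; eassumption.
      + unfold g', minus, plus, opp; simpl. unfold Rdiv. ring.
    - intros x Hx. unfold g'. specialize (Hb x Hx).
      assert (Re d * Re (F' x) + Im d * Im (F' x) <= Cmod d * Cmod (F' x)).
      { rewrite <- (Cmod_conj d), <- Cmod_mult.
        eapply Rle_trans; [|apply Re_le_mod].
        right. unfold Cconj, Cmult, Re, Im; simpl. ring. }
      enough ((Re d * Re (F' x) + Im d * Im (F' x)) / Cmod d <= phi' x) by lra.
      apply (Rmult_le_reg_l (Cmod d)); [assumption|].
      field_simplify; [|assumption]. nra. }
  unfold g in Hg.
  assert (E : Cmod d = (Re d * Re (F b) + Im d * Im (F b)) / Cmod d - (Re d * Re (F a) + Im d * Im (F a)) / Cmod d).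
  { replace (_ - _) with ((Cmod d)^2 / Cmod d).
    - field; assumption.
    - rewrite Cmod2_alt.
      replace (Re (F b)) with (Re d + Re (F a)) by (unfold d, Re; simpl; ring).
      replace (Im (F b)) with (Im d + Im (F a)) by (unfold d, Im; simpl; ring).
      field. assumption. }
  lra.
Qed.

Lemma real_mean_value_bound (F F' : R -> R) (phi phi' : R -> R) a b : a <= b ->
  (forall x, a <= x <= b -> continuous F x) ->
  (forall x, a <= x <= b -> continuous phi x) ->
  (forall x, a < x < b -> is_derive F x (F' x)) ->
  (forall x, a < x < b -> is_derive phi x (phi' x)) ->
  (forall x, a < x < b -> Rabs (F' x) <= phi' x) ->
  Rabs (F b - F a) <= phi b - phi a.
Proof.
intros Hab HF Hphi HdF Hdphi Hb.
rewrite <- Cmod_R. replace (RtoC (F b - F a)) with (RtoC (F b) - RtoC (F a))%C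
  by (unfold RtoC, Cminus, Cplus, Copp; simpl; f_equal; ring).
apply (mean_value_bound (fun x => RtoC (F x)) (fun x => RtoC (F' x)) phi phi'); auto.
- intros; apply ccont_real; auto.
- intros; apply cder_real; auto.
- intros; rewrite Cmod_R; auto.
Qed.

Lemma cder_affine (z w : C) u : cder (fun u => z + RtoC u * w)%C u w.
Proof.
eapply cder_eq.
- apply cder_plus; [apply cder_const|].
  apply cder_mult; [apply cder_real, (is_derive_id (K := R_AbsRing))|apply cder_const].
- change (@one R_AbsRing) with 1. cbv beta. ring.
Qed.

Lemma Cmod_segment_le z w c u : Cmod z <= c -> Cmod w <= c -> 0 <= u <= 1 ->
  Cmod (w + RtoC u * (z - w)) <= c.
Proof.
intros Hz Hw Hu.
replace (w + RtoC u * (z - w))%C with (RtoC (1 - u) * w + RtoC u * z)%C.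
- eapply Rle_trans; [apply Cmod_triangle|]. rewrite !Cmod_mult, !Cmod_R, !Rabs_pos_eq by lra. nra.
- replace (RtoC (1 - u)) with (RtoC 1 - RtoC u)%C; [ring|].
  unfold RtoC, Cminus, Cplus, Copp; simpl; f_equal; ring.
Qed.

Lemma cexp_lipschitz z w c : Cmod z <= c -> Cmod w <= c ->
  Cmod (cexp z - cexp w) <= exp c * Cmod (z - w).
Proof.
intros Hz Hw.
pose (F := fun u : R => cexp (w + RtoC u * (z - w))%C).
pose (F' := fun u : R => ((z - w) * cexp (w + RtoC u * (z - w)))%C).
assert (HF : forall u, cder F u (F' u)).
{ intros u. apply cder_cexp, cder_affine. }
replace (cexp z) with (F 1) by (unfold F; f_equal; ring).
replace (cexp w) with (F 0) by (unfold F; f_equal; ring).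
replace (exp c * Cmod (z - w)) with (exp c * Cmod (z - w) * 1 - exp c * Cmod (z - w) * 0) by ring.
apply (mean_value_bound F F' (fun u => exp c * Cmod (z - w) * u) (fun u => exp c * Cmod (z - w))); auto.
- lra.
- intros; eapply cder_ccont, HF.
- intros. apply (continuous_mult (K := R_AbsRing)); [apply continuous_const|apply continuous_id].
- intros x _. auto_derive; [exact I|ring].
- intros x Hx. unfold F'. rewrite Cmod_mult, Rmult_comm.
  apply Rmult_le_compat_r; [apply Cmod_ge_0|]. apply Cmod_cexp_le, Cmod_segment_le; lra.
Qed.

(** Second-order bound, obtained by comparing along the segment from [w] to [z]. *)
Lemma cexp_taylor z w c : Cmod z <= c -> Cmod w <= c ->
  Cmod (cexp z - cexp w - (z - w) * cexp w) <= exp c * Cmod (z - w) * Cmod (z - w).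
Proof.
intros Hz Hw.
pose (F := fun u : R => (cexp (w + RtoC u * (z - w)) - (0 + RtoC u * ((z - w) * cexp w)))%C).
pose (F' := fun u : R => ((z - w) * cexp (w + RtoC u * (z - w)) - (z - w) * cexp w)%C).
assert (HF : forall u, cder F u (F' u)).
{ intros u. apply cder_minus; [apply cder_cexp, cder_affine|apply cder_affine]. }
replace (cexp z - cexp w - (z - w) * cexp w)%C with (F 1 - F 0)%C.
2:{ unfold F. replace (w + 1 * (z - w))%C with z by ring.
    replace (w + 0 * (z - w))%C with w by ring. ring. }
set (k := exp c * Cmod (z - w) * Cmod (z - w)).
replace k with (k * 1 - k * 0) by ring.
apply (mean_value_bound F F' (fun u => k * u) (fun u => k)); auto.
- lra.
- intros; eapply cder_ccont, HF.
- intros. apply (continuous_mult (K := R_AbsRing)); [apply continuous_const|apply continuous_id].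
- intros x _. auto_derive; [exact I|ring].
- intros x Hx. unfold F'.
  replace ((z - w) * cexp (w + x * (z - w)) - (z - w) * cexp w)%C
    with ((z - w) * (cexp (w + x * (z - w)) - cexp w))%C by ring.
  rewrite Cmod_mult. unfold k.
  rewrite (Rmult_comm (exp c * _)). apply Rmult_le_compat_l; [apply Cmod_ge_0|].
  eapply Rle_trans; [apply (cexp_lipschitz _ _ c); [apply Cmod_segment_le; lra | lra]|].
  apply Rmult_le_compat_l; [left; apply exp_pos|].
  replace (w + x * (z - w) - w)%C with (RtoC x * (z - w))%C by ring.
  rewrite Cmod_mult, Cmod_R, Rabs_pos_eq by lra.
  pose proof (Cmod_ge_0 (z - w)). nra.
Qed.

(** * Powers, and primitives with a singular end point *)

(** The power [s ^ theta], extended by [0] to [s <= 0] so as to be continuous;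
    [Rpower 0 theta] is [1]. *)
Definition pw (theta s : R) : R := if Rle_dec s 0 then 0 else Rpower s theta.

Lemma pw_le0 theta s : s <= 0 -> pw theta s = 0.
Proof. intros H. unfold pw. destruct (Rle_dec s 0); [reflexivity|lra]. Qed.

Lemma pw_gt0 theta s : 0 < s -> pw theta s = Rpower s theta.
Proof. intros H. unfold pw. destruct (Rle_dec s 0); [lra|reflexivity]. Qed.

Lemma pw_pos theta s : 0 < s -> 0 < pw theta s.
Proof. intros H. rewrite pw_gt0 by assumption. apply exp_pos. Qed.

Lemma pw_nonneg theta s : 0 <= pw theta s.
Proof.
destruct (Rle_dec s 0); [right; symmetry; now apply pw_le0|left; apply pw_pos; lra].
Qed.

Lemma pw_le theta s t : 0 <= theta -> s <= t -> pw theta s <= pw theta t.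
Proof.
intros Ht Hst. destruct (Rle_dec s 0) as [H|H].
- rewrite (pw_le0 _ s) by assumption. apply pw_nonneg.
- rewrite !pw_gt0 by lra. apply Rle_Rpower_l; lra.
Qed.

Lemma pw_double theta s : 0 <= theta <= 1 -> pw theta (2 * s) <= 2 * pw theta s.
Proof.
intros Ht. destruct (Rle_dec s 0) as [H|H].
- rewrite !pw_le0 by lra. lra.
- rewrite !pw_gt0 by lra.
  rewrite <- Rpower_mult_distr by lra.
  apply Rmult_le_compat_r; [left; apply exp_pos|].
  rewrite <- (Rpower_1 2) at 2 by lra. apply Rle_Rpower; lra.
Qed.

Lemma pw_half s : 0 < s -> pw (1 / 2) s = sqrt s.
Proof. intros H. rewrite pw_gt0 by assumption. replace (1/2) with (/2) by field. now apply Rpower_sqrt. Qed.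

Lemma pw_half_plus theta s : 0 <= s -> pw (1 / 2 + theta) s = sqrt s * pw theta s.
Proof.
intros [H | <-].
- rewrite !pw_gt0 by assumption. rewrite Rpower_plus. f_equal.
  replace (1/2) with (/2) by field. now apply Rpower_sqrt.
- rewrite !pw_le0 by lra. ring.
Qed.

Lemma pw_deriv theta s : 0 < s -> is_derive (pw theta) s (theta * pw theta s / s).
Proof.
intros H. apply (is_derive_ext_loc (fun x => exp (theta * ln x))).
- exists (mkposreal s H). intros y Hy. unfold ball in Hy; simpl in Hy.
  unfold AbsRing_ball, abs, minus, plus, opp in Hy; simpl in Hy.
  apply Rabs_def2 in Hy. rewrite pw_gt0 by lra. reflexivity.
- rewrite pw_gt0 by assumption. unfold Rpower. auto_derive; [assumption|]. field. lra.
Qed.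

Lemma pw_small theta : 0 < theta -> forall eps, 0 < eps ->
  exists d, 0 < d /\ forall s, s < d -> pw theta s < eps.
Proof.
intros Ht eps He. exists (Rpower eps (/ theta)). split; [apply exp_pos|].
intros s Hs. destruct (Rle_dec s 0) as [H|H]; [now rewrite pw_le0|].
rewrite pw_gt0 by lra.
replace eps with (Rpower (Rpower eps (/ theta)) theta).
- apply Rlt_Rpower_l; lra.
- rewrite Rpower_mult, Rinv_l by lra. now apply Rpower_1.
Qed.

Lemma continuous_eps (f : R -> R) x :
  (forall eps, 0 < eps -> exists d, 0 < d /\ forall y, Rabs (y - x) < d -> Rabs (f y - f x) < eps) ->
  continuous f x.
Proof.
intros H. apply filterlim_locally. intros [eps He].
destruct (H eps He) as [d [Hd Hf]]. exists (mkposreal d Hd). intros y Hy. apply Hf, Hy.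
Qed.

Lemma eps_continuous (f : R -> R) x : continuous f x ->
  forall eps, 0 < eps -> exists d, 0 < d /\ forall y, Rabs (y - x) < d -> Rabs (f y - f x) < eps.
Proof.
intros H eps He. apply filterlim_locally with (eps := mkposreal eps He) in H.
destruct H as [[d Hd] Hf]. exists d; split; [assumption|]. intros y Hy. apply (Hf y Hy).
Qed.

Lemma is_derive_continuous (f : R -> R) (x l : R) : is_derive f x l -> continuous f x.
Proof. intros H. apply (ex_derive_continuous f). eexists. exact H. Qed.

Lemma pw_cont theta s : 0 < theta -> continuous (pw theta) s.
Proof.
intros Ht. destruct (Rlt_dec 0 s) as [H|H].
- eapply is_derive_continuous. now apply pw_deriv.
- apply continuous_eps. intros eps He. destruct (pw_small theta Ht eps He) as [d [Hd Hs]].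
  exists d; split; [assumption|]. intros y Hy. apply Rabs_def2 in Hy.
  rewrite (pw_le0 _ s) by lra. rewrite Rminus_0_r, Rabs_pos_eq by apply pw_nonneg.
  apply Hs; lra.
Qed.

(** [F - psi] is nondecreasing, [F + psi] is nonincreasing and the first lies below the
    second, so the supremum of the first separates them. *)
Lemma limit_at_singular_end (F F' psi psi' : R -> R) a b : a < b ->
  (forall x, a < x < b -> is_derive F x (F' x)) ->
  (forall x, a < x < b -> is_derive psi x (psi' x)) ->
  (forall x, a < x < b -> Rabs (F' x) <= - psi' x) ->
  (forall x, a < x < b -> 0 <= psi x) ->
  exists L, forall x, a < x < b -> Rabs (F x - L) <= psi x.
Proof.
intros Hab HF Hpsi Hb Hpos.
assert (Hmono : forall x y, a < x -> x <= y -> y < b ->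
  F x - psi x <= F y - psi y /\ F y + psi y <= F x + psi x).
{ intros x y Hx Hxy Hy.
  assert (Rabs (F y - F x) <= - psi y - - psi x).
  { apply (real_mean_value_bound F F' (fun u => - psi u) (fun u => - psi' u)); try assumption.
    - intros u Hu. eapply is_derive_continuous. apply HF; lra.
    - intros u Hu. apply (continuous_opp psi). eapply is_derive_continuous. apply Hpsi; lra.
    - intros u Hu. apply HF; lra.
    - intros u Hu. apply (is_derive_opp psi). apply Hpsi; lra.
    - intros u Hu. apply Hb; lra. }
  apply Rabs_le_between in H. lra. }
destruct (completeness (fun v => exists x, a < x < b /\ v = F x - psi x)) as [L [HL1 HL2]].
- exists (F ((a + b) / 2) + psi ((a + b) / 2)). intros v [x [Hx ->]].
  destruct (Rle_dec x ((a + b) / 2)) as [H|H].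
  + destruct (Hmono x ((a + b) / 2)); try lra. pose proof (Hpos ((a+b)/2)). lra.
  + destruct (Hmono ((a + b) / 2) x); try lra. pose proof (Hpos x Hx). lra.
- exists (F ((a + b) / 2) - psi ((a + b) / 2)), ((a + b) / 2). split; [lra|reflexivity].
- exists L. intros x Hx. apply Rabs_le_between'. split.
  + enough (L <= F x + psi x) by lra. apply HL2. intros v [y [Hy ->]].
    destruct (Rle_dec x y) as [H|H].
    * destruct (Hmono x y); try lra. pose proof (Hpos y Hy). lra.
    * destruct (Hmono y x); try lra. pose proof (Hpos x Hx). lra.
  + enough (F x - psi x <= L) by lra. apply HL1. exists x. split; [assumption|reflexivity].
Qed.

Lemma primitive_exists (f : R -> R) b : (forall x, x < b -> continuous f x) ->
  exists F, forall x, x < b -> is_derive F x (f x).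
Proof.
intros Hf. exists (fun x => RInt f (b - 1) x). intros x Hx.
apply (is_derive_RInt f (fun x => RInt f (b - 1) x) (b - 1)); [|now apply Hf].
assert (Hd : 0 < b - x) by lra.
exists (mkposreal _ Hd). intros y Hy. unfold ball in Hy; simpl in Hy.
unfold AbsRing_ball, abs, minus, plus, opp in Hy; simpl in Hy. apply Rabs_def2 in Hy.
apply (RInt_correct f). apply (ex_RInt_continuous f).
intros z Hz. apply Hf. eapply Rle_lt_trans; [apply Hz|]. apply Rmax_lub_lt; lra.
Qed.

(** The integrand may blow up at [b]; [limit_at_singular_end] gives the value which has
    to be subtracted from an arbitrary primitive. *)
Lemma primitive_tail_exists (f : R -> R) a b theta K : a < b -> 0 < theta ->
  (forall x, x < b -> continuous f x) ->
  (forall x, a < x < b -> Rabs (f x) <= K * (pw theta (b - x) / (b - x))) ->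
  exists F, (forall x, b <= x -> F x = 0) /\ (forall x, continuous F x) /\
    (forall x, x < b -> is_derive F x (f x)).
Proof.
intros Hab Ht Hf HK.
destruct (primitive_exists f b Hf) as [F0 HF0].
set (psi := fun x => K / theta * pw theta (b - x)).
set (psi' := fun x => - (K * (pw theta (b - x) / (b - x)))).
assert (HK0 : 0 <= K).
{ specialize (HK ((a + b) / 2) ltac:(lra)).
  assert (0 < pw theta (b - (a + b) / 2) / (b - (a + b) / 2)).
  { apply Rdiv_lt_0_compat; [apply pw_pos|]; lra. }
  pose proof (Rabs_pos (f ((a + b) / 2))). nra. }
destruct (limit_at_singular_end F0 f psi psi' a b) as [L HL]; try assumption.
- intros x Hx. apply HF0; lra.
- intros x Hx. unfold psi, psi'. eapply is_derive_eq.
  + apply is_derive_scal. apply (is_derive_comp (pw theta) (fun x => b - x)).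
    * apply pw_deriv; lra.
    * auto_derive; [exact I|reflexivity].
  + unfold scal; simpl; unfold mult; simpl. field. lra.
- intros x Hx. unfold psi'. rewrite Ropp_involutive. now apply HK.
- intros x Hx. unfold psi. apply Rmult_le_pos; [|apply pw_nonneg].
  apply Rdiv_le_0_compat; lra.
- set (F := fun x => if Rlt_dec x b then F0 x - L else 0).
  assert (HFd : forall x, x < b -> is_derive F x (f x)).
  { intros x Hx. apply (is_derive_ext_loc (fun x => F0 x - L)).
    - assert (Hd : 0 < b - x) by lra.
      exists (mkposreal _ Hd). intros y Hy. unfold ball in Hy; simpl in Hy.
      unfold AbsRing_ball, abs, minus, plus, opp in Hy; simpl in Hy. apply Rabs_def2 in Hy.
      unfold F. destruct (Rlt_dec y b); [reflexivity|lra].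
    - eapply is_derive_eq.
      + apply (is_derive_minus F0 (fun _ => L)); [apply HF0, Hx|apply (is_derive_const (K := R_AbsRing))].
      + unfold minus, plus, opp, zero; simpl. ring. }
  exists F. split; [|split; [|assumption]].
  + intros x Hx. unfold F. destruct (Rlt_dec x b); [lra|reflexivity].
  + intros x. destruct (Rlt_dec x b) as [Hx|Hx].
    * eapply is_derive_continuous. now apply HFd.
    * apply continuous_eps. intros eps He.
      assert (Hc : continuous psi b).
      { unfold psi. apply (continuous_mult (K := R_AbsRing) (fun _ => K / theta) (fun x => pw theta (b - x))); [apply continuous_const|].
        apply (continuous_comp (fun x => b - x) (pw theta)); [|now apply pw_cont].
        apply (continuous_minus (fun _ => b) (fun x => x)); [apply continuous_const|apply continuous_id]. }
      destruct (eps_continuous psi b Hc eps He) as [d [Hd Hpd]].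
      assert (H0 : psi b = 0) by (unfold psi; rewrite pw_le0 by lra; ring).
      exists (Rmin d (b - a)). split; [apply Rmin_glb_lt; lra|].
      intros y Hy. unfold F.
      destruct (Rlt_dec x b); [lra|]. destruct (Rlt_dec y b) as [Hyb|Hyb].
      2:{ rewrite Rminus_0_r, Rabs_R0; assumption. }
      pose proof (Rmin_l d (b - a)). pose proof (Rmin_r d (b - a)).
      apply Rabs_def2 in Hy.
      rewrite Rminus_0_r. eapply Rle_lt_trans; [apply HL; lra|].
      assert (Hz : Rabs (psi y - psi b) < eps) by (apply Hpd, Rabs_def1; lra).
      rewrite H0 in Hz. apply Rabs_def2 in Hz. lra.
Qed.

Definition tail_primitive (f : R -> C) (b : R) (F : R -> C) : Prop :=
  (forall x, b <= x -> F x = RtoC 0) /\ (forall x, ccont F x) /\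
  (forall x, x < b -> cder F x (f x)).

Lemma tail_primitive_exists (f : R -> C) a b theta K : a < b -> 0 < theta ->
  (forall x, x < b -> ccont f x) ->
  (forall x, a < x < b -> Cmod (f x) <= K * (pw theta (b - x) / (b - x))) ->
  exists F, tail_primitive f b F.
Proof.
intros Hab Ht Hf HK.
destruct (primitive_tail_exists (fun x => Re (f x)) a b theta K) as [F1 [A1 [A2 A3]]]; try assumption.
{ intros x Hx. apply Hf, Hx. }
{ intros x Hx. eapply Rle_trans; [apply re_le_Cmod | now apply HK]. }
destruct (primitive_tail_exists (fun x => Im (f x)) a b theta K) as [F2 [B1 [B2 B3]]]; try assumption.
{ intros x Hx. apply Hf, Hx. }
{ intros x Hx. eapply Rle_trans; [apply abs_Im_le_mod | now apply HK]. }
exists (fun x => (F1 x, F2 x)). split; [|split].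
- intros x Hx. unfold RtoC. f_equal; auto.
- intros x. split; [apply A2|apply B2].
- intros x Hx. split; [apply A3|apply B3]; assumption.
Qed.

Lemma tail_primitive_bound (f F : R -> C) a b theta K x : 0 < theta ->
  (forall y, a <= y <= b -> ccont F y) ->
  (forall y, a < y < b -> cder F y (f y)) ->
  F b = RtoC 0 ->
  (forall y, a < y < b -> Cmod (f y) <= K * (pw theta (b - y) / (b - y))) ->
  a <= x <= b ->
  Cmod (F x) <= K / theta * pw theta (b - x).
Proof.
intros Ht HFc HFd HF0 HK Hx.
rewrite <- Cmod_opp. replace (- F x)%C with (F b - F x)%C by (rewrite HF0; ring).
replace (K / theta * pw theta (b - x)) with (- (K / theta) * pw theta (b - b) - (- (K / theta) * pw theta (b - x))).
2:{ rewrite (pw_le0 _ (b - b)) by lra. ring. }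
apply (mean_value_bound F f (fun y => - (K / theta) * pw theta (b - y))
   (fun y => K * (pw theta (b - y) / (b - y)))); try lra.
- intros y Hy. apply HFc; lra.
- intros y _. apply (continuous_mult (K := R_AbsRing) (fun _ => - (K / theta)) (fun x => pw theta (b - x))); [apply continuous_const|].
  apply (continuous_comp (fun x => b - x) (pw theta)); [|now apply pw_cont].
  apply (continuous_minus (fun _ => b) (fun x => x)); [apply continuous_const|apply continuous_id].
- intros y Hy. apply HFd; lra.
- intros y Hy. eapply is_derive_eq.
  + apply is_derive_scal. apply (is_derive_comp (pw theta) (fun x => b - x)).
    * apply pw_deriv; lra.
    * auto_derive; [exact I|reflexivity].
  + unfold scal; simpl; unfold mult; simpl. field. lra.
- intros y Hy. apply HK; lra.
Qed.

Lemma Ceq_of_minus (z w : C) : (z - w)%C = RtoC 0 -> z = w.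
Proof. intros H. replace z with ((z - w) + w)%C by ring. rewrite H. ring. Qed.

(** The product of [F] with the integrating factor [exp (- P)] has derivative zero. *)
Lemma linear_ode_solution (F P k : R -> C) a b : a <= b ->
  (forall x, a <= x <= b -> ccont F x) ->
  (forall x, a <= x <= b -> ccont P x) ->
  (forall x, a < x < b -> cder F x (k x * F x)) ->
  (forall x, a < x < b -> cder P x (k x)) ->
  (F b * cexp (- P b) = F a * cexp (- P a))%C.
Proof.
intros Hab HF HP HdF HdP.
enough (Cmod (F b * cexp (- P b) - F a * cexp (- P a)) <= 0 - 0).
{ apply Ceq_of_minus,  Cmod_eq_0.
  apply Rle_antisym; [lra|apply Cmod_ge_0]. }
apply (mean_value_bound (fun x => F x * cexp (- P x))%C (fun _ => RtoC 0) (fun _ => 0) (fun _ => 0)); auto.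
- intros x Hx. apply ccont_mult; [now apply HF|]. apply ccont_cexp, ccont_opp, HP, Hx.
- intros; apply continuous_const.
- intros x Hx. eapply cder_eq.
  + apply cder_mult; [now apply HdF|]. apply cder_cexp, cder_opp, HdP, Hx.
  + cbv beta. ring.
- intros; apply (is_derive_const (K := R_AbsRing) (V := R_NormedModule) 0 x).
- intros; rewrite Cmod_0; lra.
Qed.

(** * Increments of the flow with respect to the tip *)

(** What is used of the family [W]: its equation, and the size [sqrt (t - r)] of its modulus
    and of its imaginary part.  The functions [lam] and [l] are the driving function and its
    derivative, extended by constants outside of [[0, T]]; likewise [W t r] is frozen for
    [r <= 0] and zero for [r >= t], so that no one-sided notion is needed. *)
Record tip_flow (T M delta b B D : R) (lam l : R -> R) (W : R -> R -> C) : Prop := {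
  tf_l_cont : forall q, continuous l q;
  tf_l_bound : forall q, Rabs (l q) <= M;
  tf_l_holder : forall q p, Rabs (l q - l p) <= M * pw (1 / 2 + delta) (Rabs (q - p));
  tf_lam_cont : forall q, continuous lam q;
  tf_lam_der : forall q, 0 < q < T -> is_derive lam q (l q);
  tf_zero : forall t r, 0 < t <= T -> t <= r -> W t r = RtoC 0;
  tf_cont : forall t r, 0 < t <= T -> ccont (W t) r;
  tf_der : forall t r, 0 < r < t -> t <= T -> cder (W t) r (2 / W t r - l r);
  tf_pos : forall t r, 0 < t <= T -> r < t -> 0 < Im (W t r);
  tf_low : forall t r, 0 < t <= T -> 0 <= r <= t -> b * sqrt (t - r) <= Im (W t r);
  tf_up : forall t r, 0 < t <= T -> 0 <= r <= t -> Cmod (W t r) <= B * sqrt (t - r);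
  tf_sq : forall t r, 0 < t <= T -> 0 <= r <= t ->
    Cmod (W t r * W t r + RtoC (4 * (t - r))) <= D * ((t - r) * sqrt (t - r)) }.

Arguments tf_l_cont {T M delta b B D lam l W} _.
Arguments tf_l_bound {T M delta b B D lam l W} _.
Arguments tf_l_holder {T M delta b B D lam l W} _.
Arguments tf_lam_cont {T M delta b B D lam l W} _.
Arguments tf_lam_der {T M delta b B D lam l W} _.
Arguments tf_zero {T M delta b B D lam l W} _.
Arguments tf_cont {T M delta b B D lam l W} _.
Arguments tf_der {T M delta b B D lam l W} _.
Arguments tf_pos {T M delta b B D lam l W} _.
Arguments tf_low {T M delta b B D lam l W} _.
Arguments tf_up {T M delta b B D lam l W} _.
Arguments tf_sq {T M delta b B D lam l W} _.

Definition params (T M delta b B D : R) : Prop :=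
  0 < T /\ 0 < M /\ 0 < delta <= 1 / 2 /\ 0 < b /\ 0 < B /\ 0 < D.

Lemma Cmod_div_le x z n k : Cmod x <= n -> 0 < k -> k <= Cmod z -> Cmod (x / z) <= n / k.
Proof.
intros Hx Hk Hz.
assert (z <> RtoC 0) by (apply Cmod_gt_0; lra).
rewrite Cmod_div by assumption. unfold Rdiv.
apply Rmult_le_compat; try assumption.
- apply Cmod_ge_0.
- left; apply Rinv_0_lt_compat; lra.
- apply Rinv_le_contravar; assumption.
Qed.

Lemma Cmod_mult_le z w m n : Cmod z <= m -> Cmod w <= n -> Cmod (z * w) <= m * n.
Proof.
intros. rewrite Cmod_mult. apply Rmult_le_compat; try assumption; apply Cmod_ge_0.
Qed.

Lemma Cmod_mult_ge z w m n : 0 <= m -> 0 <= n -> m <= Cmod z -> n <= Cmod w -> m * n <= Cmod (z * w).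
Proof. intros. rewrite Cmod_mult. apply Rmult_le_compat; assumption. Qed.

Lemma Cmod_plus_le z w m n : Cmod z <= m -> Cmod w <= n -> Cmod (z + w) <= m + n.
Proof. intros. eapply Rle_trans; [apply Cmod_triangle|lra]. Qed.

Lemma Cmod_minus_le z w m n : Cmod z <= m -> Cmod w <= n -> Cmod (z - w) <= m + n.
Proof. intros. apply Cmod_plus_le; [|rewrite Cmod_opp]; assumption. Qed.

Lemma pos_Im_neq0 z : 0 < Im z -> z <> RtoC 0.
Proof. intros H E. rewrite E in H. simpl in H. lra. Qed.

Lemma le_Im_le_mod k z : k <= Im z -> k <= Cmod z.
Proof. intros H. eapply Rle_trans; [exact H|apply Im_le_mod]. Qed.

Lemma ccont_div F G x : ccont F x -> ccont G x -> G x <> RtoC 0 -> ccont (fun u => F u / G u)%C x.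
Proof. intros. apply ccont_mult; [|apply ccont_inv]; assumption. Qed.

(** As a function of [q], the integral of [l / W t] from [q] to [t]. *)
Definition drift_exponent (l : R -> R) (W : R -> R -> C) (t : R) : R -> C :=
  epsilon (inhabits (fun _ => RtoC 0))
    (tail_primitive (fun q => - (RtoC (l q) / W t q))%C t).

(** An inverse square root is an instance, with exponent [1/2], of the singularities allowed in
    [tail_primitive_exists]. *)
Lemma inverse_sqrt_as_power b M s : 0 < b -> 0 < s -> M / (b * sqrt s) = M / b * (pw (1/2) s / s).
Proof.
intros Hb Hs. rewrite pw_half by assumption.
assert (0 < sqrt s) by now apply sqrt_lt_R0.
rewrite <- (sqrt_sqrt s) at 3 by lra. field. lra.
Qed.

Lemma drift_exponent_spec {T M delta b B D lam l W} t : params T M delta b B D ->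
  tip_flow T M delta b B D lam l W -> 0 < t <= T ->
  tail_primitive (fun q => - (RtoC (l q) / W t q))%C t (drift_exponent l W t).
Proof.
intros (HT & HM & Hd & Hb & HB & HD) H Ht. unfold drift_exponent. apply epsilon_spec.
apply (tail_primitive_exists _ 0 t (1/2) (M / b)); try lra.
- intros x Hx. apply ccont_opp, ccont_div.
  + apply ccont_real, (tf_l_cont H).
  + apply (tf_cont H); assumption.
  + apply pos_Im_neq0, (tf_pos H); assumption.
- intros x Hx. rewrite Cmod_opp, <- inverse_sqrt_as_power by lra.
  assert (0 < sqrt (t - x)) by (apply sqrt_lt_R0; lra).
  apply Cmod_div_le.
  + rewrite Cmod_R. apply (tf_l_bound H).
  + now apply Rmult_lt_0_compat.
  + apply le_Im_le_mod, (tf_low H); lra.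
Qed.

Lemma drift_exponent_bound {T M delta b B D lam l W} t q : params T M delta b B D ->
  tip_flow T M delta b B D lam l W -> 0 < t <= T -> 0 <= q <= t ->
  Cmod (drift_exponent l W t q) <= 2 * M / b * sqrt (t - q).
Proof.
intros Hp H Ht Hq.
destruct (drift_exponent_spec t Hp H Ht) as [E0 [Ec Ed]].
destruct Hp as (HT & HM & Hd & Hb & HB & HD).
replace (2 * M / b * sqrt (t - q)) with (M / b / (1 / 2) * pw (1 / 2) (t - q)).
2:{ destruct (proj2 Hq) as [Hlt | ->].
    - rewrite pw_half by lra. field. lra.
    - rewrite Rminus_diag, sqrt_0, pw_le0 by lra. ring. }
apply (tail_primitive_bound (fun q => - (RtoC (l q) / W t q))%C (drift_exponent l W t) 0); auto; try lra.
- intros y Hy. apply Ed; lra.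
- apply E0; lra.
- intros x Hx. rewrite Cmod_opp, <- inverse_sqrt_as_power by lra.
  assert (0 < sqrt (t - x)) by (apply sqrt_lt_R0; lra).
  apply Cmod_div_le.
  + rewrite Cmod_R. apply (tf_l_bound H).
  + now apply Rmult_lt_0_compat.
  + apply le_Im_le_mod, (tf_low H); lra.
Qed.

Lemma drift_exponent_uniform_bound {T M delta b B D lam l W} t q : params T M delta b B D ->
  tip_flow T M delta b B D lam l W -> 0 < t <= T -> 0 <= q <= t ->
  Cmod (drift_exponent l W t q) <= 2 * M / b * sqrt T.
Proof.
intros Hp H Ht Hq. eapply Rle_trans; [eapply drift_exponent_bound; eassumption|].
destruct Hp as (HT & HM & Hd & Hb & HB & HD).
apply Rmult_le_compat_l; [|apply sqrt_le_1_alt; lra].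
apply Rdiv_le_0_compat; lra.
Qed.

Lemma sum_lower_bound {T M delta b B D lam l W} t t' q : params T M delta b B D ->
  tip_flow T M delta b B D lam l W -> 0 < t -> t < t' -> t' <= T -> 0 <= q <= t ->
  b * sqrt (t - q) + b * sqrt (t' - q) <= Im (W t' q + W t q)%C.
Proof.
intros Hp H Ht Htt Ht' Hq.
pose proof (tf_low H t q ltac:(lra) ltac:(lra)).
pose proof (tf_low H t' q ltac:(lra) ltac:(lra)).
simpl in *. unfold Im in *. lra.
Qed.

(** The equations give [(W t' - W t)' = - 2 (W t' - W t) / (W t' * W t)] and
    [(W t' + W t)' = 2 (W t' + W t) / (W t' * W t) - 2 l].  In the product the singular
    coefficients cancel, and a linear equation remains whose coefficient is integrable up to
    [r = t]. *)
Lemma square_difference {T M delta b B D lam l W} t t' : params T M delta b B D ->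
  tip_flow T M delta b B D lam l W -> 0 < t -> t < t' -> t' <= T ->
  exists H : R -> C, H t = RtoC 0 /\ (forall q, 0 <= q <= t -> ccont H q) /\
    (forall q, 0 < q < t -> cder H q (- (RtoC (2 * l q) / (W t' q + W t q)))) /\
    (forall q, 0 <= q <= t -> Cmod (H q) <= 2 * M / b * sqrt T) /\
    (forall q, 0 <= q <= t ->
      W t' q * W t' q - W t q * W t q = W t' t * W t' t * cexp (H q))%C.
Proof.
intros Hp H Ht Htt Ht'.
assert (Hp' := Hp). destruct Hp' as (HT & HM & Hd & Hb & HB & HD).
set (f := fun q => (- (RtoC (2 * l q) / (W t' q + W t q)))%C).
assert (Hf : forall y, 0 <= y < t -> Cmod (f y) <= M / b * (pw (1/2) (t - y) / (t - y))).
{ intros y Hy. unfold f. rewrite Cmod_opp, <- inverse_sqrt_as_power by lra.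
  assert (0 < sqrt (t - y)) by (apply sqrt_lt_R0; lra).
  assert (sqrt (t - y) <= sqrt (t' - y)) by (apply sqrt_le_1_alt; lra).
  pose proof (sum_lower_bound t t' y Hp H ltac:(lra) ltac:(lra) ltac:(lra) ltac:(lra)) as HL.
  replace (M / (b * sqrt (t - y))) with (2 * M / (b * sqrt (t - y) + b * sqrt (t - y))).
  2:{ field. repeat split; nra. }
  apply Cmod_div_le.
  - rewrite Cmod_R, Rabs_mult, (Rabs_pos_eq 2) by lra.
    pose proof (tf_l_bound H y). lra.
  - nra.
  - apply le_Im_le_mod. nra. }
destruct (tail_primitive_exists f 0 t (1/2) (M / b)) as [P [P0 [Pc Pd]]]; try lra.
{ intros x Hx. apply ccont_opp, ccont_div.
  - apply ccont_real. apply (continuous_mult (K := R_AbsRing)); [apply continuous_const|].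
    apply (tf_l_cont H).
  - apply ccont_plus; apply (tf_cont H); lra.
  - apply pos_Im_neq0.
    pose proof (tf_pos H t x ltac:(lra) ltac:(lra)).
    pose proof (tf_pos H t' x ltac:(lra) ltac:(lra)).
    unfold Im in *; simpl in *. lra. }
{ intros x Hx. apply Hf; lra. }
exists P. split; [apply P0; lra|]. split; [intros; apply Pc|]. split; [intros; apply Pd; lra|]. split.
- intros q Hq. eapply Rle_trans.
  + apply (tail_primitive_bound f P 0 t (1/2) (M/b) q); auto; try lra.
    * intros; apply Pd; lra.
    * apply P0; lra.
    * intros; apply Hf; lra.
  + replace (2 * M / b * sqrt T) with (M / b / (1/2) * sqrt T) by (field; lra).
    apply Rmult_le_compat_l; [apply Rdiv_le_0_compat; [apply Rdiv_le_0_compat|]; lra|].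
    rewrite <- pw_half by lra. apply pw_le; lra.
- intros q Hq.
  assert (E := linear_ode_solution (fun x => W t' x * W t' x - W t x * W t x)%C P f q t ltac:(lra)).
  cbv beta in E. rewrite (tf_zero H t t) in E by lra.
  rewrite (P0 t) in E by lra.
  replace (- RtoC 0)%C with (RtoC 0) in E by ring. rewrite cexp_0 in E.
  transitivity ((W t' q * W t' q - W t q * W t q) * cexp (- P q) * cexp (P q))%C.
  + rewrite <- Cmult_assoc, <- cexp_add.
    replace (- P q + P q)%C with (RtoC 0) by ring. rewrite cexp_0. ring.
  + rewrite <- E; [ring| | | |].
    * intros x Hx. apply ccont_minus; apply ccont_mult; apply (tf_cont H); lra.
    * intros; apply Pc.
    * intros x Hx. eapply cder_eq.
      -- apply cder_minus; apply cder_mult; apply (tf_der H); lra.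
      -- pose proof (tf_pos H t x ltac:(lra) ltac:(lra)).
         pose proof (tf_pos H t' x ltac:(lra) ltac:(lra)).
         assert (W t x <> RtoC 0) by now apply pos_Im_neq0.
         assert (W t' x <> RtoC 0) by now apply pos_Im_neq0.
         assert ((W t' x + W t x)%C <> RtoC 0) by (apply pos_Im_neq0; unfold Im in *; simpl in *; lra).
         unfold f. rewrite RtoC_mult. field. auto.
    * intros; apply Pd; lra.
Qed.

(** Divide [square_difference] by [W t' q + W t q], whose imaginary part is at least
    of order [sqrt (t' - q)]. *)
Lemma tip_increment {T M delta b B D} : params T M delta b B D ->
  exists K, 0 < K /\ forall lam l W, tip_flow T M delta b B D lam l W ->
  forall t t' q, 0 < t -> t < t' -> t' <= T -> 0 <= q <= t ->
  Cmod (W t' q - W t q) <= K * ((t' - t) / sqrt (t' - q)).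
Proof.
intros Hp. assert (Hp' := Hp). destruct Hp' as (HT & HM & Hd & Hb & HB & HD).
exists (B * B * exp (2 * M / b * sqrt T) / b). split.
{ apply Rdiv_lt_0_compat; [|assumption]. apply Rmult_lt_0_compat; [nra|apply exp_pos]. }
intros lam l W H t t' q Ht Htt Ht' Hq.
destruct (square_difference t t' Hp H Ht Htt Ht') as [P [_ [_ [_ [HPb HE]]]]].
specialize (HE q Hq). specialize (HPb q Hq).
assert (Hs' : 0 < sqrt (t' - q)) by (apply sqrt_lt_R0; lra).
pose proof (sum_lower_bound t t' q Hp H Ht Htt Ht' Hq) as HL.
pose proof (sqrt_pos (t - q)).
assert (Hn : (W t' q + W t q)%C <> RtoC 0) by (apply pos_Im_neq0; nra).
replace (W t' q - W t q)%C with ((W t' q * W t' q - W t q * W t q) / (W t' q + W t q))%C by (field; assumption).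
rewrite HE.
replace (_ / b * _) with (B * B * (t' - t) * exp (2 * M / b * sqrt T) / (b * sqrt (t' - q))) by (field; lra).
apply Cmod_div_le.
- apply Cmod_mult_le; [|now apply Cmod_cexp_le].
  replace (B * B * (t' - t)) with (B * sqrt (t' - t) * (B * sqrt (t' - t))).
  2:{ rewrite <- (sqrt_sqrt (t' - t)) at 3 by lra. ring. }
  apply Cmod_mult_le; apply (tf_up H); lra.
- nra.
- apply le_Im_le_mod. nra.
Qed.

(** * Comparison of the two exponents *)

(** The kernel is the product of the singularities [1 / (t' - q)] and [1 / sqrt (t - q)],
    where [t' = t + eps]; its integral has the size [sqrt eps], uniformly in [q]. *)
Lemma atan_kernel eps t q : 0 < eps -> q < t ->
  is_derive (fun q => - (2 * sqrt eps * atan (sqrt ((t - q) / eps)))) q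
    (eps / ((t - q + eps) * sqrt (t - q))).
Proof.
intros He Hq.
assert (Hs : 0 < (t - q) / eps) by (apply Rdiv_lt_0_compat; lra).
assert (H1 : 0 < sqrt eps) by now apply sqrt_lt_R0.
assert (H2 : 0 < sqrt (t - q)) by (apply sqrt_lt_R0; lra).
assert (H3 : sqrt eps * sqrt eps = eps) by (apply sqrt_sqrt; lra).
assert (H4 : sqrt (t - q) * sqrt (t - q) = t - q) by (apply sqrt_sqrt; lra).
eapply is_derive_eq.
- apply (is_derive_opp (fun q => 2 * sqrt eps * atan (sqrt ((t - q) / eps)))).
  apply is_derive_scal.
  apply (is_derive_comp atan (fun q => sqrt ((t - q) / eps))); [apply is_derive_atan|].
  apply (is_derive_sqrt (fun q => (t - q) / eps) q (- / eps)); [|exact Hs].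
  auto_derive; [exact I|]. field. lra.
- unfold opp, scal; simpl; unfold mult; simpl.
  rewrite Rsqr_sqrt by lra. rewrite sqrt_div by lra.
  set (a := sqrt eps) in *. set (c := sqrt (t - q)) in *.
  rewrite <- H4, <- H3. field. repeat split; try nra.
Qed.

(** The exponent in [square_difference] has the integrand [2 l / (W t' + W t)], and that of
    [drift_exponent] at [tau] is [l / W tau].  By [tip_increment] their difference
    is controlled by [atan_kernel], so the two exponents differ by [O (sqrt (t' - t))]. *)
Lemma square_first_order {T M delta b B D} : params T M delta b B D ->
  exists K, 0 < K /\ forall lam l W, tip_flow T M delta b B D lam l W ->
  forall t t' tau, 0 < t -> t < t' -> t' <= T -> tau = t \/ tau = t' ->
  forall q, 0 <= q <= t ->
  Cmod (W t' q * W t' q - W t q * W t q + RtoC (4 * (t' - t)) * cexp (drift_exponent l W tau q))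
    <= K * ((t' - t) * sqrt (t' - t)).
Proof.
intros Hp. assert (Hp' := Hp). destruct Hp' as (HT & HM & Hd & Hb & HB & HD).
destruct (tip_increment Hp) as [KD [HKD HD1]].
set (KE := 2 * M / b * sqrt T).
set (K3 := M * KD / (b * b)).
assert (HK3 : 0 < K3) by (apply Rdiv_lt_0_compat; nra).
set (K4 := 4 * K3 + 2 * M / b).
assert (HK4 : 0 < K4).
{ unfold K4. assert (0 < 2 * M / b) by (apply Rdiv_lt_0_compat; lra). lra. }
exists (D * exp KE + 4 * (exp KE * K4)). split.
{ pose proof (exp_pos KE). nra. }
intros lam l W H t t' tau Ht Htt Ht' Htau q Hq.
destruct (square_difference t t' Hp H Ht Htt Ht') as [P [HP0 [HPc [HPd [HPb HE]]]]].
set (eps := t' - t).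
assert (He : 0 < eps) by (unfold eps; lra).
assert (Hse : 0 < sqrt eps) by now apply sqrt_lt_R0.
assert (Htau' : 0 < tau <= T) by (destruct Htau; lra).
destruct (drift_exponent_spec tau Hp H Htau') as [HE0 [HEc HEd]].
assert (HC : Cmod (P q - drift_exponent l W tau q) <= K4 * sqrt eps).
{ assert (Hend : Cmod (P t - drift_exponent l W tau t) <= 2 * M / b * sqrt eps).
  { rewrite HP0. replace (RtoC 0 - _)%C with (- drift_exponent l W tau t)%C by ring. rewrite Cmod_opp.
    eapply Rle_trans; [eapply drift_exponent_bound; try eassumption; destruct Htau; lra|].
    apply Rmult_le_compat_l; [apply Rdiv_le_0_compat; lra|].
    apply sqrt_le_1_alt. unfold eps. destruct Htau; lra. }
  assert (Hmv : Cmod ((P t - drift_exponent l W tau t) - (P q - drift_exponent l W tau q)) <=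
     K3 * - (2 * sqrt eps * atan (sqrt ((t - t) / eps))) - K3 * - (2 * sqrt eps * atan (sqrt ((t - q) / eps)))).
  { apply (mean_value_bound (fun x => P x - drift_exponent l W tau x)%C
      (fun x => - (RtoC (2 * l x) / (W t' x + W t x)) - - (RtoC (l x) / W tau x))%C
      (fun x => K3 * - (2 * sqrt eps * atan (sqrt ((t - x) / eps))))
      (fun x => K3 * (eps / ((t - x + eps) * sqrt (t - x))))); try lra.
    - intros x Hx. apply ccont_minus; [apply HPc; lra|apply HEc].
    - intros x Hx. apply (continuous_mult (K := R_AbsRing)); [apply continuous_const|].
      apply (continuous_opp (fun x => 2 * sqrt eps * atan (sqrt ((t - x) / eps)))).
      apply (continuous_mult (K := R_AbsRing)); [apply continuous_const|].
      apply continuous_atan_comp, continuous_sqrt_comp.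
      apply (continuous_mult (K := R_AbsRing)); [|apply continuous_const].
      apply (continuous_minus (fun _ => t) (fun x => x)); [apply continuous_const|apply continuous_id].
    - intros x Hx. apply cder_minus; [apply HPd; lra|apply HEd; destruct Htau; lra].
    - intros x Hx. apply is_derive_scal. apply atan_kernel; lra.
    - intros x Hx.
      assert (Hs : 0 < sqrt (t - x)) by (apply sqrt_lt_R0; lra).
      assert (Hs' : 0 < sqrt (t' - x)) by (apply sqrt_lt_R0; lra).
      assert (Hss : sqrt (t - x) <= sqrt (t' - x)) by (apply sqrt_le_1_alt; lra).
      pose proof (sum_lower_bound t t' x Hp H Ht Htt Ht' ltac:(lra)) as HL.
      pose proof (tf_low H tau x Htau' ltac:(destruct Htau; lra)) as HLt.
      assert (Hlow : b * sqrt (t - x) <= Im (W tau x)).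
      { eapply Rle_trans; [|exact HLt]. apply Rmult_le_compat_l; [lra|].
        apply sqrt_le_1_alt. destruct Htau; lra. }
      assert (Hn1 : (W t' x + W t x)%C <> RtoC 0) by (apply pos_Im_neq0; nra).
      assert (Hn2 : W tau x <> RtoC 0) by (apply pos_Im_neq0; nra).
      (* For either choice of [tau] the difference of the integrands has the factor [W t' x - W t x]. *)
      assert (Hsg : exists s : C, Cmod s = Cmod (W t' x - W t x) /\
         (- (RtoC (2 * l x) / (W t' x + W t x)) - - (RtoC (l x) / W tau x))%C =
         (RtoC (l x) * s / (W tau x * (W t' x + W t x)))%C).
      { rewrite RtoC_mult. destruct Htau as [-> | ->].
        - exists (W t' x - W t x)%C. split; [reflexivity|]. field. auto.
        - exists (W t x - W t' x)%C. split; [apply Cmod_minus_sym|]. field. auto. }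
      destruct Hsg as [s [Hs1 ->]].
      replace (K3 * (eps / ((t - x + eps) * sqrt (t - x)))) with
         (M * (KD * ((t' - t) / sqrt (t' - x))) / (b * sqrt (t - x) * (b * sqrt (t' - x)))).
      2:{ replace (t - x + eps) with (sqrt (t' - x) * sqrt (t' - x)) by (rewrite sqrt_sqrt; unfold eps; lra).
          unfold K3, eps. field. lra. }
      apply Cmod_div_le.
      + apply Cmod_mult_le.
        * rewrite Cmod_R. apply (tf_l_bound H).
        * rewrite Hs1. apply (HD1 lam l W H); lra.
      + apply Rmult_lt_0_compat; nra.
      + apply Cmod_mult_ge; try nra; apply le_Im_le_mod; nra. }
  replace (P q - drift_exponent l W tau q)%C with ((P t - drift_exponent l W tau t) - ((P t - drift_exponent l W tau t) - (P q - drift_exponent l W tau q)))%C by ring.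
  eapply Rle_trans; [apply Cmod_minus_le; [exact Hend|exact Hmv]|].
  unfold K4. rewrite Rminus_diag. unfold Rdiv at 2. rewrite Rmult_0_l, sqrt_0, atan_0.
  pose proof (proj2 (atan_bound (sqrt ((t - q) / eps)))) as Hat. pose proof PI_4.
  assert (2 * (K3 * sqrt eps) * atan (sqrt ((t - q) / eps)) <= 2 * (K3 * sqrt eps) * 2).
  { apply Rmult_le_compat_l; [|lra]. nra. }
  lra. }
rewrite (HE q Hq).
assert (HPq := HPb q Hq).
assert (HEq : Cmod (drift_exponent l W tau q) <= KE).
{ eapply drift_exponent_uniform_bound; try eassumption. destruct Htau; lra. }
replace (W t' t * W t' t * cexp (P q) + RtoC (4 * eps) * cexp (drift_exponent l W tau q))%C with
  ((W t' t * W t' t + RtoC (4 * (t' - t))) * cexp (P q) - RtoC (4 * eps) * (cexp (P q) - cexp (drift_exponent l W tau q)))%C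
  by (unfold eps; ring).
replace ((_ + _) * _) with (D * (eps * sqrt eps) * exp KE + 4 * eps * (exp KE * (K4 * sqrt eps))) by ring.
apply Cmod_minus_le.
- apply Cmod_mult_le; [apply (tf_sq H); lra|now apply Cmod_cexp_le].
- apply Cmod_mult_le; [rewrite Cmod_R, Rabs_pos_eq; lra|].
  eapply Rle_trans; [apply (cexp_lipschitz _ _ KE); assumption|].
  apply Rmult_le_compat_l; [left; apply exp_pos|exact HC].
Qed.

(** * First-order expansions of the tip and of the kernel *)

(** The derivative of the slit at time [t]. *)
Definition tip_velocity (l : R -> R) (W : R -> R -> C) (t : R) : C :=
  (- (2) * cexp (drift_exponent l W t 0) / W t 0)%C.

(** At time [0] the division of [square_first_order] by [W t' + W t] is harmless, because
    both tips have imaginary part at least of order [sqrt a]. *)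
Lemma tip_first_order {T M delta b B D} a : params T M delta b B D -> 0 < a ->
  exists K, 0 < K /\ forall lam l W, tip_flow T M delta b B D lam l W ->
  forall t t' tau, a <= t -> t < t' -> t' <= T -> tau = t \/ tau = t' ->
  Cmod (W t' 0 - W t 0 - RtoC (t' - t) * tip_velocity l W tau)
    <= K * ((t' - t) * sqrt (t' - t)).
Proof.
intros Hp Ha. assert (Hp' := Hp). destruct Hp' as (HT & HM & Hd & Hb & HB & HD).
destruct (tip_increment Hp) as [KD [HKD HD1]].
destruct (square_first_order Hp) as [K4 [HK4 HE1]].
set (KE := 2 * M / b * sqrt T).
assert (Hsa : 0 < sqrt a) by now apply sqrt_lt_R0.
assert (HsT : 0 < sqrt T) by now apply sqrt_lt_R0.
set (c := b * sqrt a). assert (Hc : 0 < c) by (unfold c; nra).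
pose proof (exp_pos KE) as HeKE.
exists (K4 / c + 2 * exp KE * (KD / sqrt a) * sqrt T / (c * c)). split.
{ assert (0 < K4 / c) by (apply Rdiv_lt_0_compat; lra).
  assert (0 < KD / sqrt a) by (apply Rdiv_lt_0_compat; lra).
  assert (0 < 2 * exp KE * (KD / sqrt a) * sqrt T / (c * c)).
  { apply Rdiv_lt_0_compat; [|nra]. assert (0 < 2 * exp KE * (KD / sqrt a)) by nra. nra. }
  lra. }
intros lam l W H t t' tau Ht Htt Ht' Htau.
specialize (HE1 lam l W H t t' tau ltac:(lra) Htt Ht' Htau 0 ltac:(lra)).
specialize (HD1 lam l W H t t' 0 ltac:(lra) Htt Ht' ltac:(lra)).
set (eps := t' - t) in *. assert (He : 0 < eps) by (unfold eps; lra).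
assert (Hse : 0 < sqrt eps) by now apply sqrt_lt_R0.
assert (Hlow : forall u, a <= u <= T -> c <= Im (W u 0)).
{ intros u Hu. eapply Rle_trans; [|apply (tf_low H); lra].
  unfold c. apply Rmult_le_compat_l; [lra|]. apply sqrt_le_1_alt; lra. }
assert (L1 := Hlow t ltac:(lra)). assert (L2 := Hlow t' ltac:(lra)).
assert (Ltau : c <= Im (W tau 0)) by (destruct Htau; subst; assumption).
assert (LS : c <= Im (W t' 0 + W t 0)%C) by (unfold Im in *; simpl in *; lra).
assert (HDa : Cmod (W t' 0 - W t 0) <= KD / sqrt a * eps).
{ eapply Rle_trans; [exact HD1|].
  replace (KD / sqrt a * eps) with (KD * (eps / sqrt a)) by (field; lra).
  apply Rmult_le_compat_l; [lra|]. apply Rmult_le_compat_l; [lra|].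
  apply Rinv_le_contravar; [assumption|]. apply sqrt_le_1_alt; lra. }
assert (Hse2 : eps = sqrt eps * sqrt eps) by (rewrite sqrt_sqrt; lra).
assert (HeT : eps <= sqrt T * sqrt eps).
{ rewrite Hse2 at 1. apply Rmult_le_compat_r; [lra|]. apply sqrt_le_1_alt. unfold eps; lra. }
assert (Hn1 : (W t' 0 + W t 0)%C <> RtoC 0) by (apply pos_Im_neq0; lra).
assert (Hn2 : W tau 0 <> RtoC 0) by (apply pos_Im_neq0; lra).
assert (Hs : exists s : C, Cmod s = Cmod (W t' 0 - W t 0) /\ (W t' 0 + W t 0 - 2 * W tau 0 = s)%C).
{ destruct Htau as [-> | ->].
  - exists (W t' 0 - W t 0)%C. split; [reflexivity|ring].
  - exists (W t 0 - W t' 0)%C. split; [apply Cmod_minus_sym|ring]. }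
destruct Hs as [s [Hs1 Hs2]].
set (e := cexp (drift_exponent l W tau 0)) in *.
assert (Hee : Cmod e <= exp KE).
{ apply Cmod_cexp_le. eapply drift_exponent_uniform_bound; try eassumption; destruct Htau; lra. }
replace (W t' 0 - W t 0 - RtoC eps * tip_velocity l W tau)%C with
  ((W t' 0 * W t' 0 - W t 0 * W t 0 + RtoC (4 * eps) * e) / (W t' 0 + W t 0)
   + (RtoC (2 * eps) * e * s) / (W tau 0 * (W t' 0 + W t 0)))%C.
2:{ rewrite <- Hs2. unfold tip_velocity. fold e. rewrite !RtoC_mult. field. auto. }
replace (_ * (eps * sqrt eps)) with
  (K4 * (eps * sqrt eps) / c + 2 * eps * exp KE * (KD / sqrt a * (sqrt T * sqrt eps)) / (c * c)) by (field; lra).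
apply Cmod_plus_le.
- apply Cmod_div_le; try assumption. now apply le_Im_le_mod.
- apply Cmod_div_le.
  + apply Cmod_mult_le; [apply Cmod_mult_le; [rewrite Cmod_R, Rabs_pos_eq; lra|assumption]|].
    rewrite Hs1. eapply Rle_trans; [exact HDa|].
    apply Rmult_le_compat_l; [|assumption]. apply Rdiv_le_0_compat; lra.
  + nra.
  + apply Cmod_mult_ge; try lra; now apply le_Im_le_mod.
Qed.

(** The derivative of [1 / W t q] with respect to [t]. *)
Definition inverse_velocity (l : R -> R) (W : R -> R -> C) (t q : R) : C :=
  (2 * cexp (drift_exponent l W t q) / (W t q * W t q * W t q))%C.

(** The condition [t' - t <= t - q] makes [W t q] and [W t' q] comparable. *)
Lemma inverse_first_order {T M delta b B D} : params T M delta b B D ->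
  exists K, 0 < K /\ forall lam l W, tip_flow T M delta b B D lam l W ->
  forall t t' tau q, 0 < t -> t < t' -> t' <= T -> tau = t \/ tau = t' ->
  0 <= q -> t' - t <= t - q ->
  Cmod (/ W t' q - / W t q - RtoC (t' - t) * inverse_velocity l W tau q)
    <= K * ((t' - t) * sqrt (t' - t) / ((t - q) * sqrt (t - q))
            + (t' - t) * (t' - t) / ((t - q) * (t - q) * sqrt (t - q))).
Proof.
intros Hp. assert (Hp' := Hp). destruct Hp' as (HT & HM & Hd & Hb & HB & HD).
destruct (tip_increment Hp) as [KD [HKD HD1]].
destruct (square_first_order Hp) as [K4 [HK4 HE1]].
set (KE := 2 * M / b * sqrt T). pose proof (exp_pos KE) as HeKE.
set (k1 := K4 / (b * b * b)). set (k2 := 2 * exp KE * (3 * B * KD) / (b * b * b * (b * b))).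
assert (Hb3 : 0 < b * b * b) by (assert (0 < b * b) by nra; nra).
assert (Hk1 : 0 < k1) by now apply Rdiv_lt_0_compat.
assert (Hk2 : 0 < k2) by (apply Rdiv_lt_0_compat; [|nra]; repeat apply Rmult_lt_0_compat; lra).
exists (k1 + k2). split; [lra|].
intros lam l W H t t' tau q Ht Htt Ht' Htau Hq Hfar.
specialize (HE1 lam l W H t t' tau ltac:(lra) Htt Ht' Htau q ltac:(lra)).
specialize (HD1 lam l W H t t' q ltac:(lra) Htt Ht' ltac:(lra)).
assert (Hqt : q < t) by lra.
set (eps := t' - t) in *. assert (He : 0 < eps) by (unfold eps; lra).
assert (Hse : 0 < sqrt eps) by now apply sqrt_lt_R0.
set (s := t - q) in *. assert (Hs : 0 < s) by lra.
assert (Hss : 0 < sqrt s) by now apply sqrt_lt_R0.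
assert (Hs2 : s = sqrt s * sqrt s) by (rewrite sqrt_sqrt; lra).
assert (Hs' : sqrt s <= sqrt (t' - q)) by (apply sqrt_le_1_alt; unfold s; lra).
set (r := sqrt s) in *. set (r' := sqrt (t' - q)) in *.
pose proof (tf_low H t q ltac:(lra) ltac:(lra)) as L1.
pose proof (tf_low H t' q ltac:(lra) ltac:(lra)) as L2.
pose proof (tf_up H t q ltac:(lra) ltac:(lra)) as U1.
pose proof (tf_up H t' q ltac:(lra) ltac:(lra)) as U2.
fold s in L1, U1. fold r in L1, U1. fold r' in L2, U2.
assert (L2' : b * r <= Im (W t' q)) by nra.
assert (U1' : Cmod (W t q) <= B * r') by nra.
assert (Hbr : 0 < b * r) by nra.
assert (LS : b * r <= Im (W t' q + W t q)%C) by (unfold Im in *; simpl in *; lra).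
assert (Ltau : b * r <= Im (W tau q)) by (destruct Htau; subst; assumption).
assert (Utau : Cmod (W tau q) <= B * r') by (destruct Htau; subst; assumption).
assert (Hn1 : W t q <> RtoC 0) by (apply pos_Im_neq0; lra).
assert (Hn2 : W t' q <> RtoC 0) by (apply pos_Im_neq0; lra).
assert (Hn3 : W tau q <> RtoC 0) by (apply pos_Im_neq0; lra).
assert (Hn4 : (W t' q + W t q)%C <> RtoC 0) by (apply pos_Im_neq0; lra).
set (e := cexp (drift_exponent l W tau q)) in *.
assert (Hee : Cmod e <= exp KE).
{ apply Cmod_cexp_le. eapply drift_exponent_uniform_bound; try eassumption; destruct Htau; lra. }
(* For either choice of [tau] the difference of the cubic terms has the factor [W t' q - W t q]. *)
assert (Hg : exists g : C, Cmod g <= 3 * (B * r') * (KD * (eps / r')) /\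
  (2 * (W tau q * W tau q * W tau q) - W t q * W t' q * (W t' q + W t q) = W tau q * g)%C).
{ destruct Htau as [-> | ->].
  - exists ((2 * W t q + W t' q) * (W t q - W t' q))%C. split; [|ring].
    apply Cmod_mult_le; [|now rewrite Cmod_minus_sym].
    replace (3 * (B * r')) with (2 * (B * r') + B * r') by ring.
    apply Cmod_plus_le; [|assumption]. apply Cmod_mult_le; [|assumption].
    rewrite Cmod_R, Rabs_pos_eq; lra.
  - exists ((2 * W t' q + W t q) * (W t' q - W t q))%C. split; [|ring].
    apply Cmod_mult_le; [|assumption].
    replace (3 * (B * r')) with (2 * (B * r') + B * r') by ring.
    apply Cmod_plus_le; [|assumption]. apply Cmod_mult_le; [|assumption].
    rewrite Cmod_R, Rabs_pos_eq; lra. }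
destruct Hg as [g [Hg1 Hg2]].
replace (/ W t' q - / W t q - RtoC eps * inverse_velocity l W tau q)%C with
  (- ((W t' q * W t' q - W t q * W t q + RtoC (4 * eps) * e) / (W t q * W t' q * (W t' q + W t q)))
   + (RtoC (2 * eps) * e * g) / (W t q * W t' q * (W t' q + W t q) * (W tau q * W tau q)))%C.
2:{ unfold inverse_velocity. fold e.
    replace g with ((2 * (W tau q * W tau q * W tau q) - W t q * W t' q * (W t' q + W t q)) / W tau q)%C
      by (rewrite Hg2; field; assumption).
    rewrite !RtoC_mult. field. auto. }
assert (M3 : b * b * b * (s * r) <= Cmod (W t q * W t' q * (W t' q + W t q))).
{ rewrite Hs2. fold r. replace (b * b * b * (r * r * r)) with (b * r * (b * r) * (b * r)) by ring.
  assert (0 < b * r * (b * r)) by nra.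
  apply Cmod_mult_ge; try lra; [apply Cmod_mult_ge; try lra|]; now apply le_Im_le_mod. }
assert (M4 : b * b * s <= Cmod (W tau q * W tau q)).
{ rewrite Hs2. fold r. replace (b * b * (r * r)) with (b * r * (b * r)) by ring.
  apply Cmod_mult_ge; try lra; now apply le_Im_le_mod. }
assert (Hsr : 0 < s * r) by nra. assert (Hr' : 0 < r') by lra.
assert (Hb2 : 0 < b * b) by nra. assert (Hb2s : 0 < b * b * s) by nra.
assert (Hb3s : 0 < b * b * b * (s * r)) by nra.
eapply Rle_trans.
- apply (Cmod_plus_le _ _ (k1 * (eps * sqrt eps / (s * r))) (k2 * (eps * eps / (s * s * r)))).
  + rewrite Cmod_opp.
    replace (k1 * _) with (K4 * (eps * sqrt eps) / (b * b * b * (s * r))) by (unfold k1; field; lra).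
    apply Cmod_div_le; assumption.
  + replace (k2 * _) with (2 * eps * exp KE * (3 * (B * r') * (KD * (eps / r'))) / (b * b * b * (s * r) * (b * b * s))).
    2:{ unfold k2. field. lra. }
    apply Cmod_div_le.
    * apply Cmod_mult_le; [apply Cmod_mult_le; [rewrite Cmod_R, Rabs_pos_eq; lra|assumption]|assumption].
    * nra.
    * apply Cmod_mult_ge; try assumption; lra.
- assert (0 <= eps * sqrt eps / (s * r)) by (apply Rdiv_le_0_compat; nra).
  assert (0 <= eps * eps / (s * s * r)) by (apply Rdiv_le_0_compat; nra).
  nra.
Qed.

(** * The drift exponent is of class C^{1,delta} *)

Lemma driving_derivative_holder {T M delta b B D lam l W} q p x : params T M delta b B D ->
  tip_flow T M delta b B D lam l W -> Rabs (q - p) <= x ->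
  Rabs (l q - l p) <= M * (sqrt x * pw delta x).
Proof.
intros (HT & HM & Hd & Hb & HB & HD) H Hx.
eapply Rle_trans; [apply (tf_l_holder H)|].
apply Rmult_le_compat_l; [lra|].
rewrite <- pw_half_plus by (eapply Rle_trans; [apply Rabs_pos|exact Hx]).
apply pw_le; lra.
Qed.

(** As a function of [q], the integral from [q] to [t] of the derivative of [1 / W t] with respect
    to [t], against [l - l t].  The Hoelder exponent of [l] makes the singularity
    [(t - q) ^ (-3/2)] integrable. *)
Definition singular_part (l : R -> R) (W : R -> R -> C) (t : R) : R -> C :=
  epsilon (inhabits (fun _ => RtoC 0))
    (tail_primitive (fun q => - (RtoC (l q - l t) * inverse_velocity l W t q))%C t).

Lemma singular_integrand_bound {T M delta b B D lam l W} t q : params T M delta b B D ->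
  tip_flow T M delta b B D lam l W -> 0 < t <= T -> 0 <= q < t ->
  Cmod (- (RtoC (l q - l t) * inverse_velocity l W t q)) <=
    2 * M * exp (2 * M / b * sqrt T) / (b * b * b) * (pw delta (t - q) / (t - q)).
Proof.
intros Hp H Ht Hq. assert (Hp' := Hp). destruct Hp' as (HT & HM & Hd & Hb & HB & HD).
rewrite Cmod_opp.
assert (Hs : 0 < sqrt (t - q)) by (apply sqrt_lt_R0; lra).
assert (Hs2 : sqrt (t - q) * sqrt (t - q) = t - q) by (apply sqrt_sqrt; lra).
pose proof (tf_low H t q ltac:(lra) ltac:(lra)) as L1.
assert (Hbr : 0 < b * sqrt (t - q)) by nra.
replace (_ / (b * b * b) * _) with
  (M * (sqrt (t - q) * pw delta (t - q)) * (2 * exp (2 * M / b * sqrt T) / (b * sqrt (t - q) * (b * sqrt (t - q)) * (b * sqrt (t - q))))).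
2:{ rewrite <- Hs2 at 7. field. lra. }
apply Cmod_mult_le.
- rewrite Cmod_R. eapply driving_derivative_holder; try eassumption. rewrite Rabs_minus_sym, Rabs_pos_eq; lra.
- unfold inverse_velocity. assert (0 < b * sqrt (t - q) * (b * sqrt (t - q))) by nra.
  apply Cmod_div_le.
  + apply Cmod_mult_le; [rewrite Cmod_R, Rabs_pos_eq; lra|].
    apply Cmod_cexp_le. eapply drift_exponent_uniform_bound; try eassumption; lra.
  + nra.
  + apply Cmod_mult_ge; try lra; [apply Cmod_mult_ge; try lra|]; now apply le_Im_le_mod.
Qed.

Lemma singular_part_spec {T M delta b B D lam l W} t : params T M delta b B D ->
  tip_flow T M delta b B D lam l W -> 0 < t <= T ->
  tail_primitive (fun q => - (RtoC (l q - l t) * inverse_velocity l W t q))%C t (singular_part l W t).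
Proof.
intros Hp H Ht. unfold singular_part. apply epsilon_spec.
assert (Hp' := Hp). destruct Hp' as (HT & HM & Hd & Hb & HB & HD).
destruct (drift_exponent_spec t Hp H Ht) as [_ [HEc _]].
apply (tail_primitive_exists _ 0 t delta (2 * M * exp (2 * M / b * sqrt T) / (b * b * b))); try lra.
- intros x Hx. apply ccont_opp, ccont_mult.
  + apply ccont_real. apply (continuous_minus l (fun _ => l t));
    [apply (tf_l_cont H)|apply continuous_const].
  + assert (Hn : W t x <> RtoC 0) by (apply pos_Im_neq0, (tf_pos H); assumption).
    apply ccont_div.
    * apply ccont_mult; [apply ccont_const|apply ccont_cexp, HEc].
    * repeat apply ccont_mult; apply (tf_cont H); assumption.
    * repeat apply Cmult_neq_0; assumption.
- intros x Hx. eapply singular_integrand_bound; try eassumption; lra.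
Qed.

Lemma singular_part_bound {T M delta b B D lam l W} t q : params T M delta b B D ->
  tip_flow T M delta b B D lam l W -> 0 < t <= T -> 0 <= q <= t ->
  Cmod (singular_part l W t q) <=
    2 * M * exp (2 * M / b * sqrt T) / (b * b * b) / delta * pw delta (t - q).
Proof.
intros Hp H Ht Hq. assert (Hp' := Hp). destruct Hp' as (HT & HM & Hd & Hb & HB & HD).
destruct (singular_part_spec t Hp H Ht) as [J0 [Jc Jd]].
apply (tail_primitive_bound (fun q => - (RtoC (l q - l t) * inverse_velocity l W t q))%C (singular_part l W t) 0 t delta _ q); auto; try lra.
- intros; apply Jd; lra.
- apply J0; lra.
- intros y Hy. eapply singular_integrand_bound; try eassumption; lra.
Qed.

(** The derivative of [drift_exponent l W t 0] with respect to [t].  The second summand is the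
    derivative of [l t] times the explicit integral of [1 / W], with [l t] held fixed. *)
Definition drift_exponent_velocity (l : R -> R) (W : R -> R -> C) (t : R) : C :=
  (singular_part l W t 0 + RtoC (l t) * (RtoC (l t) - tip_velocity l W t) / 2)%C.

(** As a function of [q], the integral of [(l - c) / W t] from [q] to [t]: the equation of [W]
    integrates [1 / W t] to half of [lam t - lam q - W t q]. *)
Definition compensated_exponent (lam l : R -> R) (W : R -> R -> C) (c t q : R) : C :=
  (drift_exponent l W t q - RtoC (c / 2) * (RtoC (lam t - lam q) - W t q))%C.

Lemma compensated_exponent_spec {T M delta b B D lam l W} c t : params T M delta b B D ->
  tip_flow T M delta b B D lam l W -> 0 < t <= T ->
  compensated_exponent lam l W c t t = RtoC 0 /\
  (forall q, ccont (compensated_exponent lam l W c t) q) /\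
  (forall q, 0 < q < t -> cder (compensated_exponent lam l W c t) q (- (RtoC (l q - c) / W t q))).
Proof.
intros Hp H Ht. assert (Hp' := Hp). destruct Hp' as (HT & HM & Hd & Hb & HB & HD).
destruct (drift_exponent_spec t Hp H Ht) as [HE0 [HEc HEd]].
split; [|split].
- unfold compensated_exponent. rewrite (HE0 t), (tf_zero H t t) by lra.
  rewrite Rminus_diag. ring.
- intros q. apply ccont_minus; [apply HEc|]. apply ccont_mult; [apply ccont_const|].
  apply ccont_minus; [|apply (tf_cont H); assumption].
  apply ccont_real. apply (continuous_minus (fun _ => lam t) lam); [apply continuous_const|].
  apply (tf_lam_cont H).
- intros q Hq.
  assert (Hn : W t q <> RtoC 0) by (apply pos_Im_neq0, (tf_pos H); lra).
  eapply cder_eq.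
  + apply cder_minus; [apply HEd; lra|]. apply cder_mult; [apply cder_const|].
    apply cder_minus; [|apply (tf_der H); lra].
    apply (cder_real (fun q => lam t - lam q) q (- l q)).
    eapply is_derive_eq.
    * apply (is_derive_minus (fun _ => lam t) lam); [apply (is_derive_const (K := R_AbsRing))|].
      apply (tf_lam_der H); lra.
    * unfold minus, plus, opp, zero; simpl; ring.
  + rewrite RtoC_minus, RtoC_opp, RtoC_div by lra. cbv beta. field. assumption.
Qed.

(** Within distance [2 * x] of the tip no cancellation between the two times is needed: the size of
    the integrand is enough. *)
Lemma compensated_exponent_near {T M delta b B D lam l W} c t m x : params T M delta b B D ->
  tip_flow T M delta b B D lam l W -> 0 < t <= T -> 0 <= m <= t -> t - m <= 2 * x -> 0 < x ->
  (forall q, m < q < t -> Rabs (l q - c) <= M * (sqrt (2 * x) * pw delta (2 * x))) ->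
  Cmod (compensated_exponent lam l W c t m) <= 8 * M / b * (x * pw delta x).
Proof.
intros Hp H Ht Hm Hmx Hx Hl. assert (Hp' := Hp). destruct Hp' as (HT & HM & Hd & Hb & HB & HD).
destruct (compensated_exponent_spec c t Hp H Ht) as [H0 [Hc Hder]].
set (L := M * (sqrt (2 * x) * pw delta (2 * x))) in *.
assert (HL : 0 <= L).
{ unfold L. apply Rmult_le_pos; [lra|]. apply Rmult_le_pos; [apply sqrt_pos|apply pw_nonneg]. }
eapply Rle_trans.
- apply (tail_primitive_bound (fun q => - (RtoC (l q - c) / W t q))%C (compensated_exponent lam l W c t) m t (1/2) (L / b) m); auto; try lra.
  + intros; apply Hder; lra.
  + intros y Hy. rewrite Cmod_opp, <- inverse_sqrt_as_power by lra.
    assert (0 < sqrt (t - y)) by (apply sqrt_lt_R0; lra).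
    apply Cmod_div_le.
    * rewrite Cmod_R. now apply Hl.
    * nra.
    * apply le_Im_le_mod, (tf_low H); lra.
- apply Rle_trans with (L / b / (1/2) * sqrt (2 * x)).
  + apply Rmult_le_compat_l; [apply Rdiv_le_0_compat; [apply Rdiv_le_0_compat|]; lra|].
    rewrite <- pw_half by lra. apply pw_le; lra.
  + unfold L.
    replace (_ / b / (1/2) * _) with (2 * M / b * (sqrt (2 * x) * sqrt (2 * x)) * pw delta (2 * x)) by (field; lra).
    rewrite sqrt_sqrt by lra.
    replace (8 * M / b * (x * pw delta x)) with (2 * M / b * (2 * x) * (2 * pw delta x)) by (field; lra).
    apply Rmult_le_compat_l; [|apply pw_double; lra].
    apply Rmult_le_pos; [apply Rdiv_le_0_compat|]; lra.
Qed.

(** Since [delta <= 1/2], errors of order [3/2] are also of order [1 + delta]. *)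
Lemma sqrt_le_pw T delta x : 0 < delta <= 1 / 2 -> 0 < x <= T ->
  sqrt x <= pw (1 / 2 - delta) T * pw delta x.
Proof.
intros Hd Hx. rewrite <- pw_half by lra.
replace (pw (1/2) x) with (pw (1 / 2 - delta) x * pw delta x).
- apply Rmult_le_compat_r; [apply pw_nonneg|]. apply pw_le; lra.
- rewrite !pw_gt0 by lra. rewrite <- Rpower_plus. f_equal. ring.
Qed.

(** The two singularities are those of [inverse_first_order] multiplied by
    [(t - q) ^ (1/2 + delta)]. *)
Lemma far_kernel delta eps t q : 0 < delta <= 1 / 2 -> q < t ->
  is_derive (fun q => eps * sqrt eps * (- / delta * pw delta (t - q)) +
      eps * eps * (/ (1 - delta) * (pw delta (t - q) / (t - q)))) q
    (eps * sqrt eps * (pw delta (t - q) / (t - q)) + eps * eps * (pw delta (t - q) / ((t - q) * (t - q)))).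
Proof.
intros Hd Hq.
assert (Hpw : is_derive (fun q => pw delta (t - q)) q (- (delta * pw delta (t - q) / (t - q)))).
{ eapply is_derive_eq.
  - apply (is_derive_comp (pw delta) (fun q => t - q)); [apply pw_deriv; lra|].
    auto_derive; [exact I|reflexivity].
  - unfold scal; simpl; unfold mult; simpl. ring. }
assert (Hl : is_derive (fun q => t - q) q (- 1)) by (auto_derive; [exact I|ring]).
eapply is_derive_eq.
- apply (is_derive_plus (V := R_NormedModule) (fun q => eps * sqrt eps * (- / delta * pw delta (t - q)))
   (fun q => eps * eps * (/ (1 - delta) * (pw delta (t - q) / (t - q))))).
  + apply is_derive_scal, is_derive_scal, Hpw.
  + apply is_derive_scal, is_derive_scal. apply is_derive_div; [exact Hpw|exact Hl|lra].
- unfold plus; simpl. field. lra.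
Qed.

(** Away from the tip the difference of the integrands is replaced by its first-order
    expansion [inverse_first_order].  The error is integrated from the distance [t' - t] on,
    which costs the factor [(t' - t) ^ (delta - 1)] in the term of second order. *)
Lemma compensated_exponent_far {T M delta b B D} : params T M delta b B D ->
  exists K, 0 < K /\ forall lam l W, tip_flow T M delta b B D lam l W ->
  forall t t' tau, 0 < t -> t < t' -> t' <= T -> tau = t \/ tau = t' -> t' - t < t ->
  let defect q := (compensated_exponent lam l W (l tau) t' q - compensated_exponent lam l W (l tau) t q
    - RtoC (t' - t) * singular_part l W tau q)%C in
  Cmod (defect (t - (t' - t)) - defect 0) <= K * ((t' - t) * pw delta (t' - t)).
Proof.
intros Hp. assert (Hp' := Hp). destruct Hp' as (HT & HM & Hd & Hb & HB & HD).
destruct (inverse_first_order Hp) as [K [HK HX]].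
assert (HpT : 0 < pw delta T) by (apply pw_pos; lra).
assert (HpT' : 0 < pw (1 / 2 - delta) T) by (apply pw_pos; lra).
exists (4 * M * K * (pw (1 / 2 - delta) T * pw delta T / delta + 2)). split.
{ assert (0 < pw (1 / 2 - delta) T * pw delta T / delta) by (apply Rdiv_lt_0_compat; nra).
  assert (0 < 4 * M * K) by nra. nra. }
intros lam l W H t t' tau Ht Htt Ht' Htau Hfar defect.
set (eps := t' - t) in *. assert (He : 0 < eps) by (unfold eps; lra).
assert (Htau' : 0 < tau <= T) by (destruct Htau; lra).
destruct (compensated_exponent_spec (l tau) t Hp H ltac:(lra)) as [_ [Sc Sd]].
destruct (compensated_exponent_spec (l tau) t' Hp H ltac:(lra)) as [_ [Sc' Sd']].
destruct (singular_part_spec tau Hp H Htau') as [_ [Jc Jd]].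
set (phi := fun q => eps * sqrt eps * (- / delta * pw delta (t - q)) +
      eps * eps * (/ (1 - delta) * (pw delta (t - q) / (t - q)))).
set (phi' := fun q => eps * sqrt eps * (pw delta (t - q) / (t - q)) + eps * eps * (pw delta (t - q) / ((t - q) * (t - q)))).
assert (Hphi : forall q, q < t -> is_derive (fun q => 4 * M * K * phi q) q (4 * M * K * phi' q)).
{ intros q Hq. apply is_derive_scal. now apply far_kernel. }
eapply Rle_trans.
- apply (mean_value_bound defect
   (fun q => - (RtoC (l q - l tau) / W t' q) - - (RtoC (l q - l tau) / W t q)
     - RtoC eps * - (RtoC (l q - l tau) * inverse_velocity l W tau q))%C
   (fun q => 4 * M * K * phi q) (fun q => 4 * M * K * phi' q)); try lra.
  + intros q Hq. apply ccont_minus; [apply ccont_minus; [apply Sc'|apply Sc]|].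
    apply ccont_mult; [apply ccont_const|apply Jc].
  + intros q Hq. eapply is_derive_continuous. apply Hphi; lra.
  + intros q Hq. eapply cder_eq.
    * apply cder_minus; [apply cder_minus; [apply Sd'; lra|apply Sd; lra]|].
      apply cder_mult; [apply cder_const|apply Jd; destruct Htau; lra].
    * cbv beta. ring.
  + intros q Hq. apply Hphi; lra.
  + intros q Hq.
    assert (Hs : 0 < sqrt (t - q)) by (apply sqrt_lt_R0; lra).
    assert (Hs2 : sqrt (t - q) * sqrt (t - q) = t - q) by (apply sqrt_sqrt; lra).
    replace (- (RtoC (l q - l tau) / W t' q) - - (RtoC (l q - l tau) / W t q)
     - RtoC eps * - (RtoC (l q - l tau) * inverse_velocity l W tau q))%C with
     (- (RtoC (l q - l tau) * (/ W t' q - / W t q - RtoC eps * inverse_velocity l W tau q)))%C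
     by (unfold Cdiv; ring).
    rewrite Cmod_opp.
    replace (4 * M * K * phi' q) with (M * (2 * sqrt (t - q) * (2 * pw delta (t - q))) *
      (K * (eps * sqrt eps / ((t - q) * sqrt (t - q)) + eps * eps / ((t - q) * (t - q) * sqrt (t - q))))).
    2:{ unfold phi'. field. lra. }
    apply Cmod_mult_le.
    * rewrite Cmod_R. eapply Rle_trans.
      -- apply (driving_derivative_holder q tau (2 * (t - q)) Hp H).
         rewrite Rabs_minus_sym, Rabs_pos_eq; destruct Htau; unfold eps in *; lra.
      -- apply Rmult_le_compat_l; [lra|]. apply Rmult_le_compat.
         ++ apply sqrt_pos.
         ++ apply pw_nonneg.
         ++ rewrite sqrt_mult by lra. apply Rmult_le_compat_r; [lra|].
            rewrite <- (sqrt_square 2) at 2 by lra. apply sqrt_le_1_alt; lra.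
         ++ apply pw_double; lra.
    * apply (HX lam l W H); try assumption; unfold eps in *; lra.
- unfold phi.
  replace (t - (t - eps)) with eps by ring. rewrite Rminus_0_r.
  assert (Hpe : 0 < pw delta eps) by now apply pw_pos.
  assert (Hpt : 0 < pw delta t) by now apply pw_pos.
  assert (HptT : pw delta t <= pw delta T) by (apply pw_le; lra).
  assert (Hse : 0 < sqrt eps) by now apply sqrt_lt_R0.
  assert (HeT : sqrt eps <= pw (1 / 2 - delta) T * pw delta eps) by (apply sqrt_le_pw; unfold eps; lra).
  assert (Hi : 0 < / delta) by (apply Rinv_0_lt_compat; lra).
  assert (Hi2 : 0 < / (1 - delta) <= 2).
  { split; [apply Rinv_0_lt_compat; lra|]. rewrite <- (Rinv_inv 2). apply Rinv_le_contravar; lra. }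
  replace (eps * eps * (/ (1 - delta) * (pw delta eps / eps))) with (/ (1 - delta) * (eps * pw delta eps)) by (field; lra).
  set (A := eps * pw delta eps). assert (HA : 0 < A) by (unfold A; nra).
  assert (H1 : eps * sqrt eps * (/ delta * pw delta t) <= pw (1 / 2 - delta) T * pw delta T / delta * A).
  { replace (pw (1 / 2 - delta) T * pw delta T / delta * A) with
      (eps * (pw (1 / 2 - delta) T * pw delta eps) * (/ delta * pw delta T)) by (unfold A; field; lra).
    apply Rmult_le_compat; try nra. }
  assert (H2 : 0 <= eps * sqrt eps * (/ delta * pw delta eps)).
  { apply Rmult_le_pos; [|apply Rmult_le_pos]; nra. }
  assert (H3 : 0 <= eps * eps * (/ (1 - delta) * (pw delta t / t))).
  { assert (0 < pw delta t / t) by (apply Rdiv_lt_0_compat; lra). assert (0 < eps * eps) by nra. 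
    apply Rmult_le_pos; [lra|]. apply Rmult_le_pos; lra. }
  assert (H4 : / (1 - delta) * A <= 2 * A) by nra.
  assert (HMK : 0 < 4 * M * K) by nra.
  rewrite <- Rmult_minus_distr_l.
  replace (4 * M * K * (pw (1 / 2 - delta) T * pw delta T / delta + 2) * A) with
    (4 * M * K * (pw (1 / 2 - delta) T * pw delta T / delta * A + 2 * A)) by ring.
  apply Rmult_le_compat_l; lra.
Qed.

(** The times at distance at most [t' - t] from [t] are treated by [compensated_exponent_near], the
    others by [compensated_exponent_far].  The choice [c = l tau] covers the expansions at both
    end points with the same argument. *)
Lemma drift_exponent_first_order {T M delta b B D} a : params T M delta b B D -> 0 < a ->
  exists K, 0 < K /\ forall lam l W, tip_flow T M delta b B D lam l W ->
  forall t t' tau, a <= t -> t < t' -> t' <= T -> tau = t \/ tau = t' ->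
  Cmod (drift_exponent l W t' 0 - drift_exponent l W t 0 - RtoC (t' - t) * drift_exponent_velocity l W tau)
    <= K * ((t' - t) * pw delta (t' - t)).
Proof.
intros Hp Ha. assert (Hp' := Hp). destruct Hp' as (HT & HM & Hd & Hb & HB & HD).
destruct (compensated_exponent_far Hp) as [KF [HKF HF]].
destruct (tip_first_order a Hp Ha) as [KV [HKV HV]].
set (KJ := 2 * M * exp (2 * M / b * sqrt T) / (b * b * b) / delta).
assert (HKJ : 0 < KJ).
{ unfold KJ. apply Rdiv_lt_0_compat; [|lra]. apply Rdiv_lt_0_compat.
  - pose proof (exp_pos (2 * M / b * sqrt T)). nra.
  - assert (0 < b * b) by nra. nra. }
set (KN := 8 * M / b).
assert (HKN : 0 < KN) by (unfold KN; apply Rdiv_lt_0_compat; lra).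
set (p := pw (1 / 2 - delta) T). assert (Hpp : 0 < p) by (apply pw_pos; lra).
assert (HsT : 0 < sqrt T) by now apply sqrt_lt_R0.
exists (KN + KN + 2 * KJ + KF + M / 2 * (M * sqrt T + KV * p)). split.
{ assert (0 < M * sqrt T + KV * p) by nra. nra. }
intros lam l W H t t' tau Hat Htt Ht' Htau.
specialize (HV lam l W H t t' tau Hat Htt Ht' Htau).
specialize (HF lam l W H t t' tau ltac:(lra) Htt Ht' Htau). cbv zeta in HF.
set (c := l tau) in *.
(* The far range is [[0, m]]; it is empty when [t <= t' - t]. *)
set (m := Rmax 0 (t - (t' - t))).
assert (Hm0 : 0 <= m) by apply Rmax_l.
assert (Hm1 : t - (t' - t) <= m) by apply Rmax_r.
assert (Hm2 : m < t) by (apply Rmax_lub_lt; lra).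
assert (Htau' : 0 < tau <= T) by (destruct Htau; lra).
assert (Hln : forall q, m < q < t' -> Rabs (l q - c) <= M * (sqrt (2 * (t' - t)) * pw delta (2 * (t' - t)))).
{ intros q Hq. eapply driving_derivative_holder; try eassumption.
  apply Rabs_le. destruct Htau; lra. }
(* The error of the first-order expansion of the compensated exponent, integrated from [q] only. *)
set (defect := fun q => (compensated_exponent lam l W c t' q - compensated_exponent lam l W c t q
    - RtoC (t' - t) * singular_part l W tau q)%C).
assert (N1 : Cmod (compensated_exponent lam l W c t m) <= KN * ((t' - t) * pw delta (t' - t))).
{ eapply compensated_exponent_near; try eassumption; try lra. intros; apply Hln; lra. }
assert (N2 : Cmod (compensated_exponent lam l W c t' m) <= KN * ((t' - t) * pw delta (t' - t))).
{ eapply compensated_exponent_near; try eassumption; try lra. }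
set (eps := t' - t) in *. assert (He : 0 < eps) by (unfold eps; lra).
assert (Hpe : 0 < pw delta eps) by now apply pw_pos.
set (A := eps * pw delta eps) in *. assert (HA : 0 < A) by (unfold A; nra).
assert (N3 : Cmod (RtoC eps * singular_part l W tau m) <= 2 * KJ * A).
{ rewrite Cmod_mult, Cmod_R, Rabs_pos_eq by lra.
  replace (2 * KJ * A) with (eps * (KJ * (2 * pw delta eps))) by (unfold A; ring).
  apply Rmult_le_compat_l; [lra|].
  eapply Rle_trans; [eapply singular_part_bound; try eassumption; destruct Htau; lra|].
  apply Rmult_le_compat_l; [left; exact HKJ|].
  eapply Rle_trans; [|apply pw_double; lra].
  apply pw_le; [lra|]. destruct Htau; unfold eps in *; lra. }
assert (NF : Cmod (defect m - defect 0) <= KF * A).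
{ destruct (Rle_dec (t - eps) 0) as [Hc|Hc].
  - unfold m. rewrite Rmax_left by assumption.
    replace (defect 0 - defect 0)%C with (RtoC 0) by ring. rewrite Cmod_0. nra.
  - unfold m. rewrite Rmax_right by lra. apply HF. lra. }
assert (N0 : Cmod (defect 0) <= KN * A + KN * A + 2 * KJ * A + KF * A).
{ replace (defect 0) with (defect m - (defect m - defect 0))%C by ring.
  apply Cmod_minus_le; [|assumption].
  unfold defect. apply Cmod_minus_le; [|assumption]. now apply Cmod_minus_le. }
assert (Hlam : Rabs (lam t' - lam t - c * eps) <= M * (sqrt eps * pw delta eps) * eps).
{ replace (lam t' - lam t - c * eps) with ((lam t' - c * t') - (lam t - c * t)) by (unfold eps; ring).
  replace (M * (sqrt eps * pw delta eps) * eps) with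
    (M * (sqrt eps * pw delta eps) * t' - M * (sqrt eps * pw delta eps) * t) by (unfold eps; ring).
  apply (real_mean_value_bound (fun u => lam u - c * u) (fun u => l u - c)
    (fun u => M * (sqrt eps * pw delta eps) * u) (fun _ => M * (sqrt eps * pw delta eps))); try lra.
  - intros x Hx. apply (continuous_minus lam (fun u => c * u)); [apply (tf_lam_cont H)|].
    apply (continuous_mult (K := R_AbsRing)); [apply continuous_const|apply continuous_id].
  - intros x Hx. apply (continuous_mult (K := R_AbsRing)); [apply continuous_const|apply continuous_id].
  - intros x Hx. eapply is_derive_eq.
    + apply (is_derive_minus lam (fun u => c * u)).
      * apply (tf_lam_der H); lra.
      * apply is_derive_scal, (is_derive_id (K := R_AbsRing)).
    + unfold minus, plus, opp, one; simpl. ring.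
  - intros x Hx. auto_derive; [exact I|ring].
  - intros x Hx. eapply driving_derivative_holder; try eassumption.
    unfold eps. apply Rabs_le. destruct Htau; lra. }
assert (Hs1 : sqrt eps <= sqrt T) by (apply sqrt_le_1_alt; unfold eps; lra).
assert (Hs2 : sqrt eps <= p * pw delta eps) by (apply sqrt_le_pw; unfold eps in *; lra).
assert (Hse : 0 < sqrt eps) by now apply sqrt_lt_R0.
replace (drift_exponent l W t' 0 - drift_exponent l W t 0 - RtoC eps * drift_exponent_velocity l W tau)%C with
  (defect 0 + RtoC (c / 2) * (RtoC (lam t' - lam t - c * eps)
      - (W t' 0 - W t 0 - RtoC eps * tip_velocity l W tau)))%C.
2:{ unfold defect, compensated_exponent, drift_exponent_velocity. fold c.
    rewrite !RtoC_minus, !RtoC_mult, !RtoC_div by lra. field. }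
replace (_ * A) with (KN * A + KN * A + 2 * KJ * A + KF * A + M / 2 * ((M * sqrt T + KV * p) * A)) by field.
apply Cmod_plus_le; [assumption|].
apply Cmod_mult_le.
- rewrite Cmod_R. unfold Rdiv. rewrite Rabs_mult, (Rabs_pos_eq (/ 2)) by lra.
  apply Rmult_le_compat_r; [lra|]. apply (tf_l_bound H).
- replace ((M * sqrt T + KV * p) * A) with (M * sqrt T * A + KV * (p * A)) by ring.
  apply Cmod_minus_le.
  + rewrite Cmod_R. eapply Rle_trans; [exact Hlam|].
    replace (M * (sqrt eps * pw delta eps) * eps) with (M * sqrt eps * A) by (unfold A; ring).
    apply Rmult_le_compat_r; [lra|]. apply Rmult_le_compat_l; lra.
  + eapply Rle_trans; [exact HV|]. apply Rmult_le_compat_l; [lra|].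
    replace (p * A) with (eps * (p * pw delta eps)) by (unfold A; ring).
    apply Rmult_le_compat_l; lra.
Qed.

(** * Functions with a uniform first-order expansion *)

(** A quantitative C^{1,delta} class on [[a, T]].  Exchanging [t] and [t'] in the expansion shows that
    [F'] is Hoelder continuous. *)
Definition C1_holder (a T delta K : R) (F F' : R -> C) : Prop :=
  (forall t, a <= t <= T -> Cmod (F t) <= K /\ Cmod (F' t) <= K) /\
  (forall t t', a <= t <= T -> a <= t' <= T ->
    Cmod (F t' - F t - RtoC (t' - t) * F' t) <= K * (Rabs (t' - t) * pw delta (Rabs (t' - t)))).

Lemma C1_holder_weaken a T delta K L F F' : K <= L ->
  C1_holder a T delta K F F' -> C1_holder a T delta L F F'.
Proof.
intros HKL [H1 H2]. split.
- intros t Ht. destruct (H1 t Ht). lra.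
- intros t t' Ht Ht'. eapply Rle_trans; [now apply H2|].
  apply Rmult_le_compat_r; [|assumption].
  apply Rmult_le_pos; [apply Rabs_pos|apply pw_nonneg].
Qed.

Lemma C1_holder_of_ordered a T delta K F F' :
  (forall t, a <= t <= T -> Cmod (F t) <= K /\ Cmod (F' t) <= K) ->
  (forall t t' tau, a <= t -> t < t' -> t' <= T -> tau = t \/ tau = t' ->
    Cmod (F t' - F t - RtoC (t' - t) * F' tau) <= K * ((t' - t) * pw delta (t' - t))) ->
  C1_holder a T delta K F F'.
Proof.
intros H1 H2. split; [assumption|]. intros t t' Ht Ht'.
destruct (Rtotal_order t t') as [Hlt | [-> | Hgt]].
- rewrite Rabs_pos_eq by lra. apply (H2 t t' t); auto; lra.
- rewrite Rminus_diag. replace (_ - _ - _)%C with (RtoC 0) by ring.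
  rewrite Cmod_0, Rabs_R0. lra.
- rewrite Rabs_minus_sym, Rabs_pos_eq by lra. rewrite <- Cmod_opp.
  replace (- _)%C with (F t - F t' - RtoC (t - t') * F' t)%C by (rewrite !RtoC_minus; ring).
  apply (H2 t' t t); auto; lra.
Qed.

Lemma le_pw T delta x : 0 < delta <= 1 / 2 -> 0 <= x <= T ->
  x <= sqrt T * pw (1 / 2 - delta) T * pw delta x.
Proof.
intros Hd [[Hx | <-] HT].
- assert (0 < sqrt x) by now apply sqrt_lt_R0.
  rewrite <- (sqrt_sqrt x) at 1 by lra. rewrite Rmult_assoc.
  apply Rmult_le_compat; try lra.
  + apply sqrt_le_1_alt; lra.
  + apply sqrt_le_pw; lra.
- apply Rmult_le_pos; [apply Rmult_le_pos; [apply sqrt_pos|]|]; apply pw_nonneg.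
Qed.

Lemma C1_holder_increment a T delta K F F' t t' : 0 < delta <= 1 / 2 -> 0 < a -> 0 <= K ->
  C1_holder a T delta K F F' -> a <= t <= T -> a <= t' <= T ->
  Cmod (F t' - F t) <= K * (1 + pw delta T) * Rabs (t' - t).
Proof.
intros Hd Ha HK [H1 H2] Ht Ht'.
replace (F t' - F t)%C with (RtoC (t' - t) * F' t + (F t' - F t - RtoC (t' - t) * F' t))%C by ring.
replace (K * _ * _) with (Rabs (t' - t) * K + K * (Rabs (t' - t) * pw delta T)) by ring.
apply Cmod_plus_le.
- apply Cmod_mult_le; [rewrite Cmod_R; lra|]. now apply H1.
- eapply Rle_trans; [now apply H2|]. apply Rmult_le_compat_l; [assumption|].
  apply Rmult_le_compat_l; [apply Rabs_pos|]. apply pw_le; [lra|]. apply Rabs_le. lra.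
Qed.

Lemma abs_range a T t t' : 0 < a -> a <= t <= T -> a <= t' <= T -> 0 <= Rabs (t' - t) <= T.
Proof. intros. split; [apply Rabs_pos|apply Rabs_le; lra]. Qed.

Lemma C1_holder_mult a T delta K : 0 < delta <= 1 / 2 -> 0 < a < T -> 0 < K ->
  exists L, 0 < L /\ forall F F' G G',
  C1_holder a T delta K F F' -> C1_holder a T delta K G G' ->
  C1_holder a T delta L (fun t => F t * G t)%C (fun t => F' t * G t + F t * G' t)%C.
Proof.
intros Hd Ha HK.
set (c := sqrt T * pw (1 / 2 - delta) T).
assert (Hc : 0 < c) by (apply Rmult_lt_0_compat; [apply sqrt_lt_R0|apply pw_pos]; lra).
assert (HpT : 0 < pw delta T) by (apply pw_pos; lra).
assert (HKK : 0 < K * K) by nra.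
exists (2 * (K * K) + K * K * (1 + pw delta T) * c). split.
{ assert (0 < K * K * (1 + pw delta T) * c) by (apply Rmult_lt_0_compat; nra). lra. }
intros F F' G G' HF HG.
assert (Hinc := fun t t' => C1_holder_increment a T delta K F F' t t' Hd ltac:(lra) ltac:(lra) HF).
destruct HF as [F1 F2], HG as [G1 G2].
assert (HX : 0 < K * K * (1 + pw delta T) * c) by (apply Rmult_lt_0_compat; nra).
split.
- intros t Ht. destruct (F1 t Ht), (G1 t Ht). split.
  + eapply Rle_trans; [apply Cmod_mult_le; eassumption|]. lra.
  + eapply Rle_trans; [apply Cmod_plus_le; apply Cmod_mult_le; eassumption|]. lra.
- intros t t' Ht Ht'. destruct (F1 t Ht), (G1 t Ht), (F1 t' Ht').
  set (e := Rabs (t' - t)).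
  assert (He : 0 <= e <= T) by (apply (abs_range a); lra).
  replace (F t' * G t' - F t * G t - RtoC (t' - t) * (F' t * G t + F t * G' t))%C with
   (F t' * (G t' - G t - RtoC (t' - t) * G' t) + (F t' - F t - RtoC (t' - t) * F' t) * G t +
    RtoC (t' - t) * (G' t * (F t' - F t)))%C by ring.
  apply Rle_trans with (K * (K * (e * pw delta e)) + K * (e * pw delta e) * K + e * (K * (K * (1 + pw delta T) * e))).
  + apply Cmod_plus_le; [apply Cmod_plus_le|].
    * apply Cmod_mult_le; [assumption|]. now apply G2.
    * apply Cmod_mult_le; [now apply F2|assumption].
    * apply Cmod_mult_le; [rewrite Cmod_R; unfold e; lra|]. apply Cmod_mult_le; [assumption|]. now apply Hinc.
  + pose proof (le_pw T delta e Hd He) as Hle. fold c in Hle.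
    assert (e * (K * (K * (1 + pw delta T) * e)) <= K * K * (1 + pw delta T) * (e * (c * pw delta e))).
    { replace (e * (K * (K * (1 + pw delta T) * e))) with (K * K * (1 + pw delta T) * (e * e)) by ring.
      apply Rmult_le_compat_l; [nra|]. apply Rmult_le_compat_l; lra. }
    lra.
Qed.

Lemma C1_holder_inv a T delta K m : 0 < delta <= 1 / 2 -> 0 < a < T -> 0 < K -> 0 < m ->
  exists L, 0 < L /\ forall F F',
  C1_holder a T delta K F F' -> (forall t, a <= t <= T -> m <= Cmod (F t)) ->
  C1_holder a T delta L (fun t => / F t)%C (fun t => - (F' t / (F t * F t)))%C.
Proof.
intros Hd Ha HK Hm.
set (c := sqrt T * pw (1 / 2 - delta) T).
assert (Hc : 0 < c) by (apply Rmult_lt_0_compat; [apply sqrt_lt_R0|apply pw_pos]; lra).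
assert (HpT : 0 < pw delta T) by (apply pw_pos; lra).
assert (HKK : 0 < K * K) by nra.
assert (Hm2 : 0 < m * m) by nra. assert (Hm3 : 0 < m * m * m) by nra.
set (k := K * K * (1 + pw delta T) * c).
assert (Hk : 0 < k) by (apply Rmult_lt_0_compat; nra).
assert (I1 : 0 < 1 / m) by (apply Rdiv_lt_0_compat; lra).
assert (I2 : 0 < K / (m * m)) by (apply Rdiv_lt_0_compat; lra).
assert (I3 : 0 < k / (m * m * m)) by (apply Rdiv_lt_0_compat; lra).
exists (1 / m + K / (m * m) + k / (m * m * m)). split; [lra|].
intros F F' HF HFm.
assert (Hinc := fun t t' => C1_holder_increment a T delta K F F' t t' Hd ltac:(lra) ltac:(lra) HF).
destruct HF as [F1 F2]. split.
- intros t Ht. destruct (F1 t Ht). specialize (HFm t Ht).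
  assert (F t <> RtoC 0) by (apply Cmod_gt_0; lra). split.
  + replace (/ F t)%C with (RtoC 1 / F t)%C by (field; assumption).
    apply Rle_trans with (1 / m); [|lra]. apply Cmod_div_le; try assumption. rewrite Cmod_1; lra.
  + rewrite Cmod_opp. apply Rle_trans with (K / (m * m)); [|lra].
    apply Cmod_div_le; try assumption. apply Cmod_mult_ge; lra.
- intros t t' Ht Ht'. destruct (F1 t Ht). assert (m1 := HFm t Ht). assert (m2 := HFm t' Ht').
  assert (F t <> RtoC 0) by (apply Cmod_gt_0; lra).
  assert (F t' <> RtoC 0) by (apply Cmod_gt_0; lra).
  set (e := Rabs (t' - t)).
  assert (He : 0 <= e <= T) by (apply (abs_range a); lra).
  replace (/ F t' - / F t - RtoC (t' - t) * - (F' t / (F t * F t)))%C with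
   (- ((F t' - F t - RtoC (t' - t) * F' t) / (F t * F t')) +
    (RtoC (t' - t) * (F' t * (F t' - F t))) / (F t * F t * F t'))%C by (field; auto).
  apply Rle_trans with (K * (e * pw delta e) / (m * m) + e * (K * (K * (1 + pw delta T) * e)) / (m * m * m)).
  + apply Cmod_plus_le; [rewrite Cmod_opp|]; apply Cmod_div_le; try assumption.
    * now apply F2.
    * apply Cmod_mult_ge; lra.
    * apply Cmod_mult_le; [rewrite Cmod_R; unfold e; lra|]. apply Cmod_mult_le; [assumption|]. now apply Hinc.
    * apply Cmod_mult_ge; try lra. apply Cmod_mult_ge; lra.
  + pose proof (le_pw T delta e Hd He) as Hle. fold c in Hle.
    assert (Hpe : 0 <= e * pw delta e) by (apply Rmult_le_pos; [lra|apply pw_nonneg]).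
    assert (Hx : e * (K * (K * (1 + pw delta T) * e)) / (m * m * m) <= k / (m * m * m) * (e * pw delta e)).
    { replace (k / (m * m * m) * (e * pw delta e)) with (K * K * (1 + pw delta T) * (e * (c * pw delta e)) / (m * m * m))
       by (unfold k; field; lra).
      apply Rmult_le_compat_r; [left; now apply Rinv_0_lt_compat|].
      replace (e * (K * (K * (1 + pw delta T) * e))) with (K * K * (1 + pw delta T) * (e * e)) by ring.
      apply Rmult_le_compat_l; [nra|]. apply Rmult_le_compat_l; lra. }
    replace (K * (e * pw delta e) / (m * m)) with (K / (m * m) * (e * pw delta e)) by (field; lra).
    nra.
Qed.

Lemma C1_holder_exp a T delta K : 0 < delta <= 1 / 2 -> 0 < a < T -> 0 < K ->
  exists L, 0 < L /\ forall F F',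
  C1_holder a T delta K F F' ->
  C1_holder a T delta L (fun t => cexp (F t)) (fun t => F' t * cexp (F t))%C.
Proof.
intros Hd Ha HK.
set (c := sqrt T * pw (1 / 2 - delta) T).
assert (Hc : 0 < c) by (apply Rmult_lt_0_compat; [apply sqrt_lt_R0|apply pw_pos]; lra).
assert (HpT : 0 < pw delta T) by (apply pw_pos; lra).
pose proof (exp_pos K) as HeK.
set (d := K * (1 + pw delta T)). assert (Hdd : 0 < d) by (unfold d; nra).
exists (exp K * (1 + K + d * d * c)). split.
{ assert (0 < d * d) by nra. assert (0 < d * d * c) by nra. nra. }
intros F F' HF.
assert (Hinc := fun t t' => C1_holder_increment a T delta K F F' t t' Hd ltac:(lra) ltac:(lra) HF).
fold d in Hinc.
assert (Hx : 0 < d * d * c) by (assert (0 < d * d) by nra; nra).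
destruct HF as [F1 F2]. split.
- intros t Ht. destruct (F1 t Ht). split.
  + eapply Rle_trans; [now apply (Cmod_cexp_le _ K)|].
    assert (0 < exp K * K) by nra. assert (0 < exp K * (d * d * c)) by now apply Rmult_lt_0_compat. lra.
  + eapply Rle_trans; [apply Cmod_mult_le; [eassumption|now apply (Cmod_cexp_le _ K)]|].
    assert (0 < exp K * K) by nra. assert (0 < exp K * (d * d * c)) by now apply Rmult_lt_0_compat. lra.
- intros t t' Ht Ht'. destruct (F1 t Ht), (F1 t' Ht'). specialize (Hinc t t' Ht Ht').
  set (e := Rabs (t' - t)) in *.
  assert (He : 0 <= e <= T) by (apply (abs_range a); lra).
  replace (cexp (F t') - cexp (F t) - RtoC (t' - t) * (F' t * cexp (F t)))%C with
   ((cexp (F t') - cexp (F t) - (F t' - F t) * cexp (F t)) +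
    (F t' - F t - RtoC (t' - t) * F' t) * cexp (F t))%C by ring.
  apply Rle_trans with (exp K * (d * e) * (d * e) + K * (e * pw delta e) * exp K).
  + apply Cmod_plus_le.
    * eapply Rle_trans; [now apply (cexp_taylor _ _ K)|].
      pose proof (Cmod_ge_0 (F t' - F t)).
      apply Rmult_le_compat; try assumption; [nra|]. apply Rmult_le_compat_l; lra.
    * apply Cmod_mult_le; [now apply F2|now apply (Cmod_cexp_le _ K)].
  + pose proof (le_pw T delta e Hd He) as Hle. fold c in Hle.
    assert (Hpe : 0 <= e * pw delta e) by (apply Rmult_le_pos; [lra|apply pw_nonneg]).
    assert (e * e <= e * (c * pw delta e)) by (apply Rmult_le_compat_l; lra).
    assert (exp K * (d * d) * (e * e) <= exp K * (d * d) * (e * (c * pw delta e))).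
    { apply Rmult_le_compat_l; [|assumption]. apply Rmult_le_pos; [lra|]. apply Rmult_le_pos; lra. }
    assert (0 <= exp K * (e * pw delta e)) by (apply Rmult_le_pos; lra).
    lra.
Qed.

Lemma C1_holder_ext a T delta K F F' G G' :
  (forall t, F t = G t) -> (forall t, F' t = G' t) ->
  C1_holder a T delta K F F' -> C1_holder a T delta K G G'.
Proof.
intros H1 H2 [A1 A2]. split; intros; rewrite <- ?H1, <- ?H2; auto.
Qed.

(** The formula for [tip_velocity] is built from [drift_exponent] and [W] by the exponential, the
    inverse and the product, which preserve the class [C1_holder]. *)
Lemma tip_is_C2 {T M delta b B D a} : params T M delta b B D -> 0 < a < T ->
  exists N, 0 < N /\ forall lam l W, tip_flow T M delta b B D lam l W ->
  exists V A : R -> C,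
    C1_holder a T delta N (fun t => W t 0) V /\ C1_holder a T delta N V A /\
    forall t, a <= t <= T -> / N <= Cmod (V t).
Proof.
intros Hp Ha. assert (Hp' := Hp). destruct Hp' as (HT & HM & Hd & Hb & HB & HD).
set (KE := 2 * M / b * sqrt T). pose proof (exp_pos KE) as HeKE.
set (KJ := 2 * M * exp (2 * M / b * sqrt T) / (b * b * b) / delta).
destruct (tip_first_order a Hp ltac:(lra)) as [KV [HKV HV]].
destruct (drift_exponent_first_order a Hp ltac:(lra)) as [KA [HKA HA]].
assert (Hsa : 0 < sqrt a) by (apply sqrt_lt_R0; lra).
assert (HsT : 0 < sqrt T) by now apply sqrt_lt_R0.
set (m := b * sqrt a). assert (Hm : 0 < m) by (unfold m; nra).
assert (HpT : 0 < pw delta T) by (apply pw_pos; lra).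
set (p := pw (1 / 2 - delta) T). assert (Hpp : 0 < p) by (apply pw_pos; lra).
set (kv := 2 * exp KE / m). assert (Hkv : 0 < kv) by (apply Rdiv_lt_0_compat; lra).
assert (HKJ : 0 < KJ).
{ unfold KJ. apply Rdiv_lt_0_compat; [|lra]. apply Rdiv_lt_0_compat.
  - fold KE. nra.
  - assert (0 < b * b) by nra. nra. }
assert (HKE : 0 < KE).
{ unfold KE. assert (0 < 2 * M / b) by (apply Rdiv_lt_0_compat; lra). nra. }
set (K1 := B * sqrt T + kv + KV * p + 2).
set (K2 := KE + (KJ * pw delta T + M * (M + kv) / 2) + KA).
assert (HMk : 0 < M * (M + kv) / 2) by nra.
assert (HK1 : 2 < K1) by (unfold K1; assert (0 < B * sqrt T) by nra; assert (0 < KV * p) by nra; lra).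
assert (HK2 : 0 < K2) by (unfold K2; assert (0 < KJ * pw delta T) by nra; lra).
destruct (C1_holder_inv a T delta K1 m) as [L1 [HL1 C1]]; try assumption; try lra.
destruct (C1_holder_exp a T delta K2) as [L2 [HL2 C2]]; try assumption; try lra.
set (L3 := L1 + L2 + 2).
destruct (C1_holder_mult a T delta L3) as [L4 [HL4 C4]]; try assumption; try (unfold L3; lra).
set (L5 := L4 + 2).
destruct (C1_holder_mult a T delta L5) as [L6 [HL6 C6]]; try assumption; try (unfold L5; lra).
set (lowV := 2 * exp (- KE) / (B * sqrt T)).
assert (HlowV : 0 < lowV).
{ unfold lowV. apply Rdiv_lt_0_compat; [pose proof (exp_pos (- KE)); lra|nra]. }
exists (K1 + L6 + / lowV). assert (HilowV : 0 < / lowV) by now apply Rinv_0_lt_compat.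
split; [lra|].
intros lam l W H.
assert (Hlow : forall t, a <= t <= T -> m <= Cmod (W t 0)).
{ intros t Ht. apply le_Im_le_mod. eapply Rle_trans; [|apply (tf_low H); lra].
  unfold m. apply Rmult_le_compat_l; [lra|]. apply sqrt_le_1_alt; lra. }
assert (HEb : forall t, a <= t <= T -> Cmod (drift_exponent l W t 0) <= KE).
{ intros t Ht. eapply drift_exponent_uniform_bound; try eassumption; lra. }
assert (HWb : forall t, a <= t <= T -> Cmod (W t 0) <= B * sqrt T).
{ intros t Ht. eapply Rle_trans; [apply (tf_up H); lra|].
  apply Rmult_le_compat_l; [lra|]. apply sqrt_le_1_alt; lra. }
assert (HVb : forall t, a <= t <= T -> Cmod (tip_velocity l W t) <= kv).
{ intros t Ht. unfold tip_velocity, kv. apply Cmod_div_le; try assumption; [|now apply Hlow].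
  apply Cmod_mult_le; [|apply Cmod_cexp_le; auto].
  rewrite Cmod_opp, Cmod_R, Rabs_pos_eq; lra. }
assert (HW1 : C1_holder a T delta K1 (fun t => W t 0) (tip_velocity l W)).
{ apply C1_holder_of_ordered.
  - intros t Ht. specialize (HWb t Ht). specialize (HVb t Ht).
    assert (0 < B * sqrt T) by nra. assert (0 < KV * p) by nra. unfold K1. lra.
  - intros t t' tau Hat Htt Ht' Htau.
    eapply Rle_trans; [now apply (HV lam l W H)|].
    apply Rle_trans with (KV * p * ((t' - t) * pw delta (t' - t))).
    + replace (KV * p * ((t' - t) * pw delta (t' - t))) with (KV * ((t' - t) * (p * pw delta (t' - t)))) by ring.
      apply Rmult_le_compat_l; [lra|]. apply Rmult_le_compat_l; [lra|]. apply sqrt_le_pw; lra.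
    + apply Rmult_le_compat_r; [apply Rmult_le_pos; [lra|apply pw_nonneg]|].
      assert (0 < B * sqrt T) by nra. unfold K1. lra. }
assert (HE1 : C1_holder a T delta K2 (fun t => drift_exponent l W t 0) (drift_exponent_velocity l W)).
{ apply C1_holder_of_ordered.
  - intros t Ht. specialize (HEb t Ht). specialize (HVb t Ht).
    assert (0 < KJ * pw delta T) by nra.
    split; [unfold K2; lra|].
    apply Rle_trans with (KJ * pw delta T + M * (M + kv) / 2); [|unfold K2; lra].
    unfold drift_exponent_velocity. apply Cmod_plus_le.
    + eapply Rle_trans; [eapply singular_part_bound; try eassumption; lra|]. rewrite Rminus_0_r.
      apply Rmult_le_compat_l; [left; exact HKJ|]. apply pw_le; lra.
    + apply Cmod_div_le; [|lra|rewrite Cmod_R, Rabs_pos_eq; lra].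
      assert (Hl : Cmod (RtoC (l t)) <= M) by (rewrite Cmod_R; apply (tf_l_bound H)).
      apply Cmod_mult_le; [assumption|]. now apply Cmod_minus_le.
  - intros t t' tau Hat Htt Ht' Htau.
    eapply Rle_trans; [now apply (HA lam l W H)|].
    apply Rmult_le_compat_r; [apply Rmult_le_pos; [lra|apply pw_nonneg]|].
    assert (0 < KJ * pw delta T) by nra. unfold K2. lra. }
specialize (C1 _ _ HW1 Hlow). specialize (C2 _ _ HE1).
apply (C1_holder_weaken _ _ _ _ L3) in C1; [|unfold L3; lra].
apply (C1_holder_weaken _ _ _ _ L3) in C2; [|unfold L3; lra].
specialize (C4 _ _ _ _ C2 C1).
apply (C1_holder_weaken _ _ _ _ L5) in C4; [|unfold L5; lra].
assert (CC : C1_holder a T delta L5 (fun _ => (- (2))%C) (fun _ => RtoC 0)).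
{ split.
  - intros t Ht. rewrite Cmod_opp, Cmod_R, Rabs_pos_eq, Cmod_0 by lra. unfold L5. lra.
  - intros t t' Ht Ht'. replace (- (2) - - (2) - RtoC (t' - t) * RtoC 0)%C with (RtoC 0) by ring.
    rewrite Cmod_0. apply Rmult_le_pos; [unfold L5; lra|]. apply Rmult_le_pos; [apply Rabs_pos|apply pw_nonneg]. }
specialize (C6 _ _ _ _ CC C4).
exists (tip_velocity l W). eexists. split; [|split].
- eapply C1_holder_weaken; [|exact HW1]. lra.
- apply (C1_holder_weaken _ _ _ L6); [lra|].
  eapply C1_holder_ext; [| |exact C6].
  + intros t. unfold tip_velocity, Cdiv. cbv beta. ring.
  + intros t. cbv beta. reflexivity.
- intros t Ht. apply Rle_trans with lowV.
  { apply Rle_trans with (/ / lowV); [apply Rinv_le_contravar; lra|rewrite Rinv_inv; lra]. }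
  assert (Hn : W t 0 <> RtoC 0) by (apply Cmod_gt_0; specialize (Hlow t Ht); lra).
  unfold tip_velocity. rewrite Cmod_div, Cmod_mult, Cmod_opp, Cmod_R, Rabs_pos_eq by (assumption || lra).
  unfold lowV, Rdiv. apply Rmult_le_compat.
  + pose proof (exp_pos (- KE)). lra.
  + left. apply Rinv_0_lt_compat. nra.
  + apply Rmult_le_compat_l; [lra|]. rewrite Cmod_cexp.
    assert (- KE <= Re (drift_exponent l W t 0)).
    { assert (Rabs (Re (drift_exponent l W t 0)) <= KE) by (eapply Rle_trans; [apply re_le_Cmod|auto]).
      apply Rabs_le_between in H0. lra. }
    destruct H0 as [H0 | ->]; [left; now apply exp_increasing|lra].
  + apply Rinv_le_contravar; [apply Cmod_gt_0; assumption|auto].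
Qed.

(** * Derivatives relative to an interval *)

(** The relative derivative in terms of increments, which no longer mentions filters. *)
Lemma is_derive_on_eps {V : NormedModule R_AbsRing} a b (phi : R -> V) t (l : V) :
  Icc a b t ->
  is_derive_on a b phi t l <->
  (forall eps, 0 < eps -> exists d, 0 < d /\ forall y, Icc a b y -> Rabs (y - t) < d ->
     norm (minus (minus (phi y) (phi t)) (scal (y - t) l)) <= eps * Rabs (y - t)).
Proof.
intros Ht. split.
- intros [_ H] eps He.
  assert (Hlim : is_filter_lim (within (Icc a b) (locally t)) t).
  { intros P HP. unfold within. eapply filter_imp; [|exact HP]. auto. }
  destruct (H t Hlim (mkposreal eps He)) as [[d Hd] Hball].
  exists d. split; [exact Hd|]. intros y Hy Hyt. exact (Hball y Hyt Hy).
- intros H. split; [exact (is_linear_scal_l (K := R_AbsRing) l)|].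
  intros x Hx.
  assert (x = t) as ->.
  { destruct (Req_dec x t) as [E|E]; [exact E|exfalso].
    assert (Hp : 0 < Rabs (t - x)) by (apply Rabs_pos_lt; lra).
    assert (HP : locally x (fun y : R => Rabs (y - x) < Rabs (t - x))).
    { exists (mkposreal _ Hp). intros y Hy. exact Hy. }
    destruct (Hx _ HP) as [d Hd]. specialize (Hd t (ball_center t d) Ht). lra. }
  intros [eps He]. destruct (H eps He) as [d [Hd Hy]].
  exists (mkposreal d Hd). intros y Hyt HyI. apply Hy; assumption.
Qed.

Lemma minus_minus_cancel {G : AbelianGroup} (D u v : G) :
  minus u v = minus (minus D v) (minus D u).
Proof.
change (minus u v = plus (minus D v) (opp (minus D u))).
rewrite opp_minus, plus_comm. apply minus_trans.
Qed.

Lemma is_derive_on_unique {V : NormedModule R_AbsRing} a b (phi : R -> V) t (l1 l2 : V) :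
  a < b -> Icc a b t -> is_derive_on a b phi t l1 -> is_derive_on a b phi t l2 -> l1 = l2.
Proof.
intros Hab Ht H1 H2. rewrite is_derive_on_eps in H1, H2 by assumption.
assert (E : norm (minus l1 l2) = 0).
{ apply Rle_antisym; [|apply norm_ge_0]. apply le_epsilon. intros eps He. rewrite Rplus_0_l.
  destruct (H1 (eps / 2) ltac:(lra)) as [d1 [Hd1 K1]].
  destruct (H2 (eps / 2) ltac:(lra)) as [d2 [Hd2 K2]].
  assert (Hy : exists y, Icc a b y /\ y <> t /\ Rabs (y - t) < d1 /\ Rabs (y - t) < d2).
  { set (d := Rmin (Rmin d1 d2) (b - a) / 2).
    assert (Hd : 0 < d) by (unfold d; repeat apply Rmin_case; lra).
    assert (D1 : d < d1 /\ d < d2 /\ d <= (b - a) / 2).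
    { unfold d. pose proof (Rmin_l (Rmin d1 d2) (b - a)). pose proof (Rmin_r (Rmin d1 d2) (b - a)).
      pose proof (Rmin_l d1 d2). pose proof (Rmin_r d1 d2). unfold d in Hd. lra. }
    unfold Icc in *. destruct (Rle_dec (t + d) b).
    - exists (t + d). replace (t + d - t) with d by ring. rewrite Rabs_pos_eq by lra. lra.
    - exists (t - d). replace (t - d - t) with (- d) by ring. rewrite Rabs_Ropp, Rabs_pos_eq by lra. lra. }
  destruct Hy as [y [Hy [Hyt [Hy1 Hy2]]]].
  specialize (K1 y Hy Hy1). specialize (K2 y Hy Hy2).
  assert (Hp : 0 < Rabs (y - t)) by (apply Rabs_pos_lt; lra).
  set (D := minus (phi y) (phi t)) in *.
  assert (E : scal (y - t) (minus l1 l2) =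
     minus (minus D (scal (y - t) l2)) (minus D (scal (y - t) l1))).
  { transitivity (minus (scal (y - t) l1) (scal (y - t) l2)); [exact (scal_minus_distr_l (y - t) l1 l2)|].
    exact (minus_minus_cancel D (scal (y - t) l1) (scal (y - t) l2)). }
  assert (N : norm (scal (y - t) (minus l1 l2)) <= eps * Rabs (y - t)).
  { rewrite E. unfold minus at 1. eapply Rle_trans; [apply norm_triangle|]. rewrite norm_opp. lra. }
  assert (F : minus l1 l2 = scal (/ (y - t)) (scal (y - t) (minus l1 l2))).
  { rewrite scal_assoc. replace (mult (/ (y - t)) (y - t)) with (one : R_AbsRing).
    - now rewrite scal_one.
    - change (1 = / (y - t) * (y - t)). field. lra. }
  rewrite F. eapply Rle_trans; [exact (norm_scal (K := R_AbsRing) (V := V) (/ (y - t)) (scal (y - t) (minus l1 l2)))|].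
  change (Rabs (/ (y - t)) * norm (scal (y - t) (minus l1 l2)) <= eps).
  rewrite Rabs_inv.
  apply (Rmult_le_reg_l (Rabs (y - t))); [assumption|].
  rewrite <- Rmult_assoc, Rinv_r by lra. lra. }
apply norm_eq_zero in E.
replace l1 with (plus (minus l1 l2) l2).
- rewrite E. apply plus_zero_l.
- unfold minus. rewrite <- plus_assoc, plus_opp_l. apply plus_zero_r.
Qed.

Lemma Derive_on_eq {V : CompleteNormedModule R_AbsRing} a b (phi : R -> V) t (l : V) :
  a < b -> Icc a b t -> is_derive_on a b phi t l -> Derive_on a b phi t = l.
Proof.
intros Hab Ht H. apply iota_unique; [|assumption].
intros y Hy. eapply is_derive_on_unique; eassumption.
Qed.

Lemma norm_C (z : C) : norm (V := CR) z = Cmod z.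
Proof. symmetry. apply Cmod_norm. Qed.

Lemma is_derive_on_C_eps a b (phi : R -> C) t (l : C) :
  Icc a b t ->
  is_derive_on (V := CR) a b phi t l <->
  (forall eps, 0 < eps -> exists d, 0 < d /\ forall y, Icc a b y -> Rabs (y - t) < d ->
     Cmod (phi y - phi t - RtoC (y - t) * l) <= eps * Rabs (y - t)).
Proof.
intros Ht. rewrite is_derive_on_eps by assumption.
assert (E : forall y, norm (V := CR) (minus (minus (phi y) (phi t)) (scal (y - t) l)) =
   Cmod (phi y - phi t - RtoC (y - t) * l)%C).
{ intros y. rewrite norm_C. f_equal. destruct l as [l1 l2], (phi y), (phi t).
  unfold minus, plus, opp, scal, RtoC, Cminus, Cplus, Copp, Cmult; simpl.
  unfold prod_plus, prod_opp, prod_scal; simpl. unfold plus, opp, scal; simpl. unfold mult; simpl. 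
  apply injective_projections; simpl; ring. }
split; intros H eps He; destruct (H eps He) as [d [Hd Hy]]; exists d; (split; [assumption|]);
  intros y Hy1 Hy2; [rewrite <- E|refine (Rle_trans _ _ _ (Req_le _ _ (E y)) _)]; now apply Hy.
Qed.

Lemma ccont_eps F x : ccont F x ->
  forall eps, 0 < eps -> exists d, 0 < d /\ forall y, Rabs (y - x) < d -> Cmod (F y - F x) < eps.
Proof.
intros [H1 H2] eps He.
destruct (eps_continuous _ _ H1 (eps / 2) ltac:(lra)) as [d1 [Hd1 K1]].
destruct (eps_continuous _ _ H2 (eps / 2) ltac:(lra)) as [d2 [Hd2 K2]].
exists (Rmin d1 d2). split; [now apply Rmin_glb_lt|].
intros y Hy. pose proof (Rmin_l d1 d2). pose proof (Rmin_r d1 d2).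
specialize (K1 y ltac:(lra)). specialize (K2 y ltac:(lra)).
set (u := Re (F y) - Re (F x)) in *. set (v := Im (F y) - Im (F x)) in *.
replace (F y - F x)%C with (RtoC u + Ci * RtoC v)%C.
- eapply Rle_lt_trans; [apply Cmod_triangle|]. rewrite Cmod_mult, Cmod_Ci, !Cmod_R. lra.
- unfold u, v. apply injective_projections; unfold Re, Im; simpl; ring.
Qed.

Lemma eps_ccont F x :
  (forall eps, 0 < eps -> exists d, 0 < d /\ forall y, Rabs (y - x) < d -> Cmod (F y - F x) < eps) ->
  ccont F x.
Proof.
intros H. split; apply continuous_eps; intros eps He; destruct (H eps He) as [d [Hd K]];
  exists d; (split; [assumption|]); intros y Hy; (eapply Rle_lt_trans; [|now apply (K y)]).
- apply (re_le_Cmod (F y - F x)).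
- apply (abs_Im_le_mod (F y - F x)).
Qed.

Lemma is_derive_eps (f : R -> R) x l :
  (forall eps, 0 < eps -> exists d, 0 < d /\ forall y, Rabs (y - x) < d ->
     Rabs (f y - f x - (y - x) * l) <= eps * Rabs (y - x)) ->
  is_derive f x l.
Proof.
intros H. split; [exact (is_linear_scal_l (K := R_AbsRing) l)|].
intros z Hz. apply (is_filter_lim_locally_unique (V := R_NormedModule)) in Hz. subst z.
intros [eps He]. destruct (H eps He) as [d [Hd K]].
exists (mkposreal d Hd). intros y Hy. apply K, Hy.
Qed.

Lemma cder_eps F x l :
  (forall eps, 0 < eps -> exists d, 0 < d /\ forall y, Rabs (y - x) < d ->
     Cmod (F y - F x - RtoC (y - x) * l) <= eps * Rabs (y - x)) ->
  cder F x l.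
Proof.
intros H. split; apply is_derive_eps; intros eps He; destruct (H eps He) as [d [Hd K]];
  exists d; (split; [assumption|]); intros y Hy; (eapply Rle_trans; [|now apply (K y)]).
- eapply Rle_trans; [|apply re_le_Cmod]. right. f_equal. unfold Re; simpl; ring.
- eapply Rle_trans; [|apply abs_Im_le_mod]. right. f_equal. unfold Im; simpl; ring.
Qed.

Lemma is_derive_on_interior a b (phi : R -> C) t (l : C) : a < t < b ->
  is_derive_on (V := CR) a b phi t l -> cder phi t l.
Proof.
intros Ht H. rewrite is_derive_on_C_eps in H by (unfold Icc; lra).
apply cder_eps. intros eps He. destruct (H eps He) as [d [Hd K]].
exists (Rmin d (Rmin (t - a) (b - t))). split; [repeat apply Rmin_glb_lt; lra|].
intros y Hy. pose proof (Rmin_l d (Rmin (t - a) (b - t))). pose proof (Rmin_r d (Rmin (t - a) (b - t))).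
pose proof (Rmin_l (t - a) (b - t)). pose proof (Rmin_r (t - a) (b - t)).
assert (Hy' := Hy). apply Rabs_def2 in Hy'. apply K; [unfold Icc|]; lra.
Qed.

Definition clamp (a b q : R) : R := Rmax a (Rmin q b).

Lemma clamp_in a b q : a <= b -> a <= clamp a b q <= b.
Proof. intros H. unfold clamp. split; [apply Rmax_l|]. apply Rmax_lub; [assumption|apply Rmin_r]. Qed.

Lemma clamp_id a b q : a <= q <= b -> clamp a b q = q.
Proof. intros H. unfold clamp. rewrite Rmin_left, Rmax_right; lra. Qed.

Lemma clamp_lip a b q p : Rabs (clamp a b q - clamp a b p) <= Rabs (q - p).
Proof.
unfold clamp, Rmax, Rmin. repeat destruct (Rle_dec _ _); unfold Rabs; repeat destruct (Rcase_abs _); lra.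
Qed.

(** Composition with [clamp] turns one-sided continuity at the end points into continuity. *)
Lemma clamp_ccont a b (g : R -> C) (g' : R -> C) : a <= b ->
  (forall s, Icc a b s -> is_derive_on (V := CR) a b g s (g' s)) ->
  forall q, ccont (fun u => g (clamp a b u)) q.
Proof.
intros Hab H q. apply eps_ccont. intros eps He.
assert (Hc := clamp_in a b q Hab). set (x := clamp a b q) in *.
assert (Hx := H x Hc). rewrite is_derive_on_C_eps in Hx by assumption.
destruct (Hx 1 ltac:(lra)) as [d [Hd K]].
set (L := Cmod (g' x) + 1). assert (HL : 0 < L) by (unfold L; pose proof (Cmod_ge_0 (g' x)); lra).
exists (Rmin d (eps / L)). split; [apply Rmin_glb_lt; [lra|now apply Rdiv_lt_0_compat]|].
intros y Hy. pose proof (Rmin_l d (eps / L)). pose proof (Rmin_r d (eps / L)).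
assert (Hyx : Rabs (clamp a b y - x) <= Rabs (y - q)) by apply clamp_lip.
specialize (K (clamp a b y) (clamp_in a b y Hab) ltac:(lra)).
replace (g (clamp a b y) - g x)%C with
  ((g (clamp a b y) - g x - RtoC (clamp a b y - x) * g' x) + RtoC (clamp a b y - x) * g' x)%C by ring.
eapply Rle_lt_trans; [apply Cmod_triangle|].
rewrite (Cmod_mult (RtoC _)), Cmod_R.
apply Rle_lt_trans with (L * Rabs (y - q)).
- unfold L. pose proof (Cmod_ge_0 (g' x)). nra.
- apply (Rmult_lt_reg_l (/ L)); [now apply Rinv_0_lt_compat|].
  rewrite <- Rmult_assoc, Rinv_l by lra. unfold Rdiv in *. lra.
Qed.

(** * Uniqueness, gluing and continuation of Loewner solutions *)

Lemma cprimitive_exists (f : R -> C) b : (forall x, x < b -> ccont f x) ->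
  exists F, forall x, x < b -> cder F x (f x).
Proof.
intros Hf.
destruct (primitive_exists (fun x => Re (f x)) b) as [F1 H1]; [intros; now apply Hf|].
destruct (primitive_exists (fun x => Im (f x)) b) as [F2 H2]; [intros; now apply Hf|].
exists (fun x => (F1 x, F2 x)). intros x Hx. split; [now apply H1|now apply H2].
Qed.

Lemma is_derive_on_restrict a b b' (phi : R -> C) t (l : C) : b' <= b -> Icc a b' t ->
  is_derive_on (V := CR) a b phi t l -> is_derive_on (V := CR) a b' phi t l.
Proof.
unfold Icc. intros Hb Ht H. rewrite is_derive_on_C_eps in * by (unfold Icc in *; lra).
intros eps He. destruct (H eps He) as [d [Hd K]]. exists d. split; [assumption|].
intros y Hy. apply K. unfold Icc in *; lra.
Qed.

Lemma is_derive_on_extend a b b' (phi psi : R -> C) t (l : C) : a <= t < b -> b <= b' ->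
  (forall y, a <= y <= b -> phi y = psi y) ->
  is_derive_on (V := CR) a b phi t l -> is_derive_on (V := CR) a b' psi t l.
Proof.
intros Ht Hb Heq H. rewrite is_derive_on_C_eps in * by (unfold Icc in *; lra).
intros eps He. destruct (H eps He) as [d [Hd K]].
exists (Rmin d (b - t)). split; [apply Rmin_glb_lt; lra|].
intros y Hy Hyt. pose proof (Rmin_l d (b - t)). pose proof (Rmin_r d (b - t)).
assert (Hy' := Hyt). apply Rabs_def2 in Hy'. unfold Icc in *.
rewrite <- !Heq by lra. apply K; unfold Icc; lra.
Qed.

Lemma is_derive_on_ext a b (phi psi : R -> C) t (l : C) : Icc a b t ->
  (forall y, a <= y <= b -> phi y = psi y) ->
  is_derive_on (V := CR) a b phi t l -> is_derive_on (V := CR) a b psi t l.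
Proof.
intros Ht Heq H. rewrite is_derive_on_C_eps in * by assumption.
intros eps He. destruct (H eps He) as [d [Hd K]].
exists d. split; [assumption|]. intros y Hy Hyt. rewrite <- !Heq by assumption. now apply K.
Qed.

Lemma solution_restrict lambda s s' z g : 0 <= s' <= s ->
  loewner_solution lambda s z g -> loewner_solution lambda s' z g.
Proof.
intros Hs [H0 H]. split; [assumption|]. intros q Hq. unfold Icc in *.
destruct (H q ltac:(unfold Icc; lra)) as [H1 H2]. split; [assumption|].
now apply (is_derive_on_restrict 0 s s'); [lra| |].
Qed.

Lemma interior_clamp a b q : a < q < b -> locally q (fun y => clamp a b y = y).
Proof.
intros Hq. assert (Hd : 0 < Rmin (q - a) (b - q)) by (apply Rmin_glb_lt; lra).
exists (mkposreal _ Hd). intros y Hy.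
change (Rabs (y - q) < Rmin (q - a) (b - q)) in Hy.
pose proof (Rmin_l (q - a) (b - q)). pose proof (Rmin_r (q - a) (b - q)).
apply Rabs_def2 in Hy. apply clamp_id. lra.
Qed.

Lemma clamp_cder a b (g : R -> C) q l : a < q < b -> cder g q l ->
  cder (fun u => g (clamp a b u)) q l.
Proof.
intros Hq H. apply (cder_ext_loc g); [|assumption].
eapply filter_imp; [|apply (interior_clamp a b q Hq)]. cbv beta. intros y ->. reflexivity.
Qed.

(** The difference of two solutions solves a linear equation, by which it vanishes identically. *)
Lemma solution_unique lambda s z g1 g2 : 0 <= s ->
  (forall q, continuous (fun u => lambda (clamp 0 s u)) q) ->
  loewner_solution lambda s z g1 -> loewner_solution lambda s z g2 ->
  forall q, 0 <= q <= s -> g1 q = g2 q.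
Proof.
intros Hs Hlam [A0 A] [B0 B] q Hq.
set (G1 := fun u => g1 (clamp 0 s u)). set (G2 := fun u => g2 (clamp 0 s u)).
set (lc := fun u => lambda (clamp 0 s u)).
assert (C1 : forall x, ccont G1 x).
{ eapply clamp_ccont; [assumption|]. intros x Hx. apply A, Hx. }
assert (C2 : forall x, ccont G2 x).
{ eapply clamp_ccont; [assumption|]. intros x Hx. apply B, Hx. }
assert (N1 : forall x, (G1 x - RtoC (lc x))%C <> RtoC 0).
{ intros x E. apply (proj1 (A _ (clamp_in 0 s x Hs))). now apply Ceq_of_minus. }
assert (N2 : forall x, (G2 x - RtoC (lc x))%C <> RtoC 0).
{ intros x E. apply (proj1 (B _ (clamp_in 0 s x Hs))). now apply Ceq_of_minus. }
set (k := fun x => (- (RtoC 2 / ((G1 x - RtoC (lc x)) * (G2 x - RtoC (lc x)))))%C).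
destruct (cprimitive_exists k (s + 1)) as [P HP].
{ intros x _. apply ccont_opp, ccont_div.
  - apply ccont_const.
  - apply ccont_mult; apply ccont_minus; auto; apply ccont_real, Hlam.
  - now apply Cmult_neq_0. }
assert (E := linear_ode_solution (fun x => G1 x - G2 x)%C P k 0 q ltac:(lra)).
cbv beta in E.
assert (HG : G1 0 = G2 0) by (unfold G1, G2; rewrite clamp_id by lra; congruence).
rewrite HG in E.
apply Ceq_of_minus.
replace (g1 q) with (G1 q) by (unfold G1; now rewrite clamp_id by lra).
replace (g2 q) with (G2 q) by (unfold G2; now rewrite clamp_id by lra).
destruct (Ceq_dec (G1 q - G2 q)%C (RtoC 0)) as [?|Hne]; [assumption|exfalso].
apply (Cmult_neq_0 _ (cexp (- P q)) Hne (cexp_neq0 _)). rewrite E; [ring| | | |].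
- intros x _. now apply ccont_minus.
- intros x Hx. eapply cder_ccont. apply HP. lra.
- intros x Hx.
  assert (D1 : cder G1 x (RtoC 2 / (G1 x - RtoC (lc x)))%C).
  { unfold G1 at 2, lc. rewrite clamp_id by lra. apply clamp_cder; [lra|].
    apply (is_derive_on_interior 0 s); [lra|]. apply A. unfold Icc; lra. }
  assert (D2 : cder G2 x (RtoC 2 / (G2 x - RtoC (lc x)))%C).
  { unfold G2 at 2, lc. rewrite clamp_id by lra. apply clamp_cder; [lra|].
    apply (is_derive_on_interior 0 s); [lra|]. apply B. unfold Icc; lra. }
  eapply cder_eq; [apply cder_minus; eassumption|].
  unfold k. field. split; [apply N2|apply N1].
- intros x Hx. apply HP; lra.
Qed.

(** The solutions on the various [[0, s]] agree by uniqueness.  At time [q] one may take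
    the value of the solution on [[0, (q + t) / 2]]. *)
Lemma solution_glue lambda t z : 0 < t ->
  (forall s, 0 <= s < t -> forall q, continuous (fun u => lambda (clamp 0 s u)) q) ->
  (forall s, 0 <= s < t -> exists g, loewner_solution lambda s z g) ->
  exists G, forall s, 0 <= s < t -> loewner_solution lambda s z G.
Proof.
intros Ht Hlam Hex.
set (g := fun s => epsilon (inhabits (fun _ : R => RtoC 0)) (loewner_solution lambda s z)).
assert (Hg : forall s, 0 <= s < t -> loewner_solution lambda s z (g s)).
{ intros s Hs. apply epsilon_spec. now apply Hex. }
exists (fun q => g ((q + t) / 2) q). intros s Hs.
assert (Heq : forall y, 0 <= y <= s -> g s y = g ((y + t) / 2) y).
(* A common interval of the two solutions that contains [y]. *)
{ intros y Hy. set (m := Rmin s ((y + t) / 2)).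
  assert (Hm : y <= m) by (apply Rmin_glb; lra).
  pose proof (Rmin_l s ((y + t) / 2)). pose proof (Rmin_r s ((y + t) / 2)).
  apply (solution_unique lambda m z); try (unfold m in *; lra).
  - apply Hlam. unfold m in *; lra.
  - apply (solution_restrict _ s); [unfold m in *; lra|]. apply Hg; lra.
  - apply (solution_restrict _ ((y + t) / 2)); [unfold m in *; lra|]. apply Hg; lra. }
destruct (Hg s Hs) as [H0 H]. split.
- rewrite <- Heq by lra. exact H0.
- intros q Hq. assert (Hq' := Hq). unfold Icc in Hq'. rewrite <- Heq by lra.
  destruct (H q Hq) as [H1 H2]. split; [assumption|].
  now apply (is_derive_on_ext 0 s (g s)).
Qed.

(** As long as the distance to the driving function is bounded below, the solution is Lipschitz, so
    it has a limit at [t], and the equation holds there as well. *)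
Lemma solution_extend lambda lam t r0 kappa z G : 0 <= r0 < t -> 0 < kappa ->
  (forall q, continuous lam q) ->
  (forall q, 0 <= q <= t -> lam q = lambda q) ->
  (forall s, 0 <= s < t -> loewner_solution lambda s z G) ->
  (forall q, r0 <= q < t -> kappa <= Cmod (G q - RtoC (lam q))) ->
  exists g, loewner_solution lambda t z g.
Proof.
intros Hr Hk Hlc Hlam HG Hfar.
assert (HGd : forall q, 0 < q < t -> cder G q (RtoC 2 / (G q - RtoC (lam q)))%C).
{ intros q Hq. rewrite Hlam by lra.
  apply (is_derive_on_interior 0 ((q + t) / 2)); [lra|].
  apply (HG ((q + t) / 2)); [lra|]. unfold Icc; lra. }
assert (HGb : forall q, r0 < q < t -> Cmod (RtoC 2 / (G q - RtoC (lam q))) <= 2 / kappa).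
{ intros q Hq. apply Cmod_div_le; [rewrite Cmod_R, Rabs_pos_eq; lra|assumption|apply Hfar; lra]. }
assert (Hpsi : forall x, is_derive (fun q => 2 / kappa * (t - q)) x (- (2 / kappa))).
{ intros x. auto_derive; [exact I|]. field. lra. }
assert (H2k : 0 < 2 / kappa) by (apply Rdiv_lt_0_compat; lra).
destruct (limit_at_singular_end (fun q => Re (G q)) (fun q => Re (RtoC 2 / (G q - RtoC (lam q)))%C)
  (fun q => 2 / kappa * (t - q)) (fun _ => - (2 / kappa)) r0 t) as [L1 HL1]; auto; try lra.
{ intros x Hx. apply HGd; lra. }
{ intros x Hx. rewrite Ropp_involutive. eapply Rle_trans; [apply re_le_Cmod|now apply HGb]. }
{ intros x Hx. apply Rmult_le_pos; lra. }
destruct (limit_at_singular_end (fun q => Im (G q)) (fun q => Im (RtoC 2 / (G q - RtoC (lam q)))%C)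
  (fun q => 2 / kappa * (t - q)) (fun _ => - (2 / kappa)) r0 t) as [L2 HL2]; auto; try lra.
{ intros x Hx. apply HGd; lra. }
{ intros x Hx. rewrite Ropp_involutive. eapply Rle_trans; [apply abs_Im_le_mod|now apply HGb]. }
{ intros x Hx. apply Rmult_le_pos; lra. }
set (L := (L1, L2) : C).
set (Gt := fun q => if Rlt_dec q t then G q else L).
assert (HGt : forall q, q < t -> Gt q = G q).
{ intros q Hq. unfold Gt. destruct (Rlt_dec q t); [reflexivity|lra]. }
assert (HGtt : forall q, t <= q -> Gt q = L).
{ intros q Hq. unfold Gt. destruct (Rlt_dec q t); [lra|reflexivity]. }
assert (Hct : ccont Gt t).
{ apply eps_ccont. intros eps He.
  exists (Rmin (t - r0) (eps * kappa / 4)). split.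
  - apply Rmin_glb_lt; [lra|]. apply Rdiv_lt_0_compat; nra.
  - intros y Hy. pose proof (Rmin_l (t - r0) (eps * kappa / 4)). pose proof (Rmin_r (t - r0) (eps * kappa / 4)).
    apply Rabs_def2 in Hy. rewrite (HGtt t) by lra.
    destruct (Rlt_dec y t) as [Hyt|Hyt].
    + rewrite HGt by assumption. specialize (HL1 y ltac:(lra)). specialize (HL2 y ltac:(lra)).
      replace (G y - L)%C with (RtoC (Re (G y) - L1) + Ci * RtoC (Im (G y) - L2))%C
        by (apply injective_projections; unfold Re, Im, L; simpl; ring).
      eapply Rle_lt_trans; [apply Cmod_triangle|]. rewrite Cmod_mult, Cmod_Ci, !Cmod_R.
      assert (2 / kappa * (t - y) < eps / 2).
      { apply Rlt_le_trans with (2 / kappa * (eps * kappa / 4)).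
        - apply Rmult_lt_compat_l; lra.
        - right. field. lra. }
      lra.
    + rewrite HGtt by lra. replace (L - L)%C with (RtoC 0) by ring. rewrite Cmod_0. assumption. }
set (v := fun q => (RtoC 2 / (Gt q - RtoC (lam q)))%C).
assert (Hcf : ccont (fun q => Gt q - RtoC (lam q))%C t) by (apply ccont_minus; [assumption|apply ccont_real, Hlc]).
assert (Hne : (Gt t - RtoC (lam t))%C <> RtoC 0).
{ intros E. destruct (ccont_eps _ _ Hcf kappa Hk) as [d [Hd K]].
  set (y := t - Rmin d (t - r0) / 2).
  assert (0 < Rmin d (t - r0)) by (apply Rmin_glb_lt; lra).
  pose proof (Rmin_l d (t - r0)). pose proof (Rmin_r d (t - r0)).
  specialize (K y ltac:(unfold y; rewrite Rabs_left; lra)). rewrite E in K.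
  replace (Gt y - RtoC (lam y) - RtoC 0)%C with (Gt y - RtoC (lam y))%C in K by ring.
  rewrite HGt in K by (unfold y; lra).
  specialize (Hfar y ltac:(unfold y; lra)). lra. }
assert (Hcv : ccont v t) by (apply ccont_div; [apply ccont_const|assumption|assumption]).
exists Gt. split.
{ rewrite HGt by lra. apply (HG 0). lra. }
intros q Hq. unfold Icc in Hq. destruct (Rlt_dec q t) as [Hqt|Hqt].
- rewrite HGt by assumption.
  destruct (HG ((q + t) / 2) ltac:(lra)) as [_ H]. destruct (H q ltac:(unfold Icc; lra)) as [H1 H2].
  split; [assumption|].
  apply (is_derive_on_extend 0 ((q + t) / 2) t G Gt); try lra; [|assumption].
  intros y Hy. symmetry. apply HGt. lra.
- assert (q = t) as -> by lra. rewrite <- Hlam by lra. split.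
  { intros E. apply Hne. rewrite E. ring. }
  apply is_derive_on_C_eps; [unfold Icc; lra|].
  intros eps He. destruct (ccont_eps _ _ Hcv eps He) as [d [Hd K]].
  exists (Rmin d t). split; [apply Rmin_glb_lt; lra|].
  intros y Hy Hyt. unfold Icc in Hy.
  pose proof (Rmin_l d t). pose proof (Rmin_r d t). 
  rewrite <- Cmod_opp.
  rewrite (Rabs_minus_sym y t), (Rabs_pos_eq (t - y)) in * by lra.
  replace (- (Gt y - Gt t - RtoC (y - t) * (RtoC 2 / (Gt t - RtoC (lam t)))))%C with
    ((Gt t - (RtoC 0 + RtoC t * v t)) - (Gt y - (RtoC 0 + RtoC y * v t)))%C
    by (unfold v; rewrite RtoC_minus; ring).
  replace (eps * (t - y)) with (eps * t - eps * y) by ring.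
  apply (mean_value_bound (fun x => Gt x - (RtoC 0 + RtoC x * v t))%C (fun x => v x - v t)%C
    (fun x => eps * x) (fun _ => eps)); try lra.
  + intros x Hx. apply ccont_minus.
    * destruct (Rlt_dec x t) as [Hxt|Hxt]; [|assert (x = t) as -> by lra; assumption].
      apply (ccont_ext_loc G).
      -- assert (Hd' : 0 < t - x) by lra. exists (mkposreal _ Hd'). intros w Hw.
         change (Rabs (w - x) < t - x) in Hw. apply Rabs_def2 in Hw. symmetry. apply HGt. lra.
      -- eapply cder_ccont. apply HGd. lra.
    * eapply cder_ccont. apply cder_affine.
  + intros. apply (continuous_mult (K := R_AbsRing)); [apply continuous_const|apply continuous_id].
  + intros x Hx. apply cder_minus; [|apply cder_affine].
    apply (cder_ext_loc G).
    * assert (Hd' : 0 < t - x) by lra. exists (mkposreal _ Hd'). intros w Hw.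
      change (Rabs (w - x) < t - x) in Hw. apply Rabs_def2 in Hw. symmetry. apply HGt. lra.
    * unfold v. rewrite HGt by lra. apply HGd. lra.
  + intros x Hx. auto_derive; [exact I|ring].
  + intros x Hx. left. apply K. rewrite Rabs_left; lra.
Qed.

(** * Points swallowed by the flow *)

(** [f] is the flow, relative to the driving function, of a point which is swallowed at time [t]:
    by [sw_blow] its modulus is not bounded away from zero near [t]. *)
Record swallowed (t M : R) (l : R -> R) (f : R -> C) : Prop := {
  sw_t : 0 < t;
  sw_l_cont : forall q, continuous l q;
  sw_l_bound : forall q, Rabs (l q) <= M;
  sw_cont : forall q, q < t -> ccont f q;
  sw_neq : forall q, q < t -> f q <> RtoC 0;
  sw_der : forall q, 0 < q < t -> cder f q (RtoC 2 / f q - RtoC (l q));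
  sw_start : 0 < Im (f 0);
  sw_left : forall q, q <= 0 -> f q = f 0;
  sw_blow : forall r kappa, 0 <= r < t -> 0 < kappa ->
     ~ (forall q, r <= q < t -> kappa <= Cmod (f q)) }.

Arguments sw_t {t M l f} _.
Arguments sw_l_cont {t M l f} _.
Arguments sw_l_bound {t M l f} _.
Arguments sw_cont {t M l f} _.
Arguments sw_neq {t M l f} _.
Arguments sw_der {t M l f} _.
Arguments sw_start {t M l f} _.
Arguments sw_left {t M l f} _.
Arguments sw_blow {t M l f} _.

Lemma Re_2_div z : Re (RtoC 2 / z) = 2 * Re z / (Re z ^ 2 + Im z ^ 2).
Proof. destruct z as [x y]. unfold Re, Im, Cdiv, Cinv, Cmult, RtoC; simpl. unfold Rdiv. ring. Qed.

Lemma Im_2_div z : Im (RtoC 2 / z) = - (2 * Im z / (Re z ^ 2 + Im z ^ 2)).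
Proof. destruct z as [x y]. unfold Re, Im, Cdiv, Cinv, Cmult, RtoC; simpl. unfold Rdiv. ring. Qed.

Lemma Csqnorm_pos z : z <> RtoC 0 -> 0 < Re z ^ 2 + Im z ^ 2.
Proof. intros H. apply Csqnorm_neq0 in H. pose proof (pow2_ge_0 (Re z)). pose proof (pow2_ge_0 (Im z)). lra. Qed.

(** Both the real and the imaginary part solve linear equations with the coefficient
    [2 / |f| ^ 2], up to sign; its primitive provides integrating factors. *)
Lemma swallowed_exponent {t M l f} : swallowed t M l f ->
  exists P, (forall q, q < t -> is_derive P q (2 / (Re (f q) ^ 2 + Im (f q) ^ 2))).
Proof.
intros H. apply primitive_exists. intros x Hx.
destruct (sw_cont H x Hx) as [C1 C2].
apply (continuous_mult (K := R_AbsRing) (fun _ => 2) (fun q => / (Re (f q) ^ 2 + Im (f q) ^ 2))); [apply continuous_const|].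
apply (continuous_Rinv_comp (fun q => Re (f q) ^ 2 + Im (f q) ^ 2)).
- apply (continuous_plus (fun u => Re (f u) ^ 2) (fun u => Im (f u) ^ 2)); simpl;
  repeat apply (continuous_mult (K := R_AbsRing)); try assumption; apply continuous_const.
- apply Csqnorm_neq0, (sw_neq H), Hx.
Qed.

Lemma exp_factor_deriv (u P : R -> R) q u' P' :
  is_derive u q u' -> is_derive P q P' ->
  is_derive (fun x => u x * exp (P x)) q ((u' + P' * u q) * exp (P q)).
Proof.
intros Hu HP. eapply is_derive_eq.
- apply (Derive.is_derive_mult u (fun x => exp (P x))); [exact Hu|].
  apply (is_derive_comp exp P); [apply is_derive_exp|exact HP].
- unfold scal; simpl; unfold mult; simpl. ring.
Qed.

Lemma swallowed_Im_pos {t M l f} q : swallowed t M l f -> q < t -> 0 < Im (f q).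
Proof.
intros H Hq.
destruct (Rle_dec q 0) as [Hq0|Hq0]; [rewrite (sw_left H) by assumption; apply (sw_start H)|].
destruct (swallowed_exponent H) as [P HP].
assert (Hinc : Im (f 0) * exp (P 0) <= Im (f q) * exp (P q)).
{ assert (Hd : forall x, 0 < x < t -> is_derive (fun u => Im (f u) * exp (P u)) x 0).
  { intros x Hx. eapply is_derive_eq.
    - apply exp_factor_deriv; [apply (sw_der H); lra|apply HP; lra].
    - assert (Hn := Csqnorm_neq0 _ (sw_neq H x ltac:(lra))).
      change (Im (RtoC 2 / f x - RtoC (l x))) with (Im (RtoC 2 / f x) - 0).
      rewrite Im_2_div. field. exact Hn. }
  apply (nondecreasing_of_derivative (fun u => Im (f u) * exp (P u)) (fun _ => 0)); try lra.
  - intros x Hx. apply (continuous_mult (K := R_AbsRing)).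
    + apply (sw_cont H); lra.
    + apply continuous_exp_comp. eapply is_derive_continuous. apply HP; lra.
  - intros x Hx. apply Hd; lra.
  - intros; lra. }
pose proof (sw_start H). pose proof (exp_pos (P 0)). pose proof (exp_pos (P q)). nra.
Qed.

Lemma swallowed_Im_decr {t M l f} q r : swallowed t M l f -> 0 <= q <= r -> r < t ->
  Im (f r) <= Im (f q).
Proof.
intros H Hq Hr.
enough (- Im (f q) <= - Im (f r)) by lra.
apply (nondecreasing_of_derivative (fun u => - Im (f u)) (fun u => 2 * Im (f u) / (Re (f u) ^ 2 + Im (f u) ^ 2))); try lra.
- intros x Hx. apply (continuous_opp (fun u => Im (f u))). apply (sw_cont H); lra.
- intros x Hx. eapply is_derive_eq.
  + apply (is_derive_opp (fun u => Im (f u))). apply (sw_der H); lra.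
  + change (Im (RtoC 2 / f x - RtoC (l x))) with (Im (RtoC 2 / f x) - 0).
    rewrite Im_2_div. unfold opp; simpl. ring.
- intros x Hx. pose proof (swallowed_Im_pos x H ltac:(lra)).
  apply Rdiv_le_0_compat; [lra|]. apply Csqnorm_pos, (sw_neq H); lra.
Qed.

(** The flow repels the real part away from zero, and [l] pushes it back at speed at most [M].  If
    the real part exceeded [M * (t - r)] at time [r], it would stay bounded away from zero up to
    time [t], and the point would not be swallowed. *)
Lemma swallowed_Re {t M l f} r : swallowed t M l f -> 0 <= r < t -> Rabs (Re (f r)) <= M * (t - r).
Proof.
intros H Hr. destruct (Rle_dec (Rabs (Re (f r))) (M * (t - r))) as [?|Hn]; [assumption|exfalso].
destruct (swallowed_exponent H) as [P HP].
set (kappa := Rabs (Re (f r)) - M * (t - r)). assert (Hk : 0 < kappa) by (unfold kappa; lra).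
assert (HM : 0 <= M) by (eapply Rle_trans; [apply Rabs_pos|apply (sw_l_bound H 0)]).
assert (Hsg : exists sg, Rabs sg = 1 /\ sg * Re (f r) = Rabs (Re (f r))).
{ destruct (Rle_dec 0 (Re (f r))).
  - exists 1. rewrite Rabs_R1, Rabs_pos_eq by assumption. lra.
  - exists (-1). rewrite (Rabs_left (Re (f r))) by lra. split; [rewrite Rabs_left; lra|lra]. }
destruct Hsg as [sg [Hs1 Hs2]].
apply (sw_blow H r kappa Hr Hk). intros q Hq.
eapply Rle_trans; [|apply re_le_Cmod].
assert (HPinc : P r <= P q).
{ apply (nondecreasing_of_derivative P (fun q => 2 / (Re (f q) ^ 2 + Im (f q) ^ 2))); try lra.
  - intros x Hx. eapply is_derive_continuous. apply HP; lra.
  - intros x Hx. apply HP; lra.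
  - intros x Hx. apply Rdiv_le_0_compat; [lra|]. apply Csqnorm_pos, (sw_neq H); lra. }
assert (Hmain : Rabs (sg * Re (f q) * exp (- (P q - P r)) - sg * Re (f r) * exp (- (P r - P r))) <= M * q - M * r).
{ apply (real_mean_value_bound (fun x => sg * Re (f x) * exp (- (P x - P r)))
    (fun x => - (sg * l x) * exp (- (P x - P r))) (fun x => M * x) (fun _ => M)); try lra.
  - intros x Hx. apply (continuous_mult (K := R_AbsRing)).
    + apply (continuous_mult (K := R_AbsRing)); [apply continuous_const|]. apply (sw_cont H); lra.
    + apply continuous_exp_comp, (continuous_opp (fun x => P x - P r)).
      apply (continuous_minus P (fun _ => P r)); [|apply continuous_const].
      eapply is_derive_continuous. apply HP; lra.
  - intros x Hx. apply (continuous_mult (K := R_AbsRing)); [apply continuous_const|apply continuous_id].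
  - intros x Hx. eapply is_derive_eq.
    + apply (exp_factor_deriv (fun x => sg * Re (f x)) (fun x => - (P x - P r))).
      * apply is_derive_scal. apply (sw_der H); lra.
      * apply (is_derive_opp (fun x => P x - P r)).
        apply (is_derive_minus P (fun _ => P r)); [apply HP; lra|apply (is_derive_const (K := R_AbsRing))].
    + assert (Hnz := Csqnorm_neq0 _ (sw_neq H x ltac:(lra))).
      change (Re (RtoC 2 / f x - RtoC (l x))) with (Re (RtoC 2 / f x) - l x).
      rewrite Re_2_div. unfold opp, minus, plus, zero; simpl. unfold opp; simpl. f_equal. field. simpl in Hnz. lra.
  - intros x Hx. auto_derive; [exact I|ring].
  - intros x Hx.
    assert (HPx : P r <= P x).
    { apply (nondecreasing_of_derivative P (fun q => 2 / (Re (f q) ^ 2 + Im (f q) ^ 2))); try lra.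
      - intros y Hy. eapply is_derive_continuous. apply HP; lra.
      - intros y Hy. apply HP; lra.
      - intros y Hy. apply Rdiv_le_0_compat; [lra|]. apply Csqnorm_pos, (sw_neq H); lra. }
    rewrite Rabs_mult, Rabs_Ropp, Rabs_mult, Hs1, Rmult_1_l.
    rewrite (Rabs_pos_eq (exp _)) by (left; apply exp_pos).
    assert (exp (- (P x - P r)) <= 1).
    { rewrite <- exp_0. destruct (Rle_lt_or_eq_dec _ _ HPx) as [E|E].
      - left. apply exp_increasing. lra.
      - right. f_equal. lra. }
    pose proof (sw_l_bound H x). pose proof (exp_pos (- (P x - P r))).
    pose proof (Rabs_pos (l x)). nra. }
rewrite Rminus_diag, Ropp_0, exp_0, Rmult_1_r, Hs2 in Hmain.
apply Rabs_le_between in Hmain.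
assert (He : 0 < exp (- (P q - P r)) <= 1).
{ split; [apply exp_pos|]. rewrite <- exp_0. destruct (Rle_lt_or_eq_dec _ _ HPinc) as [E|E].
  - left. apply exp_increasing. lra.
  - right. f_equal. lra. }
assert (Hx : kappa <= sg * Re (f q) * exp (- (P q - P r))) by (unfold kappa; nra).
assert (Hp : 0 < sg * Re (f q)) by nra.
apply Rle_trans with (sg * Re (f q)); [nra|].
eapply Rle_trans; [apply Rle_abs|]. rewrite Rabs_mult, Hs1. lra.
Qed.

(** The imaginary part decreases; if it stayed above [eta] the point would not be swallowed. *)
Lemma swallowed_Im_small {t M l f} eta : swallowed t M l f -> 0 < eta ->
  exists r, 0 <= r < t /\ forall q, r <= q < t -> Im (f q) < eta.
Proof.
intros H He.
destruct (classic (exists r, 0 <= r < t /\ Im (f r) < eta)) as [[r [Hr Hlt]]|Hno].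
- exists r. split; [assumption|]. intros q Hq.
  eapply Rle_lt_trans; [apply (swallowed_Im_decr r q H); lra|assumption].
- exfalso. pose proof (sw_t H).
  apply (sw_blow H 0 eta ltac:(lra) He). intros q Hq.
  eapply Rle_trans; [|apply Im_le_mod].
  apply Rnot_lt_le. intros Hlt. apply Hno. exists q. split; [lra|assumption].
Qed.

Definition flow_to_tip (t : R) (f : R -> C) (q : R) : C := if Rlt_dec q t then f q else RtoC 0.

Lemma flow_to_tip_before t f q : q < t -> flow_to_tip t f q = f q.
Proof. intros H. unfold flow_to_tip. destruct (Rlt_dec q t); [reflexivity|lra]. Qed.

Lemma flow_to_tip_after t f q : t <= q -> flow_to_tip t f q = RtoC 0.
Proof. intros H. unfold flow_to_tip. destruct (Rlt_dec q t); [lra|reflexivity]. Qed.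

Lemma flow_to_tip_locally t f q : q < t -> locally q (fun u => f u = flow_to_tip t f u).
Proof.
intros Hq. assert (Hd : 0 < t - q) by lra. exists (mkposreal _ Hd). intros w Hw.
change (Rabs (w - q) < t - q) in Hw. apply Rabs_def2 in Hw. symmetry. apply flow_to_tip_before. lra.
Qed.

(** Continuity at [t] combines [swallowed_Re] and [swallowed_Im_small]. *)
Lemma flow_to_tip_ccont {t M l f} q : swallowed t M l f -> ccont (flow_to_tip t f) q.
Proof.
intros H. destruct (Rtotal_order q t) as [Hq|[->|Hq]].
- apply (ccont_ext_loc f); [now apply flow_to_tip_locally|]. now apply (sw_cont H).
- assert (HM : 0 <= M) by (eapply Rle_trans; [apply Rabs_pos|apply (sw_l_bound H 0)]).
  apply eps_ccont. intros eps He.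
  destruct (swallowed_Im_small (eps / 2) H ltac:(lra)) as [r [Hr HI]].
  exists (Rmin (t - r) (eps / (2 * (M + 1)))). split.
  { apply Rmin_glb_lt; [lra|]. apply Rdiv_lt_0_compat; lra. }
  intros y Hy. pose proof (Rmin_l (t - r) (eps / (2 * (M + 1)))). pose proof (Rmin_r (t - r) (eps / (2 * (M + 1)))).
  apply Rabs_def2 in Hy. rewrite (flow_to_tip_after t f t) by lra.
  destruct (Rlt_dec y t) as [Hyt|Hyt].
  + rewrite flow_to_tip_before by assumption.
    replace (f y - RtoC 0)%C with (RtoC (Re (f y)) + Ci * RtoC (Im (f y)))%C
        by (apply injective_projections; unfold Re, Im; simpl; ring).
    eapply Rle_lt_trans; [apply Cmod_triangle|]. rewrite Cmod_mult, Cmod_Ci, !Cmod_R.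
    pose proof (swallowed_Re y H ltac:(lra)).
    pose proof (swallowed_Im_pos y H Hyt). specialize (HI y ltac:(lra)).
    rewrite (Rabs_pos_eq (Im (f y))) by lra.
    assert (M * (t - y) <= eps / 2).
    { apply Rle_trans with (M * (eps / (2 * (M + 1)))); [apply Rmult_le_compat_l; lra|].
      apply (Rmult_le_reg_l (2 * (M + 1))); [lra|]. field_simplify; [|lra]. nra. }
    lra.
  + rewrite flow_to_tip_after by lra. replace (RtoC 0 - RtoC 0)%C with (RtoC 0) by ring. now rewrite Cmod_0.
- apply (ccont_ext_loc (fun _ => RtoC 0)); [|apply ccont_const].
  assert (Hd : 0 < q - t) by lra. exists (mkposreal _ Hd). intros w Hw.
  change (Rabs (w - q) < q - t) in Hw. apply Rabs_def2 in Hw. symmetry. apply flow_to_tip_after. lra.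
Qed.

Lemma flow_to_tip_cder {t M l f} q : swallowed t M l f -> 0 < q < t ->
  cder (flow_to_tip t f) q (RtoC 2 / flow_to_tip t f q - RtoC (l q)).
Proof.
intros H Hq. apply (cder_ext_loc f); [apply flow_to_tip_locally; lra|].
rewrite flow_to_tip_before by lra. now apply (sw_der H).
Qed.

Lemma flow_to_tip_Re {t M l f} r : swallowed t M l f -> 0 <= r <= t -> Rabs (Re (flow_to_tip t f r)) <= M * (t - r).
Proof.
intros H Hr. destruct (Rlt_dec r t) as [Hrt|Hrt].
- rewrite flow_to_tip_before by assumption. apply (swallowed_Re _ H). lra.
- rewrite flow_to_tip_after by lra. simpl. rewrite Rabs_R0. replace (t - r) with 0 by lra. lra.
Qed.

(** The square of the imaginary part decreases at speed at most [4]. *)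
Lemma flow_to_tip_Im_sq {t M l f} r : swallowed t M l f -> 0 <= r <= t -> Im (flow_to_tip t f r) ^ 2 <= 4 * (t - r).
Proof.
intros H Hr.
enough (Im (flow_to_tip t f r) * Im (flow_to_tip t f r) + 4 * r <= Im (flow_to_tip t f t) * Im (flow_to_tip t f t) + 4 * t).
{ rewrite (flow_to_tip_after t f t) in H0 by lra. simpl (Im (RtoC 0)) in H0. simpl. lra. }
apply (nondecreasing_of_derivative (fun q => Im (flow_to_tip t f q) * Im (flow_to_tip t f q) + 4 * q)
  (fun q => 4 - 4 * Im (f q) ^ 2 / (Re (f q) ^ 2 + Im (f q) ^ 2))); try lra.
- intros x Hx. destruct (flow_to_tip_ccont x H) as [_ C2].
  apply (continuous_plus (V := R_NormedModule) (fun q => Im (flow_to_tip t f q) * Im (flow_to_tip t f q)) (fun q => 4 * q)).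
  + now apply (continuous_mult (K := R_AbsRing)).
  + apply (continuous_mult (K := R_AbsRing)); [apply continuous_const|apply continuous_id].
- intros x Hx. destruct (flow_to_tip_cder x H ltac:(lra)) as [_ D2].
  rewrite flow_to_tip_before in D2 by lra.
  eapply is_derive_eq.
  + apply (is_derive_plus (V := R_NormedModule) (fun q => Im (flow_to_tip t f q) * Im (flow_to_tip t f q)) (fun q => 4 * q)).
    * apply Derive.is_derive_mult; exact D2.
    * apply is_derive_scal, (is_derive_id (K := R_AbsRing)).
  + assert (Hn := Csqnorm_neq0 _ (sw_neq H x ltac:(lra))).
    change (Im (RtoC 2 / f x - RtoC (l x))) with (Im (RtoC 2 / f x) - 0).
    rewrite Im_2_div, flow_to_tip_before by lra. unfold plus, one; simpl. simpl in Hn. field. lra.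
- intros x Hx. assert (Hn := Csqnorm_pos _ (sw_neq H x ltac:(lra))).
  assert (4 * Im (f x) ^ 2 / (Re (f x) ^ 2 + Im (f x) ^ 2) <= 4); [|lra].
  apply (Rmult_le_reg_l (Re (f x) ^ 2 + Im (f x) ^ 2)); [assumption|].
  unfold Rdiv. rewrite (Rmult_comm (4 * _)), <- Rmult_assoc, Rinv_r by lra.
  pose proof (pow2_ge_0 (Re (f x))). lra.
Qed.

Lemma flow_to_tip_Cmod t T M l f r : swallowed t M l f -> t <= T -> 0 <= r <= t ->
  Cmod (flow_to_tip t f r) <= sqrt (M ^ 2 * T + 4) * sqrt (t - r).
Proof.
intros H HT Hr.
pose proof (flow_to_tip_Re _ H Hr) as HR. pose proof (flow_to_tip_Im_sq _ H Hr) as HI.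
pose proof (pow2_ge_0 M).
pose proof (sw_t H) as Ht.
rewrite <- sqrt_mult by nra.
rewrite <- (sqrt_pow2 (Cmod (flow_to_tip t f r))) by apply Cmod_ge_0.
apply sqrt_le_1_alt. rewrite Cmod2_alt.
assert (Re (flow_to_tip t f r) ^ 2 <= M ^ 2 * T * (t - r)).
{ rewrite <- (pow2_abs (Re _)). apply Rle_trans with ((M * (t - r)) ^ 2).
  - apply pow_incr. split; [apply Rabs_pos|assumption].
  - assert (M ^ 2 * (t - r) * (t - r) <= M ^ 2 * (t - r) * T); [|lra].
    apply Rmult_le_compat_l; [|lra]. apply Rmult_le_pos; lra. }
lra.
Qed.

(** The derivative of the square is [4 - 2 l f], where the second term is small near [t]. *)
Lemma flow_to_tip_square t T M l f r : swallowed t M l f -> t <= T -> 0 <= r <= t ->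
  Cmod (flow_to_tip t f r * flow_to_tip t f r + RtoC (4 * (t - r))) <=
    2 * M * sqrt (M ^ 2 * T + 4) * ((t - r) * sqrt (t - r)).
Proof.
intros H HT Hr. set (B := sqrt (M ^ 2 * T + 4)).
assert (HM : 0 <= M) by (eapply Rle_trans; [apply Rabs_pos|apply (sw_l_bound H 0)]).
set (k := 2 * M * (B * sqrt (t - r))).
replace (2 * M * B * ((t - r) * sqrt (t - r))) with (k * t - k * r) by (unfold k; ring).
rewrite <- Cmod_opp.
replace (- (flow_to_tip t f r * flow_to_tip t f r + RtoC (4 * (t - r))))%C with
  ((flow_to_tip t f t * flow_to_tip t f t + (RtoC (4 * t) + RtoC t * (- (4)))) - (flow_to_tip t f r * flow_to_tip t f r + (RtoC (4 * t) + RtoC r * (- (4)))))%C.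
2:{ rewrite (flow_to_tip_after t f t) by lra. rewrite !RtoC_mult, RtoC_minus. ring. }
apply (mean_value_bound (fun q => flow_to_tip t f q * flow_to_tip t f q + (RtoC (4 * t) + RtoC q * (- (4))))%C
  (fun q => RtoC (- (2) * l q) * flow_to_tip t f q)%C (fun q => k * q) (fun _ => k)); try lra.
- intros x Hx. apply ccont_plus; [apply ccont_mult; apply (flow_to_tip_ccont _ H)|].
  eapply cder_ccont. apply cder_affine.
- intros. apply (continuous_mult (K := R_AbsRing)); [apply continuous_const|apply continuous_id].
- intros x Hx. eapply cder_eq.
  + apply cder_plus; [apply cder_mult; apply (flow_to_tip_cder _ H); lra|apply cder_affine].
  + rewrite flow_to_tip_before by lra. rewrite RtoC_mult, RtoC_opp. field.
    apply (sw_neq H); lra.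
- intros x Hx. auto_derive; [exact I|ring].
- intros x Hx. unfold k. apply Cmod_mult_le.
  + rewrite Cmod_R, Rabs_mult, Rabs_Ropp, (Rabs_pos_eq 2) by lra.
    pose proof (sw_l_bound H x). lra.
  + eapply Rle_trans; [apply (flow_to_tip_Cmod _ T _ _ _ _ H); lra|].
    apply Rmult_le_compat_l; [apply sqrt_pos|]. apply sqrt_le_1_alt; lra.
Qed.

(** Near the tip, [flow_to_tip_square] forces the square of [f] to be close to [- 4 (t - r)].
    Further away the imaginary part is larger, since it decreases in time. *)
Lemma flow_to_tip_Im_lower t T M l f r D s1 : swallowed t M l f -> t <= T -> 0 <= r <= t ->
  D = 2 * M * sqrt (M ^ 2 * T + 4) -> 0 < s1 <= T -> D * sqrt s1 <= 3 ->
  sqrt (s1 / T) * sqrt (t - r) <= Im (flow_to_tip t f r).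
Proof.
intros H HT Hr HD Hs1 HD3.
assert (HM : 0 <= M) by (eapply Rle_trans; [apply Rabs_pos|apply (sw_l_bound H 0)]).
assert (HD0 : 0 <= D) by (rewrite HD; pose proof (sqrt_pos (M ^ 2 * T + 4)); nra).
assert (Hnear : forall q, 0 <= q <= t -> t - q <= s1 -> sqrt (t - q) <= Im (flow_to_tip t f q)).
{ intros q Hq Hqs. destruct (Rlt_dec q t) as [Hqt|Hqt].
  2:{ rewrite flow_to_tip_after by lra. replace (t - q) with 0 by lra. rewrite sqrt_0. simpl. lra. }
  assert (Hpos : 0 < Im (flow_to_tip t f q)) by (rewrite flow_to_tip_before by assumption; now apply (swallowed_Im_pos q H)).
  pose proof (flow_to_tip_square _ T _ _ _ q H HT Hq) as HS. rewrite <- HD in HS.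
  assert (HR : Re (flow_to_tip t f q) ^ 2 - Im (flow_to_tip t f q) ^ 2 + 4 * (t - q) <= D * ((t - q) * sqrt (t - q))).
  { eapply Rle_trans; [|exact HS]. eapply Rle_trans; [|apply Re_le_mod].
    right. unfold Re, Im; simpl. ring. }
  assert (Hds : D * sqrt (t - q) <= 3).
  { eapply Rle_trans; [|exact HD3]. apply Rmult_le_compat_l; [assumption|]. apply sqrt_le_1_alt; lra. }
  assert (D * ((t - q) * sqrt (t - q)) <= 3 * (t - q)) by (replace (D * ((t - q) * sqrt (t - q))) with (D * sqrt (t - q) * (t - q)) by ring; apply Rmult_le_compat_r; lra).
  pose proof (pow2_ge_0 (Re (flow_to_tip t f q))).
  rewrite <- (sqrt_pow2 (Im (flow_to_tip t f q))) by lra. apply sqrt_le_1_alt. lra. }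
assert (Hq1 : sqrt (s1 / T) <= 1).
{ rewrite <- sqrt_1. apply sqrt_le_1_alt. apply (Rmult_le_reg_l T); [lra|]. field_simplify; lra. }
destruct (Rle_dec (t - r) s1) as [Hle|Hgt].
- specialize (Hnear r Hr Hle). pose proof (sqrt_pos (t - r)). nra.
- specialize (Hnear (t - s1) ltac:(lra) ltac:(lra)). replace (t - (t - s1)) with s1 in Hnear by ring.
  rewrite flow_to_tip_before in * by lra.
  pose proof (swallowed_Im_decr r (t - s1) H ltac:(lra) ltac:(lra)).
  apply Rle_trans with (sqrt s1); [|lra].
  rewrite sqrt_div by lra.
  assert (0 < sqrt T) by (apply sqrt_lt_R0; lra).
  apply (Rmult_le_reg_l (sqrt T)); [assumption|].
  replace (sqrt T * (sqrt s1 / sqrt T * sqrt (t - r))) with (sqrt s1 * sqrt (t - r)) by (field; lra).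
  rewrite (Rmult_comm (sqrt T)). apply Rmult_le_compat_l; [apply sqrt_pos|]. apply sqrt_le_1_alt; lra.
Qed.

(** * Slits and norms *)

Lemma Derive_on_correct {V : CompleteNormedModule R_AbsRing} a b (phi : R -> V) t :
  a < b -> Icc a b t -> ex_derive_on a b phi t -> is_derive_on a b phi t (Derive_on a b phi t).
Proof. intros Hab Ht [l Hl]. rewrite (Derive_on_eq a b phi t l); assumption. Qed.

Lemma is_derive_on_RtoC a b (phi : R -> R) t (l : R) : Icc a b t ->
  is_derive_on (V := R_NormedModule) a b phi t l ->
  is_derive_on (V := CR) a b (fun u => RtoC (phi u)) t (RtoC l).
Proof.
intros Ht H. rewrite is_derive_on_eps in H by assumption.
apply is_derive_on_C_eps; [assumption|]. intros eps He.
destruct (H eps He) as [d [Hd K]]. exists d. split; [assumption|]. intros y Hy Hyt.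
rewrite <- RtoC_mult, <- !RtoC_minus, Cmod_R. exact (K y Hy Hyt).
Qed.

Lemma Lub_ge E (y : R) : E y -> Rbar_le y (Lub_Rbar E).
Proof. intros H. now apply (proj1 (Lub_Rbar_correct E)). Qed.

Lemma Lub_le_elem E (y K : R) : Rbar_le (Lub_Rbar E) K -> E y -> y <= K.
Proof. intros H Hy. exact (Rbar_le_trans _ _ _ (Lub_ge E y Hy) H). Qed.

Lemma Lub_nonneg E (y : R) : E y -> 0 <= y -> Rbar_le 0 (Lub_Rbar E).
Proof. intros H Hy. eapply Rbar_le_trans; [|now apply (Lub_ge E y)]. exact Hy. Qed.

Lemma Lub_le E (K : R) : (forall y, E y -> y <= K) -> Rbar_le (Lub_Rbar E) K.
Proof. intros H. apply (proj2 (Lub_Rbar_correct E)). intros y Hy. exact (H y Hy). Qed.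

Lemma Rbar_plus_le_split x y (K : R) : Rbar_le 0 x -> Rbar_le 0 y ->
  Rbar_le (Rbar_plus x y) K -> Rbar_le x K /\ Rbar_le y K.
Proof. destruct x as [x| |], y as [y| |]; simpl; try tauto. lra. Qed.

Lemma Rbar_finite_between x (K : R) : Rbar_le 0 x -> Rbar_le x K ->
  exists r, x = Finite r /\ 0 <= r <= K.
Proof. destruct x as [x| |]; simpl; try tauto. intros. exists x. split; [reflexivity|lra]. Qed.

Lemma sup_norm_nonneg {V : NormedModule R_AbsRing} a b (phi : R -> V) : a < b ->
  Rbar_le 0 (sup_norm_on a b phi).
Proof.
intros Hab. apply (Lub_nonneg _ (norm (phi a))); [|apply norm_ge_0].
exists a. split; [unfold Icc; lra|reflexivity].
Qed.

Lemma holder_nonneg {V : NormedModule R_AbsRing} a b alpha (phi : R -> V) : a < b ->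
  Rbar_le 0 (holder_seminorm a b alpha phi).
Proof.
intros Hab. apply (Lub_nonneg _ (norm (minus (phi a) (phi b)) / Rpower (Rabs (a - b)) alpha)).
- exists a, b. unfold Icc. repeat split; lra.
- apply Rdiv_le_0_compat; [apply norm_ge_0|apply exp_pos].
Qed.

Lemma driving_bounds (T M delta : R) (lambda : R -> R) : 0 < T ->
  C_class (V := R_CompleteNormedModule) 0 T 1 (1 / 2 + delta) lambda ->
  Rbar_le (C_norm (V := R_CompleteNormedModule) 0 T 1 (1 / 2 + delta) lambda) M ->
  exists l0 : R -> R,
  (forall t, Icc 0 T t -> is_derive_on (V := R_NormedModule) 0 T lambda t (l0 t)) /\
  (forall t, Icc 0 T t -> Rabs (lambda t) <= M) /\
  (forall t, Icc 0 T t -> Rabs (l0 t) <= M) /\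
  (forall t s, Icc 0 T t -> Icc 0 T s -> Rabs (l0 t - l0 s) <= M * pw (1 / 2 + delta) (Rabs (t - s))).
Proof.
intros HT [Hex _] Hn.
exists (Derive_on (V := R_CompleteNormedModule) 0 T lambda).
unfold C_norm in Hn. simpl in Hn.
assert (N0 := sup_norm_nonneg (V := R_NormedModule) 0 T lambda HT).
assert (N1 := sup_norm_nonneg (V := R_NormedModule) 0 T (Derive_on (V := R_CompleteNormedModule) 0 T lambda) HT).
assert (N2 := holder_nonneg (V := R_NormedModule) 0 T (1 / 2 + delta) (Derive_on (V := R_CompleteNormedModule) 0 T lambda) HT).
(* Nonnegativity excludes sums of opposite infinities. *)
assert (N01 := Rbar_plus_le_compat _ _ _ _ N0 N1).
rewrite Rbar_plus_0_l in N01.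
destruct (Rbar_plus_le_split _ _ M N01 N2 Hn) as [Hn01 Hh].
destruct (Rbar_plus_le_split _ _ M N0 N1 Hn01) as [Hn0 Hn1].
split; [|split; [|split]].
- intros t Ht. apply (Derive_on_correct (V := R_CompleteNormedModule)); [assumption|assumption|].
  apply (Hex 0%nat t); [auto|assumption].
- intros t Ht. apply (Lub_le_elem _ _ _ Hn0). exists t. split; [assumption|reflexivity].
- intros t Ht. apply (Lub_le_elem _ _ _ Hn1). exists t. split; [assumption|reflexivity].
- intros t s Ht Hs. destruct (Req_dec t s) as [->|Hne].
  + rewrite !Rminus_diag, Rabs_R0, pw_le0 by lra. lra.
  + assert (Hp : 0 < Rabs (t - s)) by (apply Rabs_pos_lt; lra).
    rewrite pw_gt0 by assumption. set (l0 := Derive_on _ _ _) in *.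
    assert (Hq : Rabs (l0 t - l0 s) / Rpower (Rabs (t - s)) (1 / 2 + delta) <= M).
    { apply (Lub_le_elem _ _ _ Hh). exists t, s. repeat split; try apply Ht; try apply Hs; assumption. }
    assert (Hr : 0 < Rpower (Rabs (t - s)) (1 / 2 + delta)) by apply exp_pos.
    apply (Rmult_le_compat_r (Rpower (Rabs (t - s)) (1 / 2 + delta))) in Hq; [|lra].
    unfold Rdiv in Hq. rewrite Rmult_assoc, Rinv_l in Hq by lra. lra.
Qed.

(** Injectivity of [gamma] puts [gamma t] in the domain at every time [s < t] and the description of
    the domain at time [t] excludes it, so its flow exists on [[0, t)] but not on [[0, t]];
    [solution_extend] turns the latter into [sw_blow]. *)
Lemma slit_swallowed (T M : R) (lambda l0 : R -> R) (gamma : R -> C) (t : R) : 0 < t <= T ->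
  (forall s, Icc 0 T s -> is_derive_on (V := R_NormedModule) 0 T lambda s (l0 s)) ->
  (forall s, Icc 0 T s -> Rabs (l0 s) <= M) ->
  (forall q, continuous (fun u => l0 (clamp 0 T u)) q) ->
  generates_slit T lambda gamma ->
  exists f, swallowed t M (fun u => l0 (clamp 0 T u)) f /\ f 0 = (gamma t - RtoC (lambda 0))%C.
Proof.
intros Ht Hder Hbd Hlc [[_ Hinj] [_ [HIm Hdom]]].
assert (HderC : forall s, Icc 0 T s -> is_derive_on (V := CR) 0 T (fun u => RtoC (lambda u)) s (RtoC (l0 s))).
{ intros s Hs. apply is_derive_on_RtoC; [assumption|now apply Hder]. }
assert (Hcl : forall s, 0 <= s <= T -> forall q, continuous (fun u => lambda (clamp 0 s u)) q).
{ intros s Hs q. apply (proj1 (clamp_ccont 0 s (fun u => RtoC (lambda u)) (fun u => RtoC (l0 u)) ltac:(lra)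
    (fun x Hx => is_derive_on_restrict 0 T s _ x _ ltac:(lra) Hx (HderC x ltac:(unfold Icc in *; lra))) q)). }
assert (HImt : 0 < Im (gamma t)) by (apply HIm; lra).
assert (Hsol : forall s, 0 <= s < t -> exists g, loewner_solution lambda s (gamma t) g).
{ intros s Hs. apply (Hdom s ltac:(unfold Icc; lra) (gamma t)). split; [assumption|].
  intros [s' [Hs' E]]. unfold Icc in *. apply Hinj in E; unfold Icc; lra. }
assert (Hnosol : ~ exists g, loewner_solution lambda t (gamma t) g).
{ intros Hg. assert (D : loewner_domain lambda t (gamma t)) by (split; assumption).
  apply (Hdom t ltac:(unfold Icc; lra)) in D. apply (proj2 D). exists t. unfold Icc. split; [lra|reflexivity]. }
destruct (solution_glue lambda t (gamma t) ltac:(lra)) as [G HG]; [|assumption|].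
{ intros s Hs. apply Hcl. lra. }
set (lam := fun u => lambda (clamp 0 T u)).
assert (Hlamc : forall q, continuous lam q) by (apply Hcl; lra).
assert (Hlam : forall q, 0 <= q <= T -> lam q = lambda q) by (intros q Hq; unfold lam; now rewrite clamp_id).
set (f := fun q => (G (Rmax 0 q) - RtoC (lam q))%C).
assert (Hf : forall q, 0 <= q -> f q = (G q - RtoC (lam q))%C) by (intros q Hq; unfold f; now rewrite Rmax_right).
assert (HG0 : G 0 = gamma t) by (apply (HG 0); lra).
assert (Hf0 : f 0 = (gamma t - RtoC (lambda 0))%C) by (rewrite Hf, HG0, Hlam by lra; reflexivity).
exists f. split; [|assumption].
constructor.
- lra.
- exact Hlc.
- intros q. apply Hbd. apply clamp_in. lra.
- intros q Hq. apply ccont_minus; [|now apply ccont_real].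
  assert (Hm : Rmax 0 q < t) by (apply Rmax_lub_lt; lra).
  pose proof (Rmax_l 0 q). pose proof (Rmax_r 0 q).
  set (s := (Rmax 0 q + t) / 2).
  apply (ccont_ext_loc (fun u => G (clamp 0 s u))).
  + assert (Hd : 0 < s - q) by (unfold s; lra). exists (mkposreal _ Hd). intros w Hw.
    change (Rabs (w - q) < s - q) in Hw. apply Rabs_def2 in Hw.
    unfold clamp. now rewrite Rmin_left by lra.
  + eapply clamp_ccont; [unfold s; lra|]. intros x Hx. apply (HG s); [unfold s; lra|assumption].
- intros q Hq E. apply Ceq_of_minus in E.
  assert (Hm : Rmax 0 q < t) by (apply Rmax_lub_lt; lra).
  pose proof (Rmax_l 0 q).
  apply (proj1 (proj2 (HG (Rmax 0 q) ltac:(lra)) (Rmax 0 q) ltac:(unfold Icc; lra))).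
  rewrite E. unfold lam, clamp. now rewrite Rmin_left by lra.
- intros q Hq.
  assert (DG : cder G q (RtoC 2 / (G q - RtoC (lam q)))%C).
  { rewrite Hlam by lra. apply (is_derive_on_interior 0 ((q + t) / 2)); [lra|].
    apply (HG ((q + t) / 2)); [lra|]. unfold Icc; lra. }
  assert (DL : cder (fun u => RtoC (lam u)) q (RtoC (l0 (clamp 0 T q)))).
  { rewrite clamp_id by lra. apply (clamp_cder 0 T (fun u => RtoC (lambda u))); [lra|].
    apply (is_derive_on_interior 0 T); [lra|]. apply HderC. unfold Icc; lra. }
  rewrite Hf by lra. apply cder_minus; [|exact DL].
  apply (cder_ext_loc G); [|exact DG].
  exists (mkposreal q (proj1 Hq)). intros w Hw.
  change (Rabs (w - q) < q) in Hw. apply Rabs_def2 in Hw. now rewrite Rmax_right by lra.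
- rewrite Hf0. unfold Im in *. simpl. lra.
- intros q Hq. unfold f. rewrite (Rmax_left 0 q), (Rmax_left 0 0) by lra.
  do 2 f_equal. unfold lam, clamp. rewrite (Rmin_left q), (Rmax_left 0 q), (Rmin_left 0), (Rmax_left 0 0) by lra. reflexivity.
- intros r kappa Hr Hk Hfar. apply Hnosol.
  apply (solution_extend lambda lam t r kappa (gamma t) G); try assumption.
  + intros q Hq. apply Hlam. lra.
  + intros q Hq. rewrite <- Hf by lra. now apply Hfar.
Qed.

Lemma slit_tip_flow (T M delta : R) : 0 < T -> 0 < M -> 0 < delta <= 1 / 2 ->
  exists b B D, params T M delta b B D /\
  forall (lambda : R -> R) (gamma : R -> C),
  C_class (V := R_CompleteNormedModule) 0 T 1 (1 / 2 + delta) lambda ->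
  Rbar_le (C_norm (V := R_CompleteNormedModule) 0 T 1 (1 / 2 + delta) lambda) M ->
  generates_slit T lambda gamma ->
  Rabs (lambda 0) <= M /\
  exists lam l W, tip_flow T M delta b B D lam l W /\
  forall t, 0 < t <= T -> gamma t = (RtoC (lambda 0) + W t 0)%C.
Proof.
intros HT HM Hd.
set (B := sqrt (M ^ 2 * T + 4)).
assert (HB : 0 < B) by (apply sqrt_lt_R0; pose proof (pow2_ge_0 M); nra).
set (D := 2 * M * B). assert (HD : 0 < D) by (unfold D; nra).
(* Up to distance [s1] from the tip the error in [flow_to_tip_square] is at most [3 (t - r)]. *)
set (s1 := Rmin T ((3 / D) ^ 2)).
assert (H3D : 0 < 3 / D) by (apply Rdiv_lt_0_compat; lra).
assert (Hs1 : 0 < s1 <= T).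
{ split; [apply Rmin_glb_lt; [assumption|now apply pow_lt]|apply Rmin_l]. }
assert (HDs : D * sqrt s1 <= 3).
{ apply Rle_trans with (D * (3 / D)); [|right; field; lra].
  apply Rmult_le_compat_l; [lra|]. rewrite <- (sqrt_pow2 (3 / D)) by lra.
  apply sqrt_le_1_alt, Rmin_r. }
exists (sqrt (s1 / T)), B, D. split.
{ repeat split; try lra. apply sqrt_lt_R0, Rdiv_lt_0_compat; lra. }
intros lambda gamma Hcl Hn Hslit.
destruct (driving_bounds T M delta lambda HT Hcl Hn) as [l0 [Hder [Hb0 [Hb1 Hh]]]].
split; [apply Hb0; unfold Icc; lra|].
assert (Hcin : forall q, Icc 0 T (clamp 0 T q)) by (intros q; apply clamp_in; lra).
assert (Hlh : forall q p, Rabs (l0 (clamp 0 T q) - l0 (clamp 0 T p)) <= M * pw (1 / 2 + delta) (Rabs (q - p))).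
{ intros q p. eapply Rle_trans; [now apply Hh|]. apply Rmult_le_compat_l; [lra|].
  apply pw_le; [lra|apply clamp_lip]. }
assert (Hlc : forall q, continuous (fun u => l0 (clamp 0 T u)) q).
{ intros q. apply continuous_eps. intros eps He.
  destruct (pw_small (1 / 2 + delta) ltac:(lra) (eps / M) ltac:(now apply Rdiv_lt_0_compat)) as [d [Hd0 K]].
  exists d. split; [assumption|]. intros y Hy.
  eapply Rle_lt_trans; [apply Hlh|]. specialize (K _ Hy).
  apply (Rmult_lt_compat_l M) in K; [|assumption]. replace (M * (eps / M)) with eps in K by (field; lra). exact K. }
set (l := fun u => l0 (clamp 0 T u)) in *.
set (P := fun t (w : R -> C) => exists f, swallowed t M l f /\ f 0 = (gamma t - RtoC (lambda 0))%C /\ w = flow_to_tip t f).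
set (W := fun t => epsilon (inhabits (fun _ : R => RtoC 0)) (P t)).
assert (HW : forall t, 0 < t <= T -> P t (W t)).
{ intros t Ht. apply epsilon_spec.
  destruct (slit_swallowed T M lambda l0 gamma t Ht Hder Hb1 Hlc Hslit) as [f [Hf1 Hf2]].
  exists (flow_to_tip t f), f. auto. }
assert (HderC : forall s, Icc 0 T s -> is_derive_on (V := CR) 0 T (fun u => RtoC (lambda u)) s (RtoC (l0 s))).
{ intros s Hs. apply is_derive_on_RtoC; [assumption|now apply Hder]. }
exists (fun u => lambda (clamp 0 T u)), l, W. split.
- constructor.
  + exact Hlc.
  + intros q. now apply Hb1.
  + exact Hlh.
  + intros q. apply (proj1 (clamp_ccont 0 T (fun u => RtoC (lambda u)) (fun u => RtoC (l0 u)) ltac:(lra) HderC q)).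
  + intros q Hq.
    assert (DL : cder (fun u => RtoC (lambda (clamp 0 T u))) q (RtoC (l q))).
    { unfold l. rewrite clamp_id by lra. apply (clamp_cder 0 T (fun u => RtoC (lambda u))); [lra|].
      apply (is_derive_on_interior 0 T); [lra|]. apply HderC. unfold Icc; lra. }
    apply DL.
  + intros t r Ht Hr. destruct (HW t Ht) as [f [Hf [Hf0 ->]]]. now apply flow_to_tip_after.
  + intros t r Ht. destruct (HW t Ht) as [f [Hf [Hf0 ->]]]. eapply flow_to_tip_ccont; eassumption.
  + intros t r Hr Ht. destruct (HW t ltac:(lra)) as [f [Hf [Hf0 ->]]]. eapply flow_to_tip_cder; eassumption.
  + intros t r Ht Hr. destruct (HW t Ht) as [f [Hf [Hf0 ->]]]. rewrite flow_to_tip_before by assumption.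
    eapply swallowed_Im_pos; eassumption.
  + intros t r Ht Hr. destruct (HW t Ht) as [f [Hf [Hf0 ->]]].
    apply (flow_to_tip_Im_lower t T M l f r D s1); try assumption; try lra. reflexivity.
  + intros t r Ht Hr. destruct (HW t Ht) as [f [Hf [Hf0 ->]]].
    apply (flow_to_tip_Cmod t T M l); try assumption; lra.
  + intros t r Ht Hr. destruct (HW t Ht) as [f [Hf [Hf0 ->]]].
    apply (flow_to_tip_square t T M l); try assumption; lra.
- intros t Ht. destruct (HW t Ht) as [f [Hf [Hf0 ->]]].
  rewrite flow_to_tip_before, Hf0 by lra. ring.
Qed.

Lemma C1_holder_derive_on a T delta K (F F' phi : R -> C) c : 0 < delta -> 0 < K ->
  C1_holder a T delta K F F' ->
  (forall t, a <= t <= T -> phi t = (c + F t)%C) ->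
  forall t, Icc a T t -> is_derive_on (V := CR) a T phi t (F' t).
Proof.
intros Hd HK [_ H] Hphi t Ht. apply is_derive_on_C_eps; [assumption|].
intros eps He.
destruct (pw_small delta Hd (eps / K) ltac:(now apply Rdiv_lt_0_compat)) as [d [Hd0 Hp]].
exists d. split; [assumption|]. intros y Hy Hyt. rewrite !Hphi by assumption.
replace (c + F y - (c + F t) - RtoC (y - t) * F' t)%C with (F y - F t - RtoC (y - t) * F' t)%C by ring.
eapply Rle_trans; [now apply H|].
specialize (Hp _ Hyt). apply (Rmult_lt_compat_l K) in Hp; [|assumption].
replace (K * (eps / K)) with eps in Hp by (field; lra).
rewrite (Rmult_comm (Rabs _)), <- Rmult_assoc. apply Rmult_le_compat_r; [apply Rabs_pos|lra].
Qed.

(** Add the expansions of [F] from [t] to [s] and from [s] to [t]. *)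
Lemma C1_holder_derivative_holder a T delta K F F' t s :
  C1_holder a T delta K F F' -> a <= t <= T -> a <= s <= T -> t <> s ->
  Cmod (F' t - F' s) <= 2 * K * pw delta (Rabs (t - s)).
Proof.
intros [_ H] Ht Hs Hne.
assert (Hp : 0 < Rabs (t - s)) by (apply Rabs_pos_lt; lra).
pose proof (H t s Ht Hs) as H1. pose proof (H s t Hs Ht) as H2.
rewrite (Rabs_minus_sym s t) in H1.
apply (Rmult_le_reg_l (Rabs (t - s))); [assumption|].
replace (Rabs (t - s) * Cmod (F' t - F' s)) with (Cmod (RtoC (t - s) * (F' t - F' s))) by (rewrite Cmod_mult, Cmod_R; reflexivity).
replace (RtoC (t - s) * (F' t - F' s))%C with
  ((F s - F t - RtoC (s - t) * F' t) + (F t - F s - RtoC (t - s) * F' s))%C by (rewrite !RtoC_minus; ring).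
eapply Rle_trans; [apply Cmod_plus_le; eassumption|]. lra.
Qed.

Theorem theorem6p2 :
  forall T M delta a : R,
    0 < T -> 0 < M -> 0 < delta <= 1 / 2 -> 0 < a < T ->
    exists N : R, 0 < N /\
      forall (lambda : R -> R) (gamma : R -> C),
        Rbar_le (holder_seminorm (V := R_NormedModule) 0 T (1 / 2) lambda) 1 ->
        C_class (V := R_CompleteNormedModule) 0 T 1 (1 / 2 + delta) lambda ->
        Rbar_le (C_norm (V := R_CompleteNormedModule) 0 T 1 (1 / 2 + delta) lambda) M ->
        generates_slit T lambda gamma ->
        C_regular (V := CR) a T 2 delta gamma /\
        Rbar_le (C_norm (V := CR) a T 2 delta gamma) N /\
        Rbar_le (/ N) (inf_norm_on (V := CR) a T (Derive_on (V := CR) a T gamma)).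
Proof.
intros T M delta a HT HM Hd Ha.
destruct (slit_tip_flow T M delta HT HM Hd) as [b [B [D [Hp Hflow]]]].
destruct (tip_is_C2 Hp Ha) as [N [HN Htip]].
exists (M + 5 * N). split; [lra|].
intros lambda gamma _ Hcl Hn Hslit.
destruct (Hflow lambda gamma Hcl Hn Hslit) as [Hl0 [lam [l [W [HW Hgam]]]]].
destruct (Htip lam l W HW) as [V [A [CV [CA HV]]]].
assert (HaT : a < T) by lra.
assert (Hg : forall t, a <= t <= T -> gamma t = (RtoC (lambda 0) + W t 0)%C) by (intros; apply Hgam; lra).
assert (D1 : forall t, Icc a T t -> is_derive_on (V := CR) a T gamma t (V t)).
{ apply (C1_holder_derive_on a T delta N (fun t => W t 0) V gamma (RtoC (lambda 0))); try assumption; lra. }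
assert (E1 : forall t, Icc a T t -> Derive_on (V := CR) a T gamma t = V t).
{ intros t Ht. apply (Derive_on_eq (V := CR)); auto. }
assert (D2 : forall t, Icc a T t -> is_derive_on (V := CR) a T (Derive_on (V := CR) a T gamma) t (A t)).
{ apply (C1_holder_derive_on a T delta N V A _ (RtoC 0)); try assumption; try lra.
  intros t Ht. rewrite E1 by assumption. ring. }
assert (E2 : forall t, Icc a T t -> Derive_on (V := CR) a T (Derive_on (V := CR) a T gamma) t = A t).
{ intros t Ht. apply (Derive_on_eq (V := CR)); auto. }
assert (S0 : Rbar_le (sup_norm_on (V := CR) a T gamma) (M + N)).
{ apply Lub_le. intros y [t [Ht ->]]. rewrite norm_C, Hg by exact Ht.
  apply Cmod_plus_le; [now rewrite Cmod_R|]. now apply CV. }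
assert (S1 : Rbar_le (sup_norm_on (V := CR) a T (Derive_on (V := CR) a T gamma)) N).
{ apply Lub_le. intros y [t [Ht ->]]. rewrite norm_C, E1 by exact Ht. now apply CV. }
assert (S2 : Rbar_le (sup_norm_on (V := CR) a T (Derive_on (V := CR) a T (Derive_on (V := CR) a T gamma))) N).
{ apply Lub_le. intros y [t [Ht ->]]. rewrite norm_C, E2 by exact Ht. now apply CA. }
assert (S3 : Rbar_le (holder_seminorm (V := CR) a T delta (Derive_on (V := CR) a T (Derive_on (V := CR) a T gamma))) (2 * N)).
{ apply Lub_le. intros y [t [s [Ht [Hs [Hne ->]]]]]. rewrite norm_C, !E2 by assumption.
  pose proof (C1_holder_derivative_holder _ _ _ _ _ _ t s CA Ht Hs Hne) as Hh.
  assert (Hpos : 0 < Rabs (t - s)) by (apply Rabs_pos_lt; lra).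
  rewrite pw_gt0 in Hh by assumption.
  assert (Hr : 0 < Rpower (Rabs (t - s)) delta) by apply exp_pos.
  apply (Rmult_le_reg_r (Rpower (Rabs (t - s)) delta)); [assumption|].
  unfold Rdiv. rewrite Rmult_assoc, Rinv_l, Rmult_1_r by lra. exact Hh. }
assert (HC : exists r, C_norm (V := CR) a T 2 delta gamma = Finite r /\ r <= M + 5 * N).
{ destruct (Rbar_finite_between _ _ (sup_norm_nonneg (V := CR) a T _ HaT) S0) as [r0 [R0 B0]].
  destruct (Rbar_finite_between _ _ (sup_norm_nonneg (V := CR) a T _ HaT) S1) as [r1 [R1 B1]].
  destruct (Rbar_finite_between _ _ (sup_norm_nonneg (V := CR) a T _ HaT) S2) as [r2 [R2 B2]].
  destruct (Rbar_finite_between _ _ (holder_nonneg (V := CR) a T delta _ HaT) S3) as [r3 [R3 B3]].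
  exists (r0 + r1 + r2 + r3). split; [|lra].
  unfold C_norm. simpl. rewrite R0, R1, R2, R3. reflexivity. }
destruct HC as [r [HC Hr]].
split; [split; [split|]|split].
- intros k t Hk Ht. destruct k as [|[|k]].
  + exists (V t). now apply D1.
  + exists (A t). now apply D2.
  + exfalso. lia.
- rewrite HC. reflexivity.
- intros t Ht. rewrite E1 by assumption. intros E. specialize (HV t Ht).
  rewrite E in HV. assert (0 < / N) by now apply Rinv_0_lt_compat.
  change (zero : CR) with (RtoC 0) in HV. rewrite Cmod_0 in HV. lra.
- rewrite HC. exact Hr.
- apply (proj2 (Glb_Rbar_correct _)). intros y [t [Ht ->]]. rewrite norm_C, E1 by assumption.
  apply Rle_trans with (/ N); [|now apply HV]. apply Rinv_le_contravar; lra.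
Qed.
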